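(* Let $R\subset S$ be an FCP extension of rings, let $\overline R$ be the integral closure of $R$ in $S$, and let ${}_{\overline R}^+R$ and ${}_{\overline R}^tR$ be the seminormalization and the $t$-closure of $R$ in $\overline R$. Then $R\subset S$ is a $\Delta$-extension if and only if the following two conditions hold: (1) $R\subseteq{}_{\overline R}^+R$, ${}_{\overline R}^+R\subseteq{}_{\overline R}^tR$ and ${}_{\overline R}^tR\subseteq\overline R$ are $\Delta$-extensions (the last of these being equivalent to ${}_{\overline R}^tR\subseteq\overline R$ being arithmetic); (2) for all $T,U,V\in[R,\overline R]$ such that $T\subset U$ and $T\subset V$ are minimal extensions of different types, $T\subset UV$ is a $B_2$-extension.
   Context: All rings are commutative and unital. For a ring extension $R\subseteq S$, $[R,S]$ denotes the set of all $R$-subalgebras of $S$, ordered by inclusion; it is a lattice with infimum the intersection and supremum the compositum $TU$. The extension is FCP if every chain in $[R,S]$ is finite. It is a $\Delta$-extension if $T+U\in[R,S]$ for all $T,U\in[R,S]$ (equivalently $T+U=TU$). It is chained if $[R,S]$ is totally ordered by inclusion, and arithmetic if $R_P\subseteq S_P$ is chained for each $P\in\mathrm{Spec}(R)$. It is $t$-closed if $b\in S$, $r\in R$, $b^2-rb\in R$, $b^3-rb^2\in R$ imply $b\in R$, and seminormal if $b\in S$, $b^2\in R$, $b^3\in R$ imply $b\in R$. The $t$-closure ${}_S^tR$ (resp. seminormalization ${}_S^+R$) of $R$ in $S$ is the smallest $B\in[R,S]$ such that $B\subseteq S$ is $t$-closed (resp. seminormal). An extension $R\subset T$ is minimal if $[R,T]=\{R,T\}$.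 An integral minimal extension $R\subset T$ has conductor $M:=(R:T)\in\mathrm{Max}(R)$ and is of exactly one of three types: inert, if $M\in\mathrm{Max}(T)$ and $R/M\to T/M$ is a minimal field extension; decomposed, if there are distinct $M_1,M_2\in\mathrm{Max}(T)$ with $M=M_1\cap M_2$ and $R/M\to T/M_1$, $R/M\to T/M_2$ isomorphisms; ramified, if there is $M'\in\mathrm{Max}(T)$ with $M'^2\subseteq M\subset M'$, $[T/M:R/M]=2$ and $R/M\to T/M'$ an isomorphism. The length $\ell[R,S]$ is the supremum of the lengths of chains in $[R,S]$ (a chain with $n+1$ elements having length $n$). A $B_2$-extension is an extension $R\subset S$ with $\ell[R,S]=2$ and $|[R,S]|=4$. *)

(* Defs.v *)
From HB Require Import structures.
From mathcomp Require Import all_boot all_algebra ring.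
From mathcomp Require Import boolp classical_sets functions cardinality.

Set Implicit Arguments.
Unset Strict Implicit.
Unset Printing Implicit Defensive.

Import GRing.Theory.
Local Open Scope ring_scope.
Local Open Scope classical_set_scope.
Local Open Scope card_scope.
Local Open Scope quotient_scope.

Record subring (S : comNzRingType) := Subring {
  subring_set :> set S;
  subring_setP : subring_closed [pred x | x \in subring_set] }.

Lemma subring_inj (S : comNzRingType) (A B : subring S) :
  A = B :> set S -> A = B.
Proof.
case: A B => [A hA] [B hB] /= eqAB; subst B.
by congr Subring; exact: Prop_irrelevance.
Qed.

Section SubringType.
Variables (S : comNzRingType) (A : subring S).

Definition subring_pred : {pred S} := [pred x | x \in subring_set A].

HB.instance Definition _ :=
  GRing.isSubringClosed.Build S subring_pred (subring_setP A).

Record subring_type := SubringElt {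
  subring_val : S; _ : subring_val \in subring_pred }.

HB.instance Definition _ := [isSub for subring_val].
HB.instance Definition _ := [Choice of subring_type by <:].
HB.instance Definition _ :=
  [SubChoice_isSubComNzRing of subring_type by <:].
End SubringType.

Section Lattice.
Variable S : comNzRingType.
Implicit Types (lo hi : set S) (A B T U W : subring S) (C : set (subring S)).

(* [lo, hi]: the bounds are mere sets, so that [setT] and the images of ring
   morphisms (e.g. the image of R_P in S_P) can be used as bounds. *)
Definition subexts lo hi : set (subring S) :=
  [set T : subring S | lo `<=` T /\ (T : set S) `<=` hi].

Definition is_chain lo hi C : Prop :=
  C `<=` subexts lo hi /\
  forall T U, C T -> C U -> (T : set S) `<=` U \/ (U : set S) `<=` T.

Definition fcp lo hi : Prop := forall C, is_chain lo hi C -> finite_set C.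

Definition chained lo hi : Prop := is_chain lo hi (subexts lo hi).

Definition delta lo hi : Prop :=
  forall T U, subexts lo hi T -> subexts lo hi U ->
  exists2 W, subexts lo hi W &
    W = [set t + u | t in T & u in U] :> set S.

Definition minimal lo hi : Prop :=
  lo `<` hi /\
  forall T, subexts lo hi T -> (T = lo :> set S) \/ (T = hi :> set S).

Definition has_length lo hi (n : nat) : Prop :=
  (exists2 C, is_chain lo hi C & C #= `I_n.+1) /\
  forall C (m : nat), is_chain lo hi C -> C #= `I_m.+1 -> (m <= n)%N.

Definition B2 lo hi : Prop := has_length lo hi 2 /\ subexts lo hi #= `I_4.

Fact bigcap_subring_closed C :
  subring_closed [pred x | x \in (\bigcap_(T in C) (T : set S))].
Proof.
split=> [|x y|x y]; rewrite !inE.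
- by move=> T _; have [h _ _] := subring_setP T; move: h; rewrite !inE.
- move=> hx hy T CT; have [_ h _] := subring_setP T; move: (h x y).
  by rewrite !inE; apply; [exact: hx|exact: hy].
- move=> hx hy T CT; have [_ _ h] := subring_setP T; move: (h x y).
  by rewrite !inE; apply; [exact: hx|exact: hy].
Qed.

Definition bigcap_subring C : subring S := Subring (bigcap_subring_closed C).

Definition compositum T U : subring S :=
  bigcap_subring [set W : subring S |
                   (T : set S) `<=` W /\ (U : set S) `<=` W].

Lemma compositum_sup T U :
  [/\ (T : set S) `<=` compositum T U, (U : set S) `<=` compositum T U
    & forall W, (T : set S) `<=` W -> (U : set S) `<=` W ->
        (compositum T U : set S) `<=` W].
Proof.
split=> [x Tx W [sTW _]|x Ux W [_ sUW]|W sTW sUW x hx].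
- exact: sTW.
- exact: sUW.
- by apply: (hx W).
Qed.

Definition seminormal A B : Prop :=
  forall b, subring_set B b ->
    subring_set A (b ^+ 2) -> subring_set A (b ^+ 3) -> subring_set A b.

Definition tclosed A B : Prop :=
  forall b r, subring_set B b -> subring_set A r ->
    subring_set A (b ^+ 2 - r * b) -> subring_set A (b ^+ 3 - r * b ^+ 2) ->
    subring_set A b.

Definition seminormalization A B : subring S :=
  bigcap_subring [set T | subexts A B T /\ seminormal T B].

Definition tclosure A B : subring S :=
  bigcap_subring [set T | subexts A B T /\ tclosed T B].

Lemma seminormalization_least A B : (A : set S) `<=` B ->
  [/\ subexts A B (seminormalization A B),
      seminormal (seminormalization A B) B
    & forall T, subexts A B T -> seminormal T B ->
        (seminormalization A B : set S) `<=` T].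
Proof.
move=> sAB; split=> [|b Bb h2 h3 T CT|T iT sT x]; last by apply.
- split=> [x Ax T [[sAT _] _]|x hx]; first exact: sAT.
  by apply: (hx B); split=> [|b Bb _ _]; first by split.
- by case: (CT) => _ sT; apply: sT => //; [exact: h2|exact: h3].
Qed.

Lemma tclosure_least A B : (A : set S) `<=` B ->
  [/\ subexts A B (tclosure A B),
      tclosed (tclosure A B) B
    & forall T, subexts A B T -> tclosed T B ->
        (tclosure A B : set S) `<=` T].
Proof.
move=> sAB; split=> [|b r Bb hr h2 h3 T CT|T iT sT x]; last by apply.
- split=> [x Ax T [[sAT _] _]|x hx]; first exact: sAT.
  by apply: (hx B); split=> [|b r Bb _ _ _]; first by split.
- case: (CT) => _ sT.
  by apply: (sT b r) => //; [exact: hr|exact: h2|exact: h3].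
Qed.

Fact integral_closure_subring_closed A :
  subring_closed
    [pred x | x \in [set z : S | integralOver (val : subring_type A -> S) z]].
Proof.
pose f : {rmorphism subring_type A -> S} := val.
split=> [|x y|x y]; rewrite !inE /=.
- exact: (integral1 f).
- exact: (@integral_sub _ _ f).
- exact: (@integral_mul _ _ f).
Qed.

Definition integral_closure A : subring S :=
  Subring (integral_closure_subring_closed A).

(* Since 1 is in B, (A : B) is contained in A. *)
Definition conductor A B : set S :=
  [set x | forall y, subring_set B y -> subring_set A (x * y)].

End Lattice.

Definition maximal_ideal (Q : comNzRingType) (I : idealr Q) : Prop :=
  forall J : idealr Q, {subset I <= J} -> {subset J <= I}.

Section ExtensionTypes.
Variables (S : comNzRingType) (A B : subring S).

Definition carries (C : subring S) (I : idealr (subring_type C)) (X : set S) :=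
  forall x : subring_type C, x \in I <-> X (val x).

(* [f] is the map A/M -> B/N induced by the inclusion of A in B. *)
Definition canonical_map (M : idealr (subring_type A))
    (N : idealr (subring_type B)) (f : {ideal_quot M} -> {ideal_quot N}) :=
  forall (a : subring_type A) (b : subring_type B),
    val a = val b -> f (\pi a) = \pi b.

Definition canonical_iso (M : idealr (subring_type A))
    (N : idealr (subring_type B)) : Prop :=
  exists2 f : {rmorphism {ideal_quot M} -> {ideal_quot N}},
    canonical_map f & bijective f.

Definition inert : Prop :=
  exists (M : idealr (subring_type A)) (N : idealr (subring_type B))
         (f : {rmorphism {ideal_quot M} -> {ideal_quot N}}),
    [/\ carries M (conductor A B) /\ carries N (conductor A B),
        maximal_ideal M, maximal_ideal N, canonical_map f
      & minimal (range f) setT].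

Definition decomposed : Prop :=
  exists (M : idealr (subring_type A)) (M1 M2 : idealr (subring_type B)),
    [/\ carries M (conductor A B) /\ maximal_ideal M,
        maximal_ideal M1 /\ maximal_ideal M2,
        ~ (M1 =i M2),
        forall x : subring_type B,
          conductor A B (val x) <-> x \in M1 /\ x \in M2
      & canonical_iso M M1 /\ canonical_iso M M2].

(* Here N is the conductor seen as an ideal of B; since the ideal N is closed
   under addition, M'^2 is contained in N as soon as products of two elements
   of M' are.  The dimension is stated by a basis (x, y) of
   B/N over A/M. *)
Definition ramified : Prop :=
  exists (M : idealr (subring_type A)) (N M' : idealr (subring_type B))
         (f : {rmorphism {ideal_quot M} -> {ideal_quot N}}),
    [/\ [/\ carries M (conductor A B), carries N (conductor A B),
            maximal_ideal M & maximal_ideal M'],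
        forall x y, x \in M' -> y \in M' -> x * y \in N,
        {subset N <= M'} /\ ~ {subset M' <= N},
        canonical_map f /\
        exists x y : {ideal_quot N}, forall z : {ideal_quot N},
          exists! c : {ideal_quot M} * {ideal_quot M},
            z = f c.1 * x + f c.2 * y
      & canonical_iso M M'].

End ExtensionTypes.

Variant ext_type := Inert | Decomposed | Ramified.

(* Meaningful when A `<=` B is an integral minimal extension; it is then of
   exactly one type. *)
Definition of_type (S : comNzRingType) (k : ext_type) (A B : subring S) :=
  match k with
  | Inert => inert A B
  | Decomposed => decomposed A B
  | Ramified => ramified A B
  end.

Record mulset (Q : comNzRingType) := Mulset {
  mulset_set :> set Q;
  mulset1 : mulset_set 1;
  mulsetM : forall s t, mulset_set s -> mulset_set t -> mulset_set (s * t);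
  mulset0 : ~ mulset_set 0 }.

Section Localization.
Variables (Q : comNzRingType) (D : mulset Q).

Record denom := Denom { dval : Q; _ : dval \in (D : set Q) }.
HB.instance Definition _ := [isSub for dval].
HB.instance Definition _ := [Choice of denom by <:].

Lemma denomP (s : denom) : mulset_set D (dval s).
Proof. exact: set_mem (valP s). Qed.

Definition denom1 : denom := Denom (mem_set (mulset1 D)).
Definition denomM (s t : denom) : denom :=
  Denom (mem_set (mulsetM (denomP s) (denomP t))).

Definition loc_rel : rel (Q * denom) := fun p q =>
  `[< exists u : denom, dval u * (dval q.2 * p.1 - dval p.2 * q.1) = 0 >].

Fact loc_rel_refl : reflexive loc_rel.
Proof. by move=> p; apply/asboolP; exists denom1; rewrite subrr mulr0. Qed.

Fact loc_rel_sym : symmetric loc_rel.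
Proof.
by move=> p q; apply/asboolP/asboolP => -[u hu]; exists u;
  rewrite -opprB mulrN hu oppr0.
Qed.

Fact loc_rel_trans : transitive loc_rel.
Proof.
move=> q p r /asboolP[u hu] /asboolP[v hv]; apply/asboolP.
exists (denomM (denomM u v) q.2) => /=.
rewrite (_ : _ * _ =
    dval v * dval r.2 * (dval u * (dval q.2 * p.1 - dval p.2 * q.1))
  + dval u * dval p.2 * (dval v * (dval r.2 * q.1 - dval q.2 * r.1)));
  last by ring.
by rewrite hu hv !mulr0 addr0.
Qed.

Canonical loc_equiv := EquivRel loc_rel loc_rel_refl loc_rel_sym loc_rel_trans.
Canonical loc_encModRel := defaultEncModRel loc_rel.

Definition loc := {eq_quot loc_rel}.

HB.instance Definition _ := EqQuotient.on loc.
HB.instance Definition _ := Choice.on loc.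

Definition frac (x : Q) (s : denom) : loc := \pi_loc (x, s).

Lemma eq_frac x s y t :
  frac x s = frac y t <->
  exists u : denom, dval u * (dval t * x - dval s * y) = 0.
Proof.
by split=> [/eqmodP/asboolP|h]; last by apply/eqmodP/asboolP.
Qed.

Lemma fracP (a : loc) : exists x s, a = frac x s.
Proof. by elim/quotW: a => -[x s]; exists x, s. Qed.

Definition loc_add (a b : loc) : loc :=
  frac (dval (repr b).2 * (repr a).1 + dval (repr a).2 * (repr b).1)
       (denomM (repr a).2 (repr b).2).
Definition loc_opp (a : loc) : loc := frac (- (repr a).1) (repr a).2.
Definition loc_mul (a b : loc) : loc :=
  frac ((repr a).1 * (repr b).1) (denomM (repr a).2 (repr b).2).

Lemma repr_frac x s :
  exists u : denom, dval u * (dval s * (repr (frac x s)).1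
                             - dval (repr (frac x s)).2 * x) = 0.
Proof. by apply/eq_frac; rewrite {3}/frac -[RHS]reprK; case: (repr _). Qed.

Lemma loc_addE x s y t :
  loc_add (frac x s) (frac y t) = frac (dval t * x + dval s * y) (denomM s t).
Proof.
have [u hu] := repr_frac x s; have [v hv] := repr_frac y t.
rewrite /loc_add; move: (repr (frac x s)) (repr (frac y t)) hu hv.
move=> [x' s'] [y' t'] /= hu hv; apply/eq_frac; exists (denomM u v) => /=.
transitivity (dval v * dval t * dval t' * (dval u * (dval s * x' - dval s' * x))
  + dval u * dval s * dval s' * (dval v * (dval t * y' - dval t' * y)));
  first by ring.
by rewrite hu hv !mulr0 addr0.
Qed.

Lemma loc_oppE x s : loc_opp (frac x s) = frac (- x) s.
Proof.
have [u hu] := repr_frac x s.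
rewrite /loc_opp; move: (repr (frac x s)) hu => [x' s'] /= hu.
apply/eq_frac; exists u => /=.
transitivity (- (dval u * (dval s * x' - dval s' * x)));
  first by ring.
by rewrite hu oppr0.
Qed.

Lemma loc_mulE x s y t :
  loc_mul (frac x s) (frac y t) = frac (x * y) (denomM s t).
Proof.
have [u hu] := repr_frac x s; have [v hv] := repr_frac y t.
rewrite /loc_mul; move: (repr (frac x s)) (repr (frac y t)) hu hv.
move=> [x' s'] [y' t'] /= hu hv; apply/eq_frac; exists (denomM u v) => /=.
transitivity (dval v * dval t * y' * (dval u * (dval s * x' - dval s' * x))
  + dval u * dval s' * x * (dval v * (dval t * y' - dval t' * y)));
  first by ring.
by rewrite hu hv !mulr0 addr0.
Qed.

Let eq_frac1 x s y t : dval t * x = dval s * y -> frac x s = frac y t.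
Proof. by move=> h; apply/eq_frac; exists denom1; rewrite h subrr mulr0. Qed.

Fact loc_addA : associative loc_add.
Proof.
move=> a b c; have [x [s ->]] := fracP a; have [y [t ->]] := fracP b.
by have [z [w ->]] := fracP c; rewrite !loc_addE; apply: eq_frac1 => /=; ring.
Qed.

Fact loc_addC : commutative loc_add.
Proof.
move=> a b; have [x [s ->]] := fracP a; have [y [t ->]] := fracP b.
by rewrite !loc_addE; apply: eq_frac1 => /=; ring.
Qed.

Fact loc_add0 : left_id (frac 0 denom1) loc_add.
Proof.
move=> a; have [x [s ->]] := fracP a.
by rewrite !loc_addE; apply: eq_frac1 => /=; ring.
Qed.

Fact loc_addN : left_inverse (frac 0 denom1) loc_opp loc_add.
Proof.
move=> a; have [x [s ->]] := fracP a.
by rewrite loc_oppE !loc_addE; apply: eq_frac1 => /=; ring.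
Qed.

HB.instance Definition _ :=
  GRing.isZmodule.Build loc loc_addA loc_addC loc_add0 loc_addN.

Fact loc_mulA : associative loc_mul.
Proof.
move=> a b c; have [x [s ->]] := fracP a; have [y [t ->]] := fracP b.
by have [z [w ->]] := fracP c; rewrite !loc_mulE; apply: eq_frac1 => /=; ring.
Qed.

Fact loc_mulC : commutative loc_mul.
Proof.
move=> a b; have [x [s ->]] := fracP a; have [y [t ->]] := fracP b.
by rewrite !loc_mulE; apply: eq_frac1 => /=; ring.
Qed.

Fact loc_mul1 : left_id (frac 1 denom1) loc_mul.
Proof.
move=> a; have [x [s ->]] := fracP a.
by rewrite !loc_mulE; apply: eq_frac1 => /=; ring.
Qed.

Fact loc_mulD : left_distributive loc_mul +%R.
Proof.
move=> a b c; have [x [s ->]] := fracP a; have [y [t ->]] := fracP b.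
have [z [w ->]] := fracP c; rewrite /GRing.add /= !(loc_mulE, loc_addE).
by apply: eq_frac1 => /=; ring.
Qed.

Fact loc_1neq0 : frac 1 denom1 != 0.
Proof.
apply/eqP => /eq_frac [u] /=; rewrite !mulr1 mulr0 subr0 mulr1 => u0.
by apply: (@mulset0 _ D); rewrite -u0; exact: denomP.
Qed.

HB.instance Definition _ := GRing.Zmodule_isComNzRing.Build loc
  loc_mulA loc_mulC loc_mul1 loc_mulD loc_1neq0.

End Localization.

Section Arithmetic.
Variables (S : comNzRingType) (A B : subring S).

Section AtPrime.
Variable P : prime_idealr (subring_type A).

Definition prime_compl_set : set (subring_type B) :=
  [set s | exists2 a : subring_type A, a \notin P & val a = val s].

Fact prime_compl1 : prime_compl_set 1.
Proof. by exists 1; rewrite ?idealr1. Qed.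

Fact prime_complM s t :
  prime_compl_set s -> prime_compl_set t -> prime_compl_set (s * t).
Proof.
move=> [a aP eas] [b bP ebt]; exists (a * b).
  by rewrite prime_idealrM negb_or aP bP.
by rewrite !rmorphM /= eas ebt.
Qed.

Fact prime_compl0 : ~ prime_compl_set 0.
Proof.
move=> [a aP]; rewrite rmorph0 => a0.
by move: aP; rewrite (_ : a = 0) ?idealr0 //; apply/val_inj; rewrite rmorph0.
Qed.

Definition prime_compl : mulset (subring_type B) :=
  Mulset prime_compl1 prime_complM prime_compl0.

(* B_P is the localization of B at the image of A \ P, and this is the image
   of A_P in B_P. *)
Definition local_base : set (loc prime_compl) :=
  [set z | exists (x : subring_type B) (s : denom prime_compl),
             subring_set A (val x) /\ z = frac x s].

End AtPrime.

Definition arithmetic : Prop :=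
  forall P : prime_idealr (subring_type A), chained (@local_base P) setT.

End Arithmetic.

(* Main.v *)
(** The property is local in the lattice: by the modular law, minimality
    survives the addition of a minimal extension, so R <= S is a Delta-extension as
    soon as [U + V] is a ring for any two minimal extensions [U], [V] of a common
    [T]. If [U] and [V] have distinct conductors this always holds. If one of them is
    not integral, then it is Pruefer over [T] (1 = i + j t with i, j, i t, j t in [T]),
    and again [U + V] is a ring; this reduces everything to the integral closure.
    There, modulo a common conductor, [U] and [V] are algebras over the field [T/M],
    and an inert [U] together with a non-inert [V] generates too large a lattice.
    Two ramified extensions are generated by elements of the seminormalization, because
    seminormality passes from [A <= U] to [T <= U] for [A <= T] (the conductor is
    radical and the quotients are von Neumann regular); the other equal-type pairs are
    handled by moving up along a minimal extension [N] of [T] of lower type, over which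
    the sum is a ring by induction, until the base contains the relevant closure.
    Finally, two distinct inert extensions with the same conductor never have a sum
    that is a ring, by comparing dimensions, which is why Delta and arithmetic
    coincide over the t-closure. *)
From HB Require Import structures.
Require Import Defs.
From mathcomp Require Import all_boot all_algebra ring.
From mathcomp Require Import boolp classical_sets functions cardinality.
Set Implicit Arguments.
Unset Strict Implicit.
Unset Printing Implicit Defensive.
Import GRing.Theory.
Local Open Scope ring_scope.
Local Open Scope classical_set_scope.

(** Besides induction along chains, FCP is used only through two descending chains. Stability of
    [A + a^n B] shows, with no finiteness of the integral extension assumed, that [A] modulo its
    conductor is zero-dimensional: hence the conductor of a minimal integral extension is maximal,
    and a radical conductor gives the regularity that carries seminormality and t-closedness to a
    larger base. Stability of [A[t^(2^k)]] gives the Pruefer relation. Residue rings are avoided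
    until the formal types must be matched: an inverse of [a] modulo the conductor is an [a'] with
    [1 - a a'] in it, and a non-inert minimal integral extension is [T + T y] with [y (y - l)] in
    the conductor, [l] being 0 or 1. Condition (2) is effective because an obstruction to the sum
    being a ring yields a fifth intermediate ring: [T + U y] for an inert [U], [T + T e x] for an
    idempotent [e] and a nilpotent [x] modulo the conductor. The residue characteristic may be 2, so
    identities with coefficients 2 and 4 replace division. *)

Local Notation "x '\isin' T" := (subring_set T x) (at level 70).
Local Notation "T '<<=' U" := (subring_set T `<=` subring_set U) (at level 70).

(** * Subrings, minimal extensions and the FCP condition *)

Section SubringOps.
Variable S : comNzRingType.
Implicit Types (A B T U V W : subring S) (x y : S).

Lemma sr1 T : 1 \isin T.
Proof. by apply: set_mem; exact: (rpred1 (subring_pred T)). Qed.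
Lemma sr0 T : 0 \isin T.
Proof. by apply: set_mem; exact: (rpred0 (subring_pred T)). Qed.
Lemma srD T x y : x \isin T -> y \isin T -> x + y \isin T.
Proof.
by move=> /mem_set hx /mem_set hy; apply: set_mem; exact: (@rpredD _ (subring_pred T)).
Qed.
Lemma srN T x : x \isin T -> - x \isin T.
Proof.
by move=> /mem_set hx; apply: set_mem; rewrite -[_ \in _]/(- x \in subring_pred T) rpredN.
Qed.
Lemma srB T x y : x \isin T -> y \isin T -> x - y \isin T.
Proof. by move=> hx hy; apply: srD => //; exact: srN. Qed.
Lemma srM T x y : x \isin T -> y \isin T -> x * y \isin T.
Proof.
by move=> /mem_set hx /mem_set hy; apply: set_mem; exact: (@rpredM _ (subring_pred T)).
Qed.
Lemma srX T x n : x \isin T -> x ^+ n \isin T.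
Proof.
by move=> /mem_set hx; apply: set_mem; exact: (@rpredX _ (subring_pred T)).
Qed.
Lemma sr_sum T I (r : seq I) (P : pred I) (F : I -> S) :
  (forall i, P i -> F i \isin T) -> \sum_(i <- r | P i) F i \isin T.
Proof. by move=> h; elim/big_ind: _ => //; [exact: sr0|exact: srD]. Qed.

Lemma srMn T x n : x \isin T -> x *+ n \isin T.
Proof.
by move=> hx; elim: n => [|n IH]; [exact: sr0|rewrite mulrS; exact: srD].
Qed.

Lemma subring_intro (X : set S) : X 1 ->
  (forall x y, X x -> X y -> X (x - y)) ->
  (forall x y, X x -> X y -> X (x * y)) ->
  exists W, subring_set W = X.
Proof.
move=> h1 hB hM; suff h : subring_closed [pred x | x \in X] by exists (Subring h).
by split=> [|x y|x y]; rewrite !inE; [exact: h1|exact: hB|exact: hM].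
Qed.

Lemma subring_le_anti T U : T <<= U -> U <<= T -> T = U.
Proof. by move=> h1 h2; apply/subring_inj/seteqP. Qed.

Lemma inter_subring T U : exists W, forall x, x \isin W <-> x \isin T /\ x \isin U.
Proof.
have [|x y [? ?] [? ?]|x y [? ?] [? ?]|W eW] :=
  @subring_intro (fun x => x \isin T /\ x \isin U).
- by split; exact: sr1.
- by split; exact: srB.
- by split; exact: srM.
- by exists W => x; rewrite eW.
Qed.

Lemma top_subring : exists W : subring S, subring_set W = [set: S].
Proof. by apply: subring_intro. Qed.

(** Source of the rings [A + a B], [T + T y] and [T + U y] used below. *)
Lemma add_subring T (J : set S) : J 0 ->
  (forall x y, J x -> J y -> J (x - y)) ->
  (forall t x, t \isin T -> J x -> J (t * x)) ->
  (forall x y, J x -> J y -> exists t j, [/\ t \isin T, J j & x * y = t + j]) ->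
  exists W, forall x, x \isin W <-> exists t j, [/\ t \isin T, J j & x = t + j].
Proof.
move=> J0 JB JT JJ.
have JD x y : J x -> J y -> J (x + y).
  by move=> hx hy; rewrite -[y]opprK; apply: (JB) => //; rewrite -sub0r; apply: JB.
have [|x y [t [j [ht hj ->]]] [t' [j' [ht' hj' ->]]]
      |x y [t [j [ht hj ->]]] [t' [j' [ht' hj' ->]]]|W eW] :=
  @subring_intro (fun x => exists t j, [/\ t \isin T, J j & x = t + j]).
- by exists 1, 0; split=> //; [exact: sr1|rewrite addr0].
- by exists (t - t'), (j - j'); split; [exact: srB|exact: JB|ring].
- have [s [i [hs hi e]]] := JJ _ _ hj hj'.
  exists (t * t' + s), (t * j' + t' * j + i); split; first by apply: srD => //; exact: srM.
    by apply: (JD) => //; apply: JD; exact: JT.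
  by transitivity (t * t' + t * j' + t' * j + j * j'); [ring|rewrite e; ring].
- by exists W => x; rewrite eW.
Qed.

(** Only mixed products need testing, since [T] and [U] are closed under their own products; this is
    the Delta condition for one pair, stated without a third subring. *)
Definition sumring T U := forall t u, t \isin T -> u \isin U ->
  exists t' u', [/\ t' \isin T, u' \isin U & t * u = t' + u'].

Lemma sumring_sym T U : sumring T U -> sumring U T.
Proof.
move=> h u t hu ht; have [t' [u' [? ? e]]] := h _ _ ht hu.
by exists u', t'; split; rewrite // mulrC e addrC.
Qed.

Lemma sumringP T U : sumring T U <->
  exists W, forall x, x \isin W <-> exists t u, [/\ t \isin T, u \isin U & x = t + u].
Proof.
split=> [h|[W hW] t u ht hu]; last first.
  have Wt : t \isin W by apply/hW; exists t, 0; split=> //; [exact: sr0|rewrite addr0].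
  have Wu : u \isin W by apply/hW; exists 0, u; split=> //; [exact: sr0|rewrite add0r].
  exact/hW/srM.
have [|x y [t [j [ht hj ->]]] [t' [j' [ht' hj' ->]]]
      |x y [t [j [ht hj ->]]] [t' [j' [ht' hj' ->]]]|W eW] :=
  @subring_intro (fun x => exists t u, [/\ t \isin T, u \isin U & x = t + u]).
- by exists 1, 0; split=> //; [exact: sr1|exact: sr0|rewrite addr0].
- by exists (t - t'), (j - j'); split; [exact: srB|exact: srB|ring].
- have [s [i [hs hi e]]] := h _ _ ht hj'; have [s' [i' [hs' hi' e']]] := h _ _ ht' hj.
  exists (t * t' + s + s'), (j * j' + i + i').
  split; [apply: (srD) => //; apply: srD => //; exact: srM
    |apply: (srD) => //; apply: srD => //; exact: srM|].
  by transitivity (t * t' + t * j' + t' * j + j * j'); [ring|rewrite e e'; ring].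
- by exists W => x; rewrite eW.
Qed.

Lemma deltaP A B : delta A B <-> forall T U, A <<= T -> T <<= B -> A <<= U -> U <<= B ->
  sumring T U.
Proof.
split=> [h T U AT TB AU UB|h T U [AT TB] [AU UB]].
  have [W _ eW] := h T U (conj AT TB) (conj AU UB); apply/sumringP; exists W => x.
  rewrite eW; split=> [[t ht [u hu <-]]|[t [u [ht hu ->]]]]; first by exists t, u.
  by exists t => //; exists u.
have [W hW] := (sumringP T U).1 (h T U AT TB AU UB); exists W.
  split=> [x hx|x /hW[t [u [ht hu ->]]]].
    by apply/hW; exists x, 0; split; [exact: AT|exact: sr0|rewrite addr0].
  by apply: srD; [exact: TB|exact: UB].
apply/seteqP; split=> [x /hW[t [u [ht hu ->]]]|x [t ht [u hu <-]]].
  by exists t => //; exists u.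
by apply/hW; exists t, u.
Qed.

Lemma deltaTP A : delta A [set: S] <-> forall T U, A <<= T -> A <<= U -> sumring T U.
Proof.
have [W eW] := top_subring; rewrite -eW deltaP eW.
by split=> h T U; [move=> *; exact: h|move=> ? _ ? _; exact: h].
Qed.

Definition mini T U := [/\ T <<= U, ~ U <<= T &
  forall W, T <<= W -> W <<= U -> W <<= T \/ U <<= W].

Lemma miniP T U : minimal T U <-> mini T U.
Proof.
split=> [[lt h]|[sTU nUT h]].
  split=> [||W TW WU]; first by case: lt.
    by case: lt.
  by case: (h W (conj TW WU)) => ->; [left|right].
split=> // W [TW WU]; case: (h W TW WU) => h'; [left|right]; exact/seteqP.
Qed.

(** Modular law: for [X] between [V] and [U + V], minimality leaves two choices for the intersection
    of [X] with [U], and this intersection determines [X]. *)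
Lemma sumring_mini T U V : mini T U -> T <<= V -> sumring U V ->
  exists W, [/\ V <<= W, U <<= W,
   forall x, x \isin W -> exists u v, [/\ u \isin U, v \isin V & x = u + v]
   & U <<= V \/ mini V W].
Proof.
move=> [TU nUT minU] TV /sumringP[W hW]; exists W; split.
- by move=> x hx; apply/hW; exists 0, x; split; [exact: sr0|done|rewrite add0r].
- by move=> x hx; apply/hW; exists x, 0; split; [done|exact: sr0|rewrite addr0].
- by move=> x /hW.
have VW : V <<= W.
  by move=> x hx; apply/hW; exists 0, x; split; [exact: sr0|done|rewrite add0r].
have UW : U <<= W.
  by move=> x hx; apply/hW; exists x, 0; split; [done|exact: sr0|rewrite addr0].
have [|nUV] := pselect (U <<= V); [by left|right; split=> //].
  by move=> WV; apply: nUV => x /UW /WV.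
move=> X VX XW; have [Y hY] := inter_subring X U.
have [||YT|UY] := minU Y.
- by move=> x Tx; apply/hY; split; [exact/VX/TV|exact: TU].
- by move=> x /hY[].
- left=> x Xx; have /hW[u [v [hu hv e]]] := XW _ Xx.
  have Xu : u \isin X.
    by rewrite (_ : u = x - v); [apply: srB => //; exact: VX|rewrite e; ring].
  by rewrite e; apply: srD => //; apply/TV/YT/hY.
- right=> x /hW[u [v [hu hv ->]]]; apply: srD; last exact: VX.
  by have /hY[] := UY _ hu.
Qed.

End SubringOps.

Ltac sr :=
  match goal with
  | |- _ -> _ => let h := fresh in move=> h; sr
  | |- subring_set _ _ => assumption
  | |- subring_set _ 1 => exact: sr1
  | |- subring_set _ 0 => exact: sr0
  | |- subring_set _ (_ + _) => apply: srD; solve [sr]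
  | |- subring_set _ (- _) => apply: srN; solve [sr]
  | |- subring_set _ (_ * _) => apply: srM; solve [sr]
  | |- subring_set _ (_ ^+ _) => apply: srX; solve [sr]
  | |- subring_set _ (_ *+ _) => apply: srMn; solve [sr]
  | H : subring_set ?A `<=` subring_set ?T |- subring_set ?T _ => apply: H; solve [sr]
  end.

(** * Stabilisation, induction and minimal steps under FCP *)

Section FCP.
Variables (S : comNzRingType) (R : subring S).
Hypothesis fcpR : fcp R [set: S].
Implicit Types (A B T U V W : subring S) (x y : S).

Let fcp_seq (f : nat -> subring S) : (forall n, R <<= f n) ->
  (forall m n, (m < n)%N -> f m <> f n) ->
  (forall m n, (m <= n)%N -> f m <<= f n \/ f n <<= f m) -> False.
Proof.
move=> Rf inj_f tot_f.
have finj : injective f.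
  move=> m n e; case: (ltngtP m n) => // h; first by case: (inj_f _ _ h).
  by case: (inj_f _ _ h).
have : finite_set (range f).
  apply: fcpR; split=> [_ [n _ <-]|_ _ [m _ <-] [n _ <-]]; first by split.
  case: (leqP m n) => [/tot_f //|/ltnW /tot_f[]]; by [right|left].
rewrite (eq_finite_set (inj_card_eq _)); last by move=> ? ? _ _; exact: finj.
exact: infinite_nat.
Qed.

Lemma fcp_up_stab (f : nat -> subring S) : (forall n, R <<= f n) ->
  (forall n, f n <<= f n.+1) -> exists n, f n.+1 <<= f n.
Proof.
move=> Rf sf; apply: contrapT => /forallNP h.
have le m n : (m <= n)%N -> f m <<= f n.
  elim: n => [|n IH]; first by rewrite leqn0 => /eqP->.
  by rewrite leq_eqVlt => /orP[/eqP->//|/IH {}IH x /IH/sf].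
apply: (@fcp_seq f) => // [m n mn e|m n /le]; last by left.
by apply: (h m) => x /(le _ _ mn); rewrite e.
Qed.

Lemma fcp_down_stab (f : nat -> subring S) : (forall n, R <<= f n) ->
  (forall n, f n.+1 <<= f n) -> exists n, f n <<= f n.+1.
Proof.
move=> Rf sf; apply: contrapT => /forallNP h.
have le m n : (m <= n)%N -> f n <<= f m.
  elim: n => [|n IH]; first by rewrite leqn0 => /eqP->.
  by rewrite leq_eqVlt => /orP[/eqP->//|/IH {}IH x /sf/IH].
apply: (@fcp_seq f) => // [m n mn e|m n /le]; last by right.
by apply: (h m); rewrite e; exact: le.
Qed.

(** Dependent choice: every counterexample has a successor that is one too, so a single
    counterexample iterates to a forbidden infinite sequence. *)
Let fcp_ind (lt : subring S -> subring S -> Prop) (P : subring S -> Prop) :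
  (forall f : nat -> subring S, (forall n, R <<= f n) -> ~ forall n, lt (f n) (f n.+1)) ->
  (forall T, R <<= T -> (forall T', R <<= T' -> lt T T' -> P T') -> P T) ->
  forall T, R <<= T -> P T.
Proof.
move=> nof IH T RT; apply: contrapT => nPT.
pose bad := {T | R <<= T /\ ~ P T}.
have [next hnext] : {next : bad -> bad & forall b, lt (sval b) (sval (next b))}.
  apply: (@choice _ _ (fun b c : bad => lt (sval b) (sval c))) => -[X [RX nX]].
  apply: contrapT => /forallNP h; apply: (nX); apply: IH => // T' RT' XT'.
  by apply: contrapT => nT'; apply: (h (exist _ T' (conj RT' nT'))).
apply: (nof (fun n => sval (iter n next (exist _ T (conj RT nPT))))) => [n|n].
  by case: (iter _ _ _) => ? [].
by rewrite iterS; exact: hnext.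
Qed.

Lemma fcp_up_ind (P : subring S -> Prop) :
  (forall T, R <<= T ->
    (forall T', R <<= T' -> T <<= T' -> ~ T' <<= T -> P T') -> P T) ->
  forall T, R <<= T -> P T.
Proof.
move=> IH; apply: (@fcp_ind (fun T T' => T <<= T' /\ ~ T' <<= T)) => [f Rf h|T RT h].
  by have [n|n ?] := fcp_up_stab Rf; [case: (h n)|case: (h n)].
by apply: IH => // T' RT' h1 h2; apply: h.
Qed.

Lemma fcp_down_ind (P : subring S -> Prop) :
  (forall T, R <<= T ->
    (forall T', R <<= T' -> T' <<= T -> ~ T <<= T' -> P T') -> P T) ->
  forall T, R <<= T -> P T.
Proof.
move=> IH; apply: (@fcp_ind (fun T T' => T' <<= T /\ ~ T <<= T')) => [f Rf h|T RT h].
  by have [n|n ?] := fcp_down_stab Rf; [case: (h n)|case: (h n)].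
by apply: IH => // T' RT' h1 h2; apply: h.
Qed.

Lemma mini_exists T U : R <<= T -> T <<= U -> ~ U <<= T ->
  exists W, mini T W /\ W <<= U.
Proof.
move=> RT TU; have RU : R <<= U by move=> x /RT /TU.
elim/fcp_down_ind: U / RU TU => U RU IH TU nUT.
have [mU|nmU] := pselect (mini T U); first by exists U; split.
have [W] : exists W, [/\ T <<= W, W <<= U, ~ W <<= T & ~ U <<= W].
  apply: contrapT => /forallNP h; apply: nmU; split=> // W TW WU.
  by apply: contrapT => /not_orP[? ?]; apply: (h W).
move=> [TW WU nWT nUW]; have RW : R <<= W by move=> x /RT /TW.
have [X [mX XW]] := IH W RW WU nUW TW nWT; exists X; split=> // x /XW; exact: WU.
Qed.

(* By the modular law, adding a minimal extension of [T] along a chain of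
   minimal steps keeps every step minimal or trivial. *)
Lemma sumring_local A B : R <<= A ->
  (forall T U V, A <<= T -> U <<= B -> V <<= B -> mini T U -> mini T V -> sumring U V) ->
  forall T U, A <<= T -> T <<= B -> A <<= U -> U <<= B -> sumring T U.
Proof.
move=> RA loc.
(* One side minimal over [T], the other arbitrary: on passing to a minimal [T1] below [V], the sum
   [U + T1] is minimal over [T1] unless [U] already lies in [T1], so induction applies above
   [T1]. *)
have step T : A <<= T -> forall V U, T <<= V -> V <<= B -> U <<= B -> mini T U ->
    sumring U V.
  move=> AT; have RT : R <<= T by move=> x /RA /AT.
  elim/fcp_up_ind: T / RT AT => T RT IH AT V U TV VB UB mU.
  have [VT|nVT] := pselect (V <<= T).
    have UT : T <<= U by case: mU.
    move=> u v hu hv; exists (u * v), 0; split; [|exact: sr0|by rewrite addr0].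
    by apply: srM => //; apply: UT; exact: VT.
  have [T1 [mT1 T1V]] := mini_exists RT TV nVT.
  have T1B : T1 <<= B by move=> x /T1V /VB.
  have TT1 : T <<= T1 by case: mT1.
  have nT1T : ~ T1 <<= T by case: mT1.
  have sr1 := loc _ _ _ AT UB T1B mU mT1.
  have [W [T1W UW hW mW]] := sumring_mini mU TT1 sr1.
  have [WB RT1 AT1] : [/\ W <<= B, R <<= T1 & A <<= T1].
    split=> [x /hW[u [v [hu hv ->]]]|x /RT /TT1 //|x /AT /TT1 //].
    by apply: srD; [exact: UB|exact: T1B].
  case: mW => [UT1|mW].
    move=> u v hu hv; exists 0, (u * v); split; [exact: sr0| |by rewrite add0r].
    by apply: srM => //; apply/T1V/UT1.
  have h := IH T1 RT1 TT1 nT1T AT1 V W T1V VB WB mW.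
  move=> u v /UW hu hv; have [w [v' [/hW[u' [t [hu' ht ->]]] hv' e]]] := h _ _ hu hv.
  exists u', (t + v'); split=> //; last by rewrite e addrA.
  by apply: srD => //; exact: T1V.
(* Both sides arbitrary: [U] is replaced by [U + T1] for a minimal [T1] below [T], and the extra
   summand from [T1] is absorbed by [T] afterwards. *)
have all A' : A <<= A' -> forall T U, A' <<= T -> T <<= B -> A' <<= U -> U <<= B -> sumring T U.
  move=> AA'; have RA' : R <<= A' by move=> x /RA /AA'.
  elim/fcp_up_ind: A' / RA' AA' => A' RA' IH AA' T U A'T TB A'U UB.
  have [TA'|nTA'] := pselect (T <<= A').
    move=> t u ht hu; exists 0, (t * u); split; [exact: sr0| |by rewrite add0r].
    by apply: srM => //; apply/A'U/TA'.
  have [T1 [mT1 T1T]] := mini_exists RA' A'T nTA'.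
  have T1B : T1 <<= B by move=> x /T1T /TB.
  have A'T1 : A' <<= T1 by case: mT1.
  have nT1A' : ~ T1 <<= A' by case: mT1.
  have [W [UW T1W hW _]] := sumring_mini mT1 A'U (step _ AA' _ _ A'U UB T1B mT1).
  have WB : W <<= B.
    move=> x /hW[u [v [hu hv ->]]]; apply: srD; [exact: T1B|exact: UB].
  have h : sumring T W.
    by apply: (IH T1) => // x; [move=> /RA' /A'T1|move=> /AA' /A'T1].
  move=> t u ht /UW hu; have [t' [w [ht' /hW[t1 [u' [ht1 hu' ->]]] e]]] := h _ _ ht hu.
  exists (t' + t1), u'; split=> //; last by rewrite e addrA.
  by apply: srD => //; exact: T1T.
by apply: all.
Qed.

End FCP.

(** * Integral extensions *)

Lemma horner_map_monic_tail (Q S : comNzRingType) (f : {rmorphism Q -> S}) n (c : nat -> Q) x :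
  (map_poly f ('X^n - \poly_(i < n) c i)).[x] = x ^+ n - \sum_(i < n) f (c i) * x ^+ i.
Proof.
rewrite rmorphB /= map_polyXn poly_def rmorph_sum /= hornerD hornerN hornerXn.
rewrite horner_sum; congr (_ - _); apply: eq_bigr => i _.
by rewrite map_polyZ map_polyXn hornerZ hornerXn.
Qed.

Section Adjoin.
Variable S : comNzRingType.
Implicit Types (A B T U V W : subring S) (x y : S).

Let valA A : {rmorphism subring_type A -> S} := val.

Lemma valP_sr A (a : subring_type A) : val a \isin A.
Proof. exact: set_mem (valP a). Qed.

Lemma lift_coef A (c : nat -> S) : (forall i, c i \isin A) ->
  exists c' : nat -> subring_type A, forall i, val (c' i) = c i.
Proof. by move=> hc; exists (fun i => SubringElt (mem_set (hc i))). Qed.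

Lemma integral_intro A x n (c : nat -> S) : (forall i, c i \isin A) ->
  x ^+ n = \sum_(i < n) c i * x ^+ i -> x \isin integral_closure A.
Proof.
move=> /lift_coef[c' hc'] e.
exists ('X^n - \poly_(i < n) c' i).
  rewrite monicE lead_coefDl ?lead_coefXn // size_polyN size_polyXn ltnS.
  exact: size_poly.
rewrite rootE (horner_map_monic_tail (valA A)) e subr_eq0; apply/eqP/eq_bigr => i _.
by rewrite -hc'.
Qed.

Lemma integral_elim A x : x \isin integral_closure A ->
  exists n (c : nat -> S), (forall i, c i \isin A) /\
    x ^+ n = \sum_(i < n) c i * x ^+ i.
Proof.
move=> [p mp]; rewrite rootE horner_coef (size_map_inj_poly val_inj) //.
have : p != 0 by exact: monic_neq0.
rewrite -size_poly_gt0; case e : (size p) => [//|n] _.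
rewrite big_ord_recr /= (coef_map (valA A)) /= (_ : subring_val p`_n = 1); last first.
  by move: mp; rewrite monicE /lead_coef e => /eqP /= ->.
rewrite mul1r addrC addr_eq0 => /eqP h.
exists n, (fun i => - val p`_i); split=> [i|]; first by apply: srN; exact: valP_sr.
by rewrite h -sumrN; apply: eq_bigr => i _; rewrite (coef_map (valA A)) mulNr.
Qed.

Lemma integral_sub_closure A B : A <<= B -> integral_closure A <<= integral_closure B.
Proof.
move=> AB x /integral_elim[n [c [hc e]]].
by apply: (integral_intro _ e) => i; exact: AB.
Qed.

Lemma integral_base A : A <<= integral_closure A.
Proof.
move=> x Ax; apply: (@integral_intro A x 1 (fun=> x)) => //.
by rewrite big_ord1 expr0 mulr1.
Qed.

Lemma integral_closure_idem A :
  integral_closure (integral_closure A) <<= integral_closure A.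
Proof.
move=> x [p mp px]; apply: (@integral_root_monic _ _ (valA A) x (map_poly val p)) => //.
  by have := monic_map (valA (integral_closure A)) mp.
apply/(integral_poly (valA A)) => i; rewrite (coef_map (valA (integral_closure A))) /=.
exact: (valP_sr p`_i).
Qed.

Definition adjoin_set A x : set S :=
  [set y | exists p : {poly subring_type A}, y = (map_poly val p).[x]].

Fact adjoin_closed A x : subring_closed [pred y | y \in adjoin_set A x].
Proof.
split=> [|y z|y z]; rewrite !inE.
- by exists 1; rewrite (rmorph1 (map_poly (valA A))) hornerC.
- by move=> [p ->] [q ->]; exists (p - q); rewrite (rmorphB (map_poly (valA A))) hornerD hornerN.
- by move=> [p ->] [q ->]; exists (p * q); rewrite (rmorphM (map_poly (valA A))) hornerM.
Qed.

Definition adjoin A x : subring S := Subring (adjoin_closed A x).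

Lemma adjoin_base A x : A <<= adjoin A x.
Proof.
move=> y Ay; exists (SubringElt (mem_set Ay))%:P.
by rewrite (map_polyC (valA A)) hornerC.
Qed.

Lemma adjoin_gen A x : x \isin adjoin A x.
Proof. by exists 'X; rewrite (map_polyX (valA A)) hornerX. Qed.

Lemma adjoin_min A W x : A <<= W -> x \isin W -> adjoin A x <<= W.
Proof.
move=> AW Wx _ [p ->]; rewrite horner_coef; apply: sr_sum => i _.
by apply: srM; [rewrite (coef_map (valA A)); apply: AW; exact: valP_sr|exact: srX].
Qed.

Lemma adjoin_span A x : x \isin integral_closure A ->
  exists n, forall y, y \isin adjoin A x ->
   exists c : nat -> S, (forall i, c i \isin A) /\ y = \sum_(i < n) c i * x ^+ i.
Proof.
move=> [p mp px]; exists (size p) => _ [q ->].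
exists (fun i => val (Pdiv.Ring.rmodp q p)`_i); split=> [i|]; first exact: valP_sr.
rewrite {1}(Pdiv.RingMonic.rdivp_eq mp q) (rmorphD (map_poly (valA A))) (rmorphM (map_poly (valA A))) hornerD hornerM.
rewrite [X in _ * X](eqP px) mulr0 add0r (@horner_coef_wide _ (size p)); last first.
  rewrite (size_map_inj_poly val_inj) // ltnW //.
  by rewrite Pdiv.Ring.ltn_rmodpN0 // monic_neq0.
by apply: eq_bigr => i _; rewrite (coef_map (valA A)).
Qed.

Lemma mini_adjoin T U x : mini T U -> x \isin U -> ~ x \isin T -> U <<= adjoin T x.
Proof.
move=> [TU _ h] Ux nTx; case: (h (adjoin T x)) => //.
- exact: adjoin_base.
- exact: adjoin_min.
by move=> /(_ _ (adjoin_gen T x)).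
Qed.

Definition rel_integral A B := B <<= integral_closure A.
Definition int_closed_in A B :=
  forall x, x \isin B -> x \isin integral_closure A -> x \isin A.

Lemma mini_integral_or T U : mini T U -> rel_integral T U \/ int_closed_in T U.
Proof.
move=> mU; have [W hW] := inter_subring (integral_closure T) U.
have [TU _ h] := mU; case: (h W).
- by move=> x Tx; apply/hW; split; [exact: integral_base|exact: TU].
- by move=> x /hW[].
- by move=> WT; right=> x Ux Ix; apply/WT/hW.
- by move=> UW; left=> x /UW /hW[].
Qed.

(** A determinant trick modulo [A]: the vector (1 - a C) X has entries in [A], and det(1 - a C) has
    the form 1 - a a'. Unknowns are eliminated one at a time instead of using the adjugate
    matrix. *)
Lemma elim_system A a n (X : nat -> S) (c : nat -> nat -> S) : a \isin A ->
  (forall i j, c i j \isin A) ->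
  (forall i, (i < n)%N -> X i - a * (\sum_(j < n) c i j * X j) \isin A) ->
  exists2 a', a' \isin A & forall i, (i < n)%N -> (1 - a * a') * X i \isin A.
Proof.
move=> Aa; elim: n X c => [|n IH] X c Ac h; first by exists 0 => //; exact: sr0.
pose s := 1 - a * c n n.
have As : s \isin A by rewrite /s; have := Ac n n; sr.
have hn : s * X n - a * (\sum_(j < n) c n j * X j) \isin A.
  have := h n (ltnSn n); rewrite big_ord_recr /= (_ : X n - _ = s * X n - a * \sum_(j < n) c n j * X j) //.
  by rewrite /s; ring.
(* Row [i] is multiplied by [s = 1 - a * c n n] and [s * X n] is replaced using row [n]. The
   diagonal term moves [- a * c n n * X i] to the other side, so that [X i] keeps coefficient 1. *)
pose c' i j := s * c i j + a * c i n * c n j + (i == j)%:R * c n n.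
have Ac' i j : c' i j \isin A.
  rewrite /c'; have := Ac i j; have := Ac i n; have := Ac n j; have := Ac n n.
  by case: (i == j) => *; rewrite ?mul1r ?mul0r; sr.
case: (IH X c' Ac') => [i ilt|a1 Aa1 h1].
  have hi := h i (ltnW ilt).
  have -> : \sum_(j < n) c' i j * X j = s * (\sum_(j < n) c i j * X j)
     + a * c i n * (\sum_(j < n) c n j * X j) + c n n * X i.
    rewrite !mulr_sumr (_ : c n n * X i = \sum_(j < n) (i == j)%:R * c n n * X j).
      by rewrite -!big_split /=; apply: eq_bigr => j _; rewrite /c'; ring.
    rewrite (bigD1 (Ordinal ilt)) //= eqxx mul1r big1 ?addr0 // => j hj.
    by rewrite (_ : (i == j) = false) ?mul0r //; apply/negbTE; rewrite eq_sym.
  have := Ac i n; set al := X i - _ in hi; set be := s * X n - _ in hn => Acin.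
  have -> : X i - a * (s * (\sum_(j < n) c i j * X j) + a * c i n *
      (\sum_(j < n) c n j * X j) + c n n * X i) = s * al + a * c i n * be.
    by rewrite /al /be big_ord_recr /= /s; ring.
  by sr.
exists (c n n + a1 - a * c n n * a1); first by have := Ac n n; sr.
have e : 1 - a * (c n n + a1 - a * c n n * a1) = s * (1 - a * a1) by rewrite /s; ring.
move=> i; rewrite e ltnS leq_eqVlt => /orP[/eqP->|ilt]; last first.
  by rewrite -mulrA; have := h1 _ ilt; sr.
have -> : s * (1 - a * a1) * X n = (1 - a * a1) * (s * X n - a * (\sum_(j < n) c n j * X j))
   + a * \sum_(j < n) c n j * ((1 - a * a1) * X j).
  rewrite (_ : \sum_(j < n) c n j * ((1 - a * a1) * X j)
    = (1 - a * a1) * \sum_(j < n) c n j * X j); first by ring.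
  by rewrite mulr_sumr; apply: eq_bigr => j _; ring.
have hs : \sum_(j < n) c n j * ((1 - a * a1) * X j) \isin A.
  by apply: sr_sum => j _; have := Ac n j; have := h1 _ (ltn_ord j); sr.
by sr.
Qed.

(** A norm argument: multiplying the equation of [b] by [a^n] and setting [a b = 1] leaves 1 = a a'
    with a' = sum of [c i * a^(n-i-1)]. Hence [1 - a b] divides [1 - a a']. *)
Lemma integral_unit_trick A B a b : A <<= B -> b \isin B ->
  b \isin integral_closure A -> a \isin A ->
  exists a' g, [/\ a' \isin A, g \isin B & 1 - a * a' = (1 - a * b) * g].
Proof.
move=> AB Bb /integral_elim[n [c [hc e]]] Aa.
have Ba := AB _ Aa.
pose geo i := \sum_(j < i) (a * b) ^+ j.
have hgeo i : 1 - (a * b) ^+ i = (1 - a * b) * geo i.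
  by rewrite -(expr1n _ i) subrXX expr1n; congr (_ * _); apply: eq_bigr => j _; rewrite expr1n mul1r.
have Bgeo i : geo i \isin B by apply: sr_sum => j _; sr.
exists (\sum_(i < n) c i * a ^+ (n - i).-1).
exists (geo n - \sum_(i < n) c i * a ^+ (n - i) * geo i); split.
- by apply: sr_sum => i _; have := hc i; sr.
- apply: srB => //; apply: sr_sum => i _; have := AB _ (hc i); have := Bgeo i; sr.
rewrite mulrBr -hgeo exprMn_comm; last exact: mulrC.
rewrite e !mulr_sumr -addrA -opprD -big_split /=; congr (_ - _); apply: eq_bigr => i _.
rewrite mulrCA -exprS prednK ?subn_gt0 //.
rewrite [X in _ + X](_ : _ = c i * a ^+ (n - i) * (1 - (a * b) ^+ i)); last by rewrite hgeo; ring.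
have -> : a ^+ n = a ^+ (n - i) * a ^+ i by rewrite -exprD subnK // ltnW.
by rewrite exprMn_comm; [ring|exact: mulrC].
Qed.

End Adjoin.

(** * Zero-dimensionality modulo the conductor of an integral extension *)

Section FCPIntegral.
Variables (S : comNzRingType) (R : subring S).
Hypothesis fcpR : fcp R [set: S].
Implicit Types (A B T U V W C : subring S) (x y a b : S).

Lemma add_mul_subring A B a : A <<= B -> a \isin B ->
  exists W, forall x, x \isin W <-> exists t y, [/\ t \isin A, y \isin B & x = t + a * y].
Proof.
move=> AB Ba; have [||t _ At [y By ->]|_ _ [x Bx ->] [y By ->]|W hW] :=
   @add_subring _ A [set z | exists2 y, y \isin B & z = a * y].
- by exists 0; rewrite ?mulr0 //; exact: sr0.
- by move=> _ _ [x Bx ->] [y By ->]; exists (x - y); [exact: srB|ring].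
- by exists (t * y); [apply: srM => //; exact: AB|ring].
- exists 0, (a * x * (a * y)); split; [exact: sr0| |by rewrite add0r].
  by exists (x * (a * y)); [sr|ring].
exists W => x; rewrite hW; split=> [[t [_ [At [y By ->] ->]]]|[t [y [At By ->]]]].
  by exists t, y.
by exists t, (a * y); split=> //; exists y.
Qed.

(** The rings [A + a^(n+1) B] decrease with [n], so two consecutive ones agree. *)
Lemma pow_stab A B a : R <<= A -> A <<= B -> a \isin B ->
  exists n, forall y, y \isin B -> exists t z,
    [/\ t \isin A, z \isin B & a ^+ n.+1 * y = t + a ^+ n.+2 * z].
Proof.
move=> RA AB Ba.
have /choice[f hf] : forall n, exists W : subring S, forall x, x \isin W <->
    exists t y, [/\ t \isin A, y \isin B & x = t + a ^+ n.+1 * y].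
  by move=> n; apply: add_mul_subring => //; exact: srX.
have [n x Rx|n x /hf[t [y [At By ->]]]|n hn] := fcp_down_stab (f := f) fcpR.
- by apply/hf; exists x, 0; rewrite mulr0 addr0; split; [exact: RA|exact: sr0|].
- by apply/hf; exists t, (a * y); split; [|exact: srM|rewrite [_ ^+ n.+2]exprSr; ring].
exists n => y By; apply/hf/hn/hf; exists 0, y.
by rewrite add0r; split=> //; exact: sr0.
Qed.

(** By stability each [a^(n+1) x^i] is, modulo [A], [a] times a combination of these same finitely
    many products: exactly the system solved by [elim_system]. *)
Lemma pow_clear_adjoin A x a : R <<= A -> x \isin integral_closure A -> a \isin A ->
  exists n a', a' \isin A /\
    forall y, y \isin adjoin A x -> a ^+ n * (1 - a * a') * y \isin A.
Proof.
move=> RA Ix Aa; have AB := @adjoin_base _ A x.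
have [n hn] := pow_stab RA AB (AB _ Aa); have [d hd] := adjoin_span Ix.
have Gx := adjoin_gen A x.
have /choice[c hc] : forall i, exists c : nat -> S, (forall j, c j \isin A) /\
    a ^+ n.+1 * x ^+ i - a * (\sum_(j < d) c j * (a ^+ n.+1 * x ^+ j)) \isin A.
  move=> i; have [t [z [At /hd[c [Ac ez]] e]]] := hn (x ^+ i) (srX _ Gx).
  exists c; split=> //; rewrite e ez.
  rewrite (_ : a ^+ n.+2 * _ = a * (\sum_(j < d) c j * (a ^+ n.+1 * x ^+ j))) ?addrK //.
  by rewrite !mulr_sumr; apply: eq_bigr => j _; rewrite [a ^+ n.+2]exprS; ring.
have [a' Aa' h] := @elim_system _ A a d (fun i => a ^+ n.+1 * x ^+ i) c Aa
   (fun i => (hc i).1) (fun i _ => (hc i).2).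
exists n.+1, a'; split=> // y /hd[b [Ab ->]].
rewrite mulr_sumr; apply: sr_sum => i _.
have := h i (ltn_ord i); have := Ab i.
set u := (1 - _) * _ => ? ?.
by rewrite (_ : _ * _ = b i * u); [sr|rewrite /u; ring].
Qed.

(** Some [a^n (1 - a a')] lies in the conductor of [A] in [U], that is, [A] modulo this conductor is
    zero-dimensional. [U] is reached by adjoining one element at a time, with induction on the
    base. *)
Lemma pow_clear A U a : R <<= A -> A <<= U -> rel_integral A U -> a \isin A ->
  exists n a', a' \isin A /\ forall y, y \isin U -> a ^+ n * (1 - a * a') * y \isin A.
Proof.
move=> RA; elim/(fcp_up_ind fcpR): A / RA => A RA IH AU IU Aa.
have [UA|nUA] := pselect (U <<= A).
  exists 0%N, 0; split; first exact: sr0.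
  by move=> y /UA Ay; rewrite mulr0 subr0 expr0 !mul1r.
have [x Ux nAx] : exists2 x, x \isin U & ~ x \isin A.
  by apply: contrapT => /forall2NP h; apply: nUA => x Ux; case: (h x) => // /contrapT.
have AA1 := @adjoin_base _ A x; have A1U := adjoin_min AU Ux.
case: (IH (adjoin A x)) => //.
- by move=> y /RA /AA1.
- by move=> h; apply/nAx/h/adjoin_gen.
- by move=> y /IU; exact: integral_sub_closure.
- exact: AA1.
move=> n [b [A1b hb]].
(* The induction hypothesis only gives [b] in [A[x]]; this replaces [1 - a b] by a multiple of it
   with coefficients in [A]. *)
have [a1 [g [Aa1 A1g eg]]] := integral_unit_trick AA1 A1b (IU _ (A1U _ A1b)) Aa.
have [m [a2 [Aa2 h2]]] := pow_clear_adjoin RA (IU _ Ux) Aa.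
exists (n + m)%N, (a1 + a2 - a * a1 * a2); split; first by sr.
move=> y Uy; have -> : a ^+ (n + m) * (1 - a * (a1 + a2 - a * a1 * a2)) * y =
   a ^+ m * (1 - a * a2) * (a ^+ n * (1 - a * b) * y * g).
  transitivity (a ^+ m * (1 - a * a2) * (a ^+ n * (1 - a * a1) * y)).
    by rewrite exprD; ring.
  by rewrite eg; ring.
by apply: h2; have := hb _ Uy; sr.
Qed.

End FCPIntegral.

(** * Conductors, seminormality and t-closedness *)

Section Conductor.
Variable S : comNzRingType.
Implicit Types (A B T U V W : subring S) (x y m u : S).

Lemma cond_base T U m : conductor T U m -> m \isin T.
Proof. by move=> /(_ 1 (sr1 U)); rewrite mulr1. Qed.

Lemma condMl T U m u : conductor T U m -> u \isin U -> conductor T U (u * m).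
Proof. by move=> hm hu y hy; rewrite (_ : u * m * y = m * (u * y)); [apply: hm; sr|ring]. Qed.

Lemma condMr T U m u : conductor T U m -> u \isin U -> conductor T U (m * u).
Proof. by rewrite mulrC; exact: condMl. Qed.

Lemma condD T U m n : conductor T U m -> conductor T U n -> conductor T U (m + n).
Proof. by move=> hm hn y hy; rewrite mulrDl; have := hm y hy; have := hn y hy; sr. Qed.

Lemma condN T U m : conductor T U m -> conductor T U (- m).
Proof. by move=> hm y hy; rewrite mulNr; have := hm y hy; sr. Qed.

Lemma condB T U m n : conductor T U m -> conductor T U n -> conductor T U (m - n).
Proof. by move=> hm /condN; exact: condD. Qed.

Lemma cond0 T U : conductor T U 0.
Proof. by move=> y _; rewrite mul0r; sr. Qed.

Lemma mini_cond1 T U : mini T U -> ~ conductor T U 1.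
Proof. by move=> [_ nUT _] h; apply: nUT => y /h; rewrite mul1r. Qed.

Definition radical_cond A U :=
  forall z, z \isin U -> conductor A U (z ^+ 2) -> conductor A U z.

Lemma radical_cond_pow A U n z : radical_cond A U -> z \isin U ->
  conductor A U (z ^+ n.+1) -> conductor A U z.
Proof.
move=> rad Uz h.
have h2 k : conductor A U (z ^+ (2 ^ k)) -> conductor A U z.
  elim: k => [|k IH]; first by rewrite expr1.
  by rewrite expnSr exprM => /rad h'; apply/IH/h'; sr.
apply: (h2 n.+1); have /subnK <- : (n.+1 <= 2 ^ n.+1)%N by exact/ltnW/ltn_expl.
by rewrite exprD; apply: condMl => //; sr.
Qed.

Lemma seminormal_radical A U : A <<= U -> seminormal A U -> radical_cond A U.
Proof.
move=> AU sn z Uz h y Uy; apply: sn; first by sr.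
- by rewrite exprMn; apply: h; sr.
- rewrite (_ : _ ^+ 3 = z ^+ 2 * (z * y ^+ 3)); last by ring.
  by apply: h; sr.
Qed.

Lemma tclosed_seminormal A U : tclosed A U -> seminormal A U.
Proof. by move=> tc b Ub h2 h3; apply: (tc b 0); rewrite ?mul0r ?subr0 //; sr. Qed.

Lemma tclosed_idem A U f : tclosed A U -> f \isin U -> conductor A U (f ^+ 2 - f) ->
  f \isin A.
Proof.
move=> tc Uf h; apply: (tc f 1) => //; rewrite ?mul1r; first by sr.
  exact: cond_base h.
by rewrite (_ : _ - _ = (f ^+ 2 - f) * f); [exact: h|ring].
Qed.
End Conductor.

Section FCPConductor.
Variables (S : comNzRingType) (R : subring S).
Hypothesis fcpR : fcp R [set: S].
Implicit Types (A B T U V W : subring S) (x y a b : S).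

Lemma mini_cond T U a : R <<= T -> mini T U -> rel_integral T U -> a \isin T ->
  conductor T U a \/ exists2 a', a' \isin T & conductor T U (1 - a * a').
Proof.
move=> RT mU IU Ta; have [TU _ minU] := mU.
have [W hW] := add_mul_subring TU (TU _ Ta).
have TW : T <<= W.
  by move=> x Tx; apply/hW; exists x, 0; split; [by []|sr|rewrite mulr0 addr0].
have WU : W <<= U by move=> x /hW[t [y [Tt Uy ->]]]; have := TU _ Tt; have := TU _ Ta; sr.
case: (minU W TW WU) => [WT|UW].
  left=> y Uy; apply/WT/hW; exists 0, y; split=> //; [by sr|by rewrite add0r].
right; have [n [a' [Ta' h]]] := pow_clear fcpR RT TU IU Ta; exists a' => // y Uy.
have dec k : exists t z, [/\ t \isin T, z \isin U & y = t + a ^+ k * z].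
  elim: k => [|k [t [z [Tt Uz ->]]]]; first by exists 0, y; rewrite add0r mul1r; split=> //; sr.
  have /hW[t' [z' [Tt' Uz' ->]]] := UW _ Uz.
  by exists (t + a ^+ k * t'), z'; split=> //; [sr|rewrite exprSr; ring].
have [t [z [Tt Uz ->]]] := dec n.
have := h z Uz; set v := _ * z => Tv.
by rewrite (_ : _ * _ = (1 - a * a') * t + v); [sr|rewrite /v; ring].
Qed.

(** [T] modulo the conductor of [A] in [U] is von Neumann regular. Stability of [A + y^n T] gives
    [a = y^(n+1) (1 - y e)] in [A]; clearing [a] puts a power of the wanted element in the
    conductor, and the conductor is radical. *)
Lemma cond_vnr A T U y : R <<= A -> A <<= T -> T <<= U -> rel_integral A U ->
  radical_cond A U -> y \isin T ->
  exists2 e, e \isin T & conductor A U (y * (1 - y * e)).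
Proof.
move=> RA AT TU IU rad Ty; have AU : A <<= U by move=> x /AT /TU.
have [n hn] := pow_stab fcpR RA AT Ty.
have [a [e [Aa Te h]]] := hn 1 (sr1 T); rewrite mulr1 in h.
have ea : a = y ^+ n.+1 * (1 - y * e).
  transitivity (y ^+ n.+1 - y ^+ n.+2 * e); first by rewrite h; ring.
  by rewrite [y ^+ n.+2]exprSr; ring.
have [m [a' [Aa' hm]]] := pow_clear fcpR RA AU IU Aa.
(* Chosen so that [1 - y e' = (1 - y e) (1 - a a')]. *)
pose e' := e + (1 - y * e) * (y ^+ n * (1 - y * e) * a').
have Ta' := AT _ Aa'; have Te' : e' \isin T by rewrite /e'; sr.
exists e' => //; have Uy := TU _ Ty; have Ue := TU _ Te; have Ua' := AU _ Aa'.
have ez : y * (1 - y * e') = y * (1 - y * e) * (1 - a * a').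
  by rewrite /e' ea exprS; ring.
have Uz : y * (1 - y * e') \isin U by have := TU _ Te'; sr.
apply: (radical_cond_pow (n := n.+1 * m) rad Uz).
have -> : (y * (1 - y * e')) ^+ (n.+1 * m).+1 = a ^+ m * (1 - a * a') *
    (y * ((1 - y * e) ^+ (n * m).+1) * (1 - a * a') ^+ (n.+1 * m)).
  rewrite ez (_ : a ^+ m = y ^+ (n.+1 * m) * (1 - y * e) ^+ m); last first.
    by rewrite {1}ea exprMn exprM.
  move: (1 - a * a') (1 - y * e) => r q; rewrite !exprMn [y ^+ _.+1]exprS [r ^+ _.+1]exprS.
  rewrite (_ : (n.+1 * m).+1 = (m + (n * m).+1)%N); last by rewrite mulSn addnS.
  by rewrite exprD; ring.
by apply: condMr; [exact: hm|have := AU _ Aa; sr].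
Qed.

(** With [e] a quasi-inverse of [b^2], the part [b (1 - b^2 e)] has its square in the radical
    conductor, hence lies in [A], while the rest of [b] is [b^3 e]. *)
Lemma seminormal_up A T U : R <<= A -> A <<= T -> T <<= U -> rel_integral A U ->
  seminormal A U -> seminormal T U.
Proof.
move=> RA AT TU IU sn b Ub h2 h3; have AU : A <<= U by move=> x /AT /TU.
have rad := seminormal_radical AU sn.
have [e Te h] := cond_vnr RA AT TU IU rad h2; have Ue := TU _ Te.
have hb : conductor A U (b * (1 - b ^+ 2 * e)).
  apply: rad; first by sr.
  rewrite (_ : _ ^+ 2 = b ^+ 2 * (1 - b ^+ 2 * e) * (1 - b ^+ 2 * e)); last by ring.
  by apply: condMr => //; sr.
rewrite (_ : b = b * (1 - b ^+ 2 * e) + b ^+ 3 * e); last by ring.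
by have := AT _ (cond_base hb); sr.
Qed.

Lemma tclosed_up A T U : R <<= A -> A <<= T -> T <<= U -> rel_integral A U ->
  tclosed A U -> tclosed T U.
Proof.
move=> RA AT TU IU tc b r Ub Tr Tc Tcb; have AU : A <<= U by move=> x /AT /TU.
have rad := seminormal_radical AU (tclosed_seminormal tc).
have Ur := TU _ Tr.
set c := b ^+ 2 - r * b in Tc.
have ecb : b ^+ 3 - r * b ^+ 2 = c * b by rewrite /c; ring.
rewrite ecb in Tcb.
have [e1 Te1 h1] := cond_vnr RA AT TU IU rad Tc; have Ue1 := TU _ Te1.
have [e2 Te2 h2] := cond_vnr RA AT TU IU rad Tr; have Ue2 := TU _ Te2.
have Uc := TU _ Tc.
(* Modulo the conductor, [g] and [h] are the idempotents where [c] and [r] vanish. Where [c] is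
   invertible, [b] is [e1 (c b)]. On [g] one has [b^2 = r b]: on [h] this makes [b] nilpotent, and
   elsewhere [e2 b] is idempotent, hence in [A] by t-closedness. *)
pose g := 1 - c * e1; pose h := 1 - r * e2; rewrite -/g in h1; rewrite -/h in h2.
have Ug : g \isin U by rewrite /g; sr.
have Uh : h \isin U by rewrite /h; sr.
pose b' := g * b; have Ub' : b' \isin U by rewrite /b'; sr.
have hb : conductor A U (h * b').
  apply: rad; first by sr.
  rewrite (_ : _ ^+ 2 = h ^+ 2 * g * (c * g) + r * h * (h * g ^+ 2 * b)).
    by apply: condD; [apply: condMl => //|apply: condMr => //]; sr.
  by rewrite /b' /c; ring.
pose f := e2 * b'.
have Af : f \isin A.
  apply: (tclosed_idem tc); first by rewrite /f; sr.
  rewrite (_ : _ - _ = e2 ^+ 2 * g * (c * g) - e2 * g * (h * b') - (c * g) * (e1 * e2 * b)).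
    apply: condB; first by apply: condB; apply: condMl => //; sr.
    by apply: condMr => //; sr.
  by rewrite /f /b' /h /g /c; ring.
rewrite (_ : b = e1 * (c * b) + h * b' + r * f); last by rewrite /f /b' /h /g; ring.
by have := AT _ (cond_base hb); have := AT _ Af; sr.
Qed.

End FCPConductor.

(** * Minimal integral extensions *)

Section MinimalTypes.
Variables (S : comNzRingType) (R : subring S).
Hypothesis fcpR : fcp R [set: S].
Implicit Types (A B T U V W X : subring S) (x y a b e u v : S).

(* [y] generates [U] over [T] and satisfies [y (y - l) = 0] modulo the conductor:
   the extension is ramified for [l = 0] and decomposed for [l = 1]. *)
Definition quad_gen T U y l := [/\ y \isin U, ~ y \isin T, l \isin T & conductor T U (y * (y - l))].

(** [U] modulo the conductor is a field, expressed without the quotient. *)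
Definition residue_field T U := forall u, u \isin U ->
  conductor T U u \/ exists2 u', u' \isin U & conductor T U (1 - u * u').

Definition same_cond T U V := forall m, conductor T U m <-> conductor T V m.

Definition four T U V X := forall W, T <<= W -> W <<= X ->
  [\/ W = T, W = U, W = V | W = X].

Lemma same_cond_sym T U V : same_cond T U V -> same_cond T V U.
Proof. by move=> h m; split=> /h. Qed.

Lemma quad_gen_span T U y l : mini T U -> quad_gen T U y l ->
  forall u, u \isin U -> exists a b, [/\ a \isin T, b \isin T & u = a + b * y].
Proof.
move=> [TU _ minU] [Uy nTy Tl /cond_base hy].
have [||t _ Tt [b Tb ->]|_ _ [b Tb ->] [c Tc ->]|W hW] :=
   @add_subring _ T [set z | exists2 b, b \isin T & z = b * y].
- by exists 0; rewrite ?mul0r //; sr.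
- by move=> _ _ [b Tb ->] [c Tc ->]; exists (b - c); [sr|ring].
- by exists (t * b); [sr|ring].
- exists (b * c * (y * (y - l))), (b * c * l * y); split; [sr| |ring].
  by exists (b * c * l) => //; sr.
have [||WT|UW] := minU W.
- by move=> t Tt; apply/hW; exists t, 0; split; [|exists 0; [sr|rewrite mul0r]|rewrite addr0].
- by move=> w /hW[t [_ [Tt [b Tb ->] ->]]]; sr.
- case: nTy; apply/WT/hW; exists 0, y; split; [sr|exists 1; [sr|by rewrite mul1r]|by rewrite add0r].
by move=> u /UW/hW[a [_ [Ta [b Tb ->] ->]]]; exists a, b.
Qed.

Lemma quad_gen_opp T U e : T <<= U -> quad_gen T U e 1 -> quad_gen T U (1 - e) 1.
Proof.
move=> TU [Ue nTe T1 h]; split=> //; first by sr.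
  by move=> h1; apply: nTe; rewrite (_ : e = 1 - (1 - e)); [sr|ring].
by rewrite (_ : _ * _ = e * (e - 1)); [|ring].
Qed.

(** [U / T] is a vector space over the field [T / M], [M] the conductor: a scalar killing a nonzero
    vector is zero. *)
Lemma cond_cancel T U a y : R <<= T -> mini T U -> rel_integral T U -> a \isin T ->
  y \isin U -> a * y \isin T -> ~ y \isin T -> conductor T U a.
Proof.
move=> RT mU IU Ta Uy Tay nTy; have [//|[a' Ta' h]] := mini_cond fcpR RT mU IU Ta.
case: nTy; rewrite (_ : y = (1 - a * a') * y + a' * (a * y)); last by ring.
by have := h _ Uy; sr.
Qed.

Lemma nonseminormal_gen T U : R <<= T -> mini T U -> rel_integral T U ->
  ~ seminormal T U -> exists x, quad_gen T U x 0.
Proof.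
move=> RT mU IU; apply: contra_notP => /forallNP h b Ub T2 T3; apply: contrapT => nTb.
apply: (h b); split=> //; first by sr.
rewrite (_ : _ * _ = b ^+ 2); last by ring.
by apply: (@cond_cancel T U _ b) => //; rewrite -exprSr.
Qed.

(** From [c b] in [T], where [c = b^2 - r b], cancellation puts [c] in the conductor. If [r] were
    there too, [b^2] would be, against seminormality; so [r] has an inverse [r'], and [r' b] is
    idempotent modulo the conductor. *)
Lemma nontclosed_gen T U : R <<= T -> mini T U -> rel_integral T U ->
  seminormal T U -> ~ tclosed T U -> exists e, quad_gen T U e 1.
Proof.
move=> RT mU IU sn; apply: contra_notP => /forallNP h b r Ub Tr Tc Td; apply: contrapT => nTb.
have [TU _ _] := mU.
have Mc : conductor T U (b ^+ 2 - r * b).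
  apply: (@cond_cancel T U _ b) => //.
  by rewrite (_ : _ * _ = b ^+ 3 - r * b ^+ 2); [|ring].
have [Mr|[r' Tr' Mr']] := mini_cond fcpR RT mU IU Tr.
  have Mb2 : conductor T U (b ^+ 2).
    by rewrite (_ : _ ^+ 2 = b ^+ 2 - r * b + r * b); [apply: condD => //; exact: condMr|ring].
  apply/nTb/sn => //; first exact: cond_base Mb2.
  by rewrite exprSr; exact: Mb2.
have Ur := TU _ Tr; have Ur' := TU _ Tr'.
apply: (h (r' * b)); split; [sr| |sr|].
  move=> Te; apply: nTb; rewrite (_ : b = (1 - r * r') * b + r * (r' * b)); last by ring.
  by have := Mr' _ Ub; sr.
rewrite (_ : _ * _ = r' ^+ 2 * (b ^+ 2 - r * b) - (1 - r * r') * (r' * b)); last by ring.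
by apply: condB; [apply: condMl => //|apply: condMr => //]; sr.
Qed.

(** For a quasi-inverse [e] of [y], the product [y e] is idempotent modulo the conductor, hence in
    [T] by t-closedness; in the field [T / M] it is zero or invertible. *)
Lemma tclosed_field T U : R <<= T -> mini T U -> rel_integral T U ->
  tclosed T U -> residue_field T U.
Proof.
move=> RT mU IU tc y Uy; have [TU _ _] := mU.
have rad := seminormal_radical TU (tclosed_seminormal tc).
have [e Ue he] := cond_vnr fcpR RT TU (fun x h => h) IU rad Uy.
have Tf : y * e \isin T.
  apply: (tclosed_idem tc); first by sr.
  rewrite (_ : _ - _ = - ((y * (1 - y * e)) * e)); last by ring.
  by apply/condN/condMr.
have [Mf|[f' Tf' Mf']] := mini_cond fcpR RT mU IU Tf.
  left; rewrite (_ : y = y * (1 - y * e) + y * e * y); last by ring.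
  by apply: condD => //; exact: condMr.
right; exists (e * f'); first by have := TU _ Tf'; sr.
by rewrite mulrA.
Qed.

Lemma mini_types T U : R <<= T -> mini T U -> rel_integral T U ->
  [\/ ~ seminormal T U /\ exists x, quad_gen T U x 0,
      [/\ seminormal T U, ~ tclosed T U & exists e, quad_gen T U e 1]
    | tclosed T U /\ residue_field T U].
Proof.
move=> RT mU IU; have [sn|nsn] := pselect (seminormal T U); last first.
  by constructor 1; split=> //; exact: nonseminormal_gen.
have [tc|ntc] := pselect (tclosed T U).
  by constructor 3; split=> //; exact: tclosed_field.
by constructor 2; split=> //; exact: nontclosed_gen.
Qed.

Lemma field_no_gen T U y l : T <<= U -> residue_field T U -> ~ quad_gen T U y l.
Proof.
move=> TU fU [Uy nTy Tl h]; have [/cond_base //|[y' Uy' hy']] := fU _ Uy.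
have Ul := TU _ Tl.
suff /cond_base hl : conductor T U (y - l) by apply: nTy; rewrite -[y](subrK l); sr.
rewrite (_ : y - l = (1 - y * y') * (y - l) + y * (y - l) * y'); last by ring.
by apply: condD; apply: condMr => //; sr.
Qed.

(** Writing [e = a + b x] with [x^2 = 0], the equation [e^2 = e] gives [a^2 = a] and
    [(2 a - 1) b = 0]. Since [(2 a - 1)^2 = 1 + 4 (a^2 - a)], this forces [b = 0]. *)
Lemma quad_gen_excl T U x e : R <<= T -> mini T U -> rel_integral T U ->
  quad_gen T U x 0 -> quad_gen T U e 1 -> False.
Proof.
move=> RT mU IU gx [Ue nTe _ he]; have [Ux nTx _ hx] := gx; have [TU _ _] := mU.
have [a [b [Ta Tb ee]]] := quad_gen_span mU gx Ue.
have Ua := TU _ Ta; have Ub := TU _ Tb.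
have Mb : ~ conductor T U b.
  by move=> Mb; apply: nTe; rewrite ee; have := Mb _ Ux; sr.
have Mc : conductor T U ((a * 2 - 1) * b).
  apply: (@cond_cancel T U _ x) => //; first by sr.
  rewrite (_ : _ * _ = e * (e - 1) - (a ^+ 2 - a) - b ^+ 2 * (x * (x - 0))); last by rewrite ee; ring.
  by have := cond_base he; have := cond_base hx; sr.
have Md : conductor T U (a ^+ 2 - a).
  rewrite (_ : _ - _ = e * (e - 1) - (a * 2 - 1) * b * x - b ^+ 2 * (x * (x - 0))); last by rewrite ee; ring.
  apply: condB; first by apply: condB => //; exact: condMr.
  by apply: condMl => //; sr.
apply: Mb; rewrite (_ : b = (a * 2 - 1) * b * (a * 2 - 1) - (a ^+ 2 - a) * (4 * b)); last by ring.
by apply: condB; apply: condMr => //; sr.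
Qed.

Lemma cond_dichotomy T U V : R <<= T -> mini T U -> rel_integral T U ->
  mini T V -> rel_integral T V ->
  same_cond T U V \/ exists m n, [/\ conductor T U m, conductor T V n & m + n = 1].
Proof.
move=> RT mU IU mV IV; have [h|nh] := pselect (same_cond T U V); [by left|right].
have aux X Y m : mini T Y -> rel_integral T Y -> conductor T X m -> ~ conductor T Y m ->
  T <<= X -> exists p n, [/\ conductor T X p, conductor T Y n & p + n = 1].
  move=> mY IY Xm nYm TX; have [//|[m' Tm' h]] := mini_cond fcpR RT mY IY (cond_base Xm).
  by exists (m * m'), (1 - m * m'); split=> //; [apply: condMr => //; exact: TX|ring].
have [TU _ _] := mU; have [TV _ _] := mV.
have [m] : exists m, ~ (conductor T U m <-> conductor T V m) by apply/existsNP.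
have [Um|nUm] := pselect (conductor T U m); have [Vm|nVm] := pselect (conductor T V m) => hm.
- by case: hm.
- exact: (aux _ _ m).
- by have [n [p [? ? e]]] := aux V U m mU IU Vm nUm TV; exists p, n; rewrite addrC.
- by case: hm.
Qed.

Lemma comax_sumring T U V m n : T <<= U -> T <<= V ->
  conductor T U m -> conductor T V n -> m + n = 1 -> sumring U V.
Proof.
move=> TU TV Mm Nn e u v Uu Vv; exists (u * (n * v)), (m * u * v); split.
- by have := TU _ (Nn _ Vv); sr.
- by have := TV _ (Mm _ Uu); sr.
- by rewrite -[LHS]mul1r -e; ring.
Qed.

Lemma gen_sumring T U V e f l l' : mini T U -> mini T V ->
  quad_gen T U e l -> quad_gen T V f l' ->
  (exists u v, [/\ u \isin U, v \isin V & e * f = u + v]) -> sumring U V.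
Proof.
move=> mU mV ge gf [p [q [Up Vq epq]]] u v Uu Vv.
have [TU _ _] := mU; have [TV _ _] := mV; have [Ue _ _ _] := ge; have [Vf _ _ _] := gf.
have [a [b [Ta Tb ->]]] := quad_gen_span mU ge Uu.
have [c [d [Tc Td ->]]] := quad_gen_span mV gf Vv.
exists (a * c + b * c * e + b * d * p), (a * d * f + b * d * q); split.
- by have := TU _ Ta; have := TU _ Tb; have := TU _ Tc; have := TU _ Td; sr.
- by have := TV _ Ta; have := TV _ Tb; have := TV _ Tc; have := TV _ Td; sr.
transitivity (a * c + b * c * e + a * d * f + b * d * (e * f)); first by ring.
by rewrite epq; ring.
Qed.

(* Modulo the common conductor, [U] is a field on which [V / T] would be a
   one-dimensional space. *)
Lemma field_gen_no_mul T U V y l al b : R <<= T -> mini T U -> rel_integral T U ->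
  residue_field T U -> same_cond T U V -> quad_gen T V y l -> ~ y \isin U ->
  al \isin U -> ~ al \isin T -> b \isin T -> ~ (al - b) * y \isin U.
Proof.
move=> RT mU IU fU sM [Vy nTy Tl hy] nUy Ual nTal Tb h; have [TU _ _] := mU.
have Ub := TU _ Tb.
have [/cond_base hb|[c Uc hc]] := fU (al - b) (srB Ual Ub).
  by apply: nTal; rewrite -[al](subrK b); sr.
apply: nUy; rewrite (_ : y = (1 - (al - b) * c) * y + (al - b) * y * c); last by ring.
by have := TU _ ((sM _).1 hc _ Vy); sr.
Qed.

Lemma field_gen_notin T U V y l : T <<= U -> residue_field T U -> same_cond T U V ->
  quad_gen T V y l -> ~ y \isin U.
Proof.
move=> TU fU sM [Vy nTy Tl hy] Uy; apply: (@field_no_gen T U y l) => //; split=> //.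
exact/sM.
Qed.

(** For [al] in [U] outside [T], writing [al y = u + (a + b y)] would put [(al - b) y] in [U]. *)
Lemma field_gen_nosum T U V y l : R <<= T -> mini T U -> rel_integral T U -> mini T V ->
  residue_field T U -> same_cond T U V -> quad_gen T V y l -> ~ sumring U V.
Proof.
move=> RT mU IU mV fU sM gy sUV; have [TU nUT _] := mU; have [Vy nTy _ _] := gy.
have nUy := field_gen_notin TU fU sM gy.
have [al Ual nTal] : exists2 al, al \isin U & ~ al \isin T.
  by apply: contrapT => /forall2NP h; apply: nUT => x Ux; case: (h x) => // /contrapT.
have [u [v [Uu Vv e]]] := sUV _ _ Ual Vy.
have [a [b [Ta Tb ev]]] := quad_gen_span mV gy Vv.
apply: (field_gen_no_mul RT mU IU fU sM gy nUy Ual nTal Tb).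
rewrite mulrBl e ev (_ : _ - _ = u + a); last by ring.
by have := TU _ Ta; sr.
Qed.

(** The ring [T + U y] is a fifth element: it contains [y], which is not in [U], and [al y], which
    is not in [V]. *)
Lemma field_gen_nofour T U V X y l : R <<= T -> mini T U -> rel_integral T U -> mini T V ->
  residue_field T U -> same_cond T U V -> quad_gen T V y l ->
  U <<= X -> V <<= X -> ~ four T U V X.
Proof.
move=> RT mU IU mV fU sM gy UX VX h4; have [TU nUT _] := mU; have [Vy nTy Tl hy] := gy.
have [TV _ _] := mV.
have nUy := field_gen_notin TU fU sM gy.
have [al Ual nTal] : exists2 al, al \isin U & ~ al \isin T.
  by apply: contrapT => /forall2NP h; apply: nUT => x Ux; case: (h x) => // /contrapT.
have [||t _ Tt [b Tb ->]|_ _ [b Tb ->] [c Tc ->]|W hW] :=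
   @add_subring _ T [set z | exists2 b, b \isin U & z = b * y].
- by exists 0; rewrite ?mul0r //; sr.
- by move=> _ _ [b Tb ->] [c Tc ->]; exists (b - c); [sr|ring].
- by exists (t * b); [sr|ring].
- exists (b * c * (y * (y - l))), (b * c * l * y); split; [| |by ring].
    by rewrite mulrC; apply: (sM _).2 => //; sr.
  by exists (b * c * l) => //; sr.
have Wy : y \isin W.
  by apply/hW; exists 0, y; split; [sr|exists 1; [sr|rewrite mul1r]|rewrite add0r].
have Waly : al * y \isin W.
  by apply/hW; exists 0, (al * y); split; [sr|exists al|rewrite add0r].
have [||e|e|e|e] := h4 W.
- by move=> t Tt; apply/hW; exists t, 0; split; [|exists 0; [sr|rewrite mul0r]|rewrite addr0].
- move=> w /hW[t [_ [Tt [b Ub ->] ->]]]; have := UX _ (TU _ Tt); have := UX _ Ub; sr.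
- by move: Wy; rewrite e.
- by move: Wy; rewrite e.
- move: Waly; rewrite e => /(quad_gen_span mV gy)[a [b [Ta Tb ev]]].
  apply: (field_gen_no_mul RT mU IU fU sM gy nUy Ual nTal Tb).
  rewrite mulrBl ev (_ : _ - _ = a); last by ring.
  exact: TU.
(* If [T + U y] were all of [X], then [al - a = u y] would be a unit modulo the conductor, hence so
   would [y], and [y (y - l) = 0] would give [y = l]. *)
- have : al \isin W by rewrite e; exact: UX.
  move=> /hW[a [_ [Ta [u Uu ->] eal]]].
  have Ua := TU _ Ta; have Ul := TU _ Tl.
  have [/cond_base hb|[c Uc hc]] := fU (al - a) (srB Ual Ua).
    by apply: nTal; rewrite -[al](subrK a); sr.
  apply: nTy; rewrite -[y](subrK l); apply: srD => //.
  rewrite (_ : y - l = (1 - (al - a) * c) * (y - l) + y * (y - l) * (u * c)); last first.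
    by rewrite eal; ring.
  have := (sM _).1 hc (y - l) (srB Vy (TV _ Tl)); have := (sM _).2 hy (u * c) (srM Uu Uc); sr.
Qed.

(** The candidate fifth ring is [T + T e x]. When it is [T], [U] or [V], the product [e x] lies in
    [U] or [V], which is all that is needed; the remaining case [W = X] is contradictory. *)
Lemma idem_nil_four T U V X e x : R <<= T -> mini T U -> rel_integral T U -> mini T V ->
  same_cond T U V -> quad_gen T U e 1 -> quad_gen T V x 0 ->
  U <<= X -> V <<= X -> four T U V X -> sumring U V.
Proof.
move=> RT mU IU mV sM ge gx UX VX h4; apply: (gen_sumring mU mV ge gx).
have [TU _ _] := mU; have [TV _ _] := mV.
have [Ue nTe _ he] := ge; have [Vx nTx _ hx] := gx; rewrite subr0 in hx.
have Tex2 c : c \isin T -> c * (e * x * (e * x)) \isin T.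
  move=> Tc; rewrite (_ : _ * _ = x * x * (e ^+ 2 * c)); last by ring.
  by apply: (sM _).2 => //; have := TU _ Tc; sr.
have [||t _ Tt [b Tb ->]|_ _ [b Tb ->] [c Tc ->]|W hW] :=
   @add_subring _ T [set z | exists2 b, b \isin T & z = b * (e * x)].
- by exists 0; rewrite ?mul0r //; sr.
- by move=> _ _ [b Tb ->] [c Tc ->]; exists (b - c); [sr|ring].
- by exists (t * b); [sr|ring].
- exists (b * c * (e * x * (e * x))), 0; split; [by apply: Tex2; sr| |by ring].
  by exists 0; [sr|rewrite mul0r].
have Wex : e * x \isin W.
  by apply/hW; exists 0, (e * x); split; [sr|exists 1; [sr|rewrite mul1r]|rewrite add0r].
have [||eW|eW|eW|eW] := h4 W.
- by move=> t Tt; apply/hW; exists t, 0; split; [|exists 0; [sr|rewrite mul0r]|rewrite addr0].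
- move=> w /hW[t [_ [Tt [b Tb ->] ->]]]; have := UX _ (TU _ Tt); have := UX _ (TU _ Tb).
  by have := UX _ Ue; have := VX _ Vx; sr.
- by exists (e * x), 0; rewrite addr0; split; [rewrite eW in Wex; exact: TU|sr|].
- by exists (e * x), 0; rewrite addr0; split; [rewrite -eW|sr|].
- by exists 0, (e * x); rewrite add0r; split; [sr|rewrite -eW|].
have : e \isin W by rewrite eW; exact: UX.
move=> /hW[a [_ [Ta [b Tb ->] ea]]]; exfalso.
have Ua := TU _ Ta.
have Ts : (e - a) ^+ 2 \isin T.
  rewrite (_ : e - a = b * (e * x)); last by rewrite {1}ea; ring.
  by rewrite (_ : _ ^+ 2 = b ^+ 2 * (e * x * (e * x))); [apply: Tex2; sr|ring].
have Mc : conductor T U (1 - a * 2).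
  apply: (@cond_cancel T U _ e) => //; first by sr.
  rewrite (_ : _ * _ = (e - a) ^+ 2 - e * (e - 1) - a ^+ 2); last by ring.
  by have := cond_base he; sr.
have Ms : conductor T U ((e - a) ^+ 2).
  apply: (@cond_cancel T U _ e) => //.
  rewrite (_ : e - a = b * (e * x)); last by rewrite {1}ea; ring.
  rewrite (_ : _ * _ = x * x * (e ^+ 3 * b ^+ 2)); last by ring.
  by apply: (sM _).2 => //; have := TU _ Tb; sr.
apply: (mini_cond1 mU).
(* Modulo the conductor [2 e - 1] squares to 1 and [2 a = 1], so [4 (e - a)^2 = 1], while [e - a] is
   nilpotent. *)
rewrite (_ : 1 = 4 * ((e - a) ^+ 2 - e * (e - 1)) + (1 - a * 2) * (1 + a * 2 - 4 * e)); last by ring.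
apply: condD; last by apply: condMr => //; sr.
by apply: condMl; [exact: condB|sr].
Qed.

End MinimalTypes.

(** * Pairs of minimal extensions *)

Section Lattices.
Variables (S : comNzRingType) (R : subring S).
Hypothesis fcpR : fcp R [set: S].
Implicit Types (A B T U V W X : subring S) (x y a b e u v : S).

(** Element-level substitute for [of_type], to which it is shown equivalent for minimal integral
    extensions above [R]. *)
Definition residual_type k T U :=
  match k with
  | Inert => residue_field T U
  | Decomposed => exists e, quad_gen T U e 1
  | Ramified => exists x, quad_gen T U x 0
  end.

Lemma four_sym T U V X : four T U V X -> four T V U X.
Proof.
move=> h W TW WX; case: (h W TW WX) => e; by [constructor 1|constructor 3|constructor 2|constructor 4].
Qed.

(** The nilpotent [x] is supported at one of the two maximal ideals separated by [e]: the sum being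
    a ring gives a scalar [k] in [T] with [e x = k x] modulo the conductor, and idempotence of [e]
    makes [k] zero or one there. *)
Lemma idem_nil_mul T U V e x : R <<= T -> mini T U -> rel_integral T U ->
  mini T V -> rel_integral T V -> same_cond T U V ->
  quad_gen T U e 1 -> quad_gen T V x 0 -> sumring U V ->
  conductor T U (e * x) \/ conductor T U ((1 - e) * x).
Proof.
move=> RT mU IU mV IV sM ge gx sUV.
have [TU _ _] := mU; have [TV _ _] := mV.
have [Ue nTe _ he] := ge; have [Vx nTx _ hx] := gx; rewrite subr0 in hx.
have MV m v : conductor T U m -> v \isin V -> conductor T U (m * v).
  by move=> /sM Mm Vv; apply/sM/condMr.
have [_ [_ [/(quad_gen_span mU ge)[a1 [b [Ta1 Tb ->]]]
            /(quad_gen_span mV gx)[a2 [c [Ta2 Tc ->]]] eex]]] := sUV _ _ Ue Vx.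
have Mx : conductor T U (x * x) by exact/sM.
have Uc := TU _ Tc; have Ub := TU _ Tb.
have h1 : conductor T U ((a1 + a2) * x + b * (e * x)).
  rewrite (_ : _ + _ = (e - c) * (x * x)); first by apply: condMl => //; sr.
  transitivity ((a1 + b * e + (a2 + c * x)) * x - c * x * x); first by ring.
  by rewrite -eex; ring.
have [k Tk hk] : exists2 k, k \isin T & conductor T U (e * x - k * x).
  have [Mb|[b' Tb' Mb]] := mini_cond fcpR RT mU IU Tb.
    have Mbex : conductor T U (b * (e * x)) by rewrite mulrA; apply: MV => //; exact: condMr.
    exists c => //; rewrite (_ : _ - _ = (a1 + a2) + b * e); last by rewrite eex; ring.
    apply: condD; last exact: condMr.
    apply/sM; apply: (@cond_cancel S R fcpR T V _ x) => //; first by sr.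
    rewrite (_ : _ * _ = (a1 + a2) * x + b * (e * x) - b * (e * x)); last by ring.
    by have := cond_base h1; have := cond_base Mbex; sr.
  exists (- (b' * (a1 + a2))); first by sr.
  rewrite (_ : _ - _ = (1 - b * b') * e * x + b' * ((a1 + a2) * x + b * (e * x))); last by ring.
  apply: condD; last by apply: condMl => //; exact: TU.
  by apply: MV => //; exact: condMr.
have Uk := TU _ Tk.
have Mkk : conductor T V (k * (1 - k)).
  apply: (@cond_cancel S R fcpR T V _ x) => //; first by sr.
  rewrite (_ : _ * _ = (e * x - k * x) * (e + k - 1) - (e * (e - 1)) * x); last by ring.
  have : conductor T U ((e * x - k * x) * (e + k - 1)) by apply: condMr => //; sr.
  by move=> /cond_base ?; have := cond_base (MV _ _ he Vx); sr.
have [Mk|[k' Tk' Mk]] := mini_cond fcpR RT mU IU Tk.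
  left; rewrite (_ : e * x = (e * x - k * x) + k * x); last by ring.
  by apply: condD => //; exact: MV.
right; rewrite (_ : _ * _ = (k * (1 - k)) * (k' * x) + (1 - k * k') * ((1 - k) * x) - (e * x - k * x));
  last by ring.
apply: condB => //; have Vk := TV _ Tk; have Vk' := TV _ Tk'.
apply: condD; last by apply: MV => //; sr.
by apply: MV; [exact/sM|sr].
Qed.

(** Multiplication by [m] and [n] splits every [W] as the sum of its intersections with [U] and [V],
    and minimality allows two values for each. *)
Lemma comax_four T U V X m n : mini T U -> mini T V -> U <<= X -> V <<= X ->
  (forall x, x \isin X -> exists u v, [/\ u \isin U, v \isin V & x = u + v]) ->
  conductor T U m -> conductor T V n -> m + n = 1 -> four T U V X.
Proof.
move=> [TU _ minU] [TV _ minV] UX VX hX Mm Nn emn W TW WX.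
have Tm := cond_base Mm; have Tn := cond_base Nn.
have [Y hY] := inter_subring W U; have [Z hZ] := inter_subring W V.
have dec w : w \isin W -> exists y z, [/\ y \isin Y, z \isin Z & w = y + z].
  move=> Ww; have [u [v [Uu Vv ew]]] := hX _ (WX _ Ww).
  have Wm := TW _ Tm; have Wn := TW _ Tn.
  have Tmu := Mm _ Uu; have Tnv := Nn _ Vv.
  exists (m * u + n * u), (m * v + n * v); split; last by rewrite ew -[LHS]mul1r -emn; ring.
    apply/hY; split; last by have := TU _ Tm; have := TU _ Tn; sr.
    rewrite (_ : n * u = n * w - n * v); last by rewrite ew; ring.
    by have := TW _ Tmu; have := TW _ Tnv; sr.
  apply/hZ; split; last by have := TV _ Tm; have := TV _ Tn; sr.
  rewrite (_ : m * v = m * w - m * u); last by rewrite ew; ring.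
  by have := TW _ Tmu; have := TW _ Tnv; sr.
have dY : Y <<= T \/ U <<= Y.
  by apply: minU => [t Tt|y /hY[]//]; apply/hY; split; [exact: TW|exact: TU].
have dZ : Z <<= T \/ V <<= Z.
  by apply: minV => [t Tt|y /hZ[]//]; apply/hZ; split; [exact: TW|exact: TV].
have YW : Y <<= W by move=> y /hY[].
have ZW : Z <<= W by move=> y /hZ[].
have YU : Y <<= U by move=> y /hY[].
have ZV : Z <<= V by move=> y /hZ[].
case: dY dZ => [YT|UY] [ZT|VZ].
- by constructor 1; apply: subring_le_anti => // w /dec[y [z [hy hz ->]]]; apply: srD; [exact: YT|exact: ZT].
- constructor 3; apply: subring_le_anti => [w /dec[y [z [hy hz ->]]]|v /VZ/ZW //].
  by apply: srD; [exact/TV/YT|exact: ZV].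
- constructor 2; apply: subring_le_anti => [w /dec[y [z [hy hz ->]]]|v /UY/YW //].
  by apply: srD; [exact: YU|exact/TU/ZT].
- constructor 4; apply: subring_le_anti => // x /hX[u [v [Uu Vv ->]]].
  by apply: srD; [exact/YW/UY|exact/ZW/VZ].
Qed.

(** After exchanging [e] and [1 - e] if necessary, [e x] vanishes modulo the conductor. An
    intermediate ring then either contains [e] or lies in [V]. *)
Lemma idem_nil_sum_four T U V X e x : R <<= T -> mini T U -> rel_integral T U ->
  mini T V -> rel_integral T V -> same_cond T U V ->
  quad_gen T U e 1 -> quad_gen T V x 0 -> sumring U V -> U <<= X -> V <<= X ->
  (forall x, x \isin X -> exists u v, [/\ u \isin U, v \isin V & x = u + v]) ->
  four T U V X.
Proof.
move=> RT mU IU mV IV sM ge gx sUV UX VX hX.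
have [TU _ _] := mU; have [TV _ minV] := mV.
wlog Mex : e ge / conductor T U (e * x).
  move=> wl; have [h|h] := idem_nil_mul RT mU IU mV IV sM ge gx sUV; first exact: (wl e).
  by apply: (wl (1 - e)) => //; exact: quad_gen_opp.
have [Ue nTe _ he] := ge; have [Vx nTx _ hx] := gx; rewrite subr0 in hx.
move=> W TW WX.
(* For [w = a + b e + c x] with [b] invertible modulo the conductor, [(w - a)^2] is [b^2 e] up to
   elements of the conductor, so [w] yields [e]. *)
have dec w : w \isin W -> ~ e \isin W -> w \isin V.
  move=> Ww nWe; have [_ [_ [/(quad_gen_span mU ge)[a1 [b [Ta1 Tb ->]]]
            /(quad_gen_span mV gx)[a2 [c [Ta2 Tc ->]]] ew]]] := hX _ (WX _ Ww).
  have [Mb|[b' Tb' Mb]] := mini_cond fcpR RT mU IU Tb.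
    by rewrite ew; have := TV _ (Mb _ Ue); have := TV _ Ta1; have := TV _ Ta2; have := TV _ Tc; sr.
  case: nWe.
  have Wb := TW _ Tb; have Wa1 := TW _ Ta1; have Wa2 := TW _ Ta2; have Wb' := TW _ Tb'.
  have Ub := TU _ Tb; have Ub' := TU _ Tb'.
  have Wz : (w - a1 - a2) ^+ 2 \isin W by sr.
  have Th : (w - a1 - a2) ^+ 2 - b ^+ 2 * e \isin T.
    rewrite (_ : _ - _ = b ^+ 2 * (e * (e - 1)) + 2 * b * c * (e * x) + c ^+ 2 * (x * x)); last by rewrite ew; ring.
    by have := cond_base he; have := cond_base hx; have := cond_base Mex; sr.
  rewrite (_ : e = b' ^+ 2 * ((w - a1 - a2) ^+ 2 - ((w - a1 - a2) ^+ 2 - b ^+ 2 * e)) +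
      (1 - b * b') * ((1 + b * b') * e)); last by ring.
  have Th2 : (1 - b * b') * ((1 + b * b') * e) \isin T by apply: Mb; sr.
  by have := TW _ Th; have := TW _ Th2; sr.
have [We|nWe] := pselect (e \isin W); last first.
  have WV : W <<= V by move=> w /dec; apply.
  case: (minV W TW WV) => h; first by constructor 1; exact: subring_le_anti.
  by constructor 3; exact: subring_le_anti.
have UW : U <<= W by move=> u /(quad_gen_span mU ge)[a [b [Ta Tb ->]]]; sr.
have [Z hZ] := inter_subring W V.
case: (minV Z) => [t Tt|z /hZ[]//|ZT|VZ].
- by apply/hZ; split; [exact: TW|exact: TV].
- constructor 2; apply: subring_le_anti => // w Ww; have [u [v [Uu Vv ew]]] := hX _ (WX _ Ww).
  rewrite ew; apply: srD => //; apply/TU/ZT/hZ; split=> //.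
  by rewrite (_ : v = w - u); [have := UW _ Uu; sr|rewrite ew; ring].
constructor 4; apply: subring_le_anti => // y /hX[u [v [Uu Vv ->]]].
by have /hZ[? _] := VZ _ Vv; have := UW _ Uu; sr.
Qed.

(** With equal conductors an inert extension never has a ring as its sum with another type, so only
    the decomposed-ramified pair needs a lattice computation. *)
Lemma types_sum_four T U V X k l : R <<= T -> mini T U -> rel_integral T U ->
  mini T V -> rel_integral T V -> k <> l -> residual_type k T U -> residual_type l T V ->
  sumring U V -> U <<= X -> V <<= X ->
  (forall x, x \isin X -> exists u v, [/\ u \isin U, v \isin V & x = u + v]) ->
  four T U V X.
Proof.
move=> RT mU IU mV IV nkl tU tV sUV UX VX hX.
have [sM|[m [n [Mm Nn e]]]] := cond_dichotomy fcpR RT mU IU mV IV; last first.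
  exact: comax_four Mm Nn e.
have hX' x : x \isin X -> exists v u, [/\ v \isin V, u \isin U & x = v + u].
  by move=> /hX[u [v [? ? ->]]]; exists v, u; rewrite addrC.
have sVU := sumring_sym sUV; have sM' := same_cond_sym sM.
case: k l nkl tU tV => -[] //= _.
- by move=> fU [y gy]; case: (field_gen_nosum RT mU IU mV fU sM gy).
- by move=> fU [y gy]; case: (field_gen_nosum RT mU IU mV fU sM gy).
- by move=> [y gy] fV; case: (field_gen_nosum RT mV IV mU fV sM' gy).
- move=> [e ge] [x gx]; exact: idem_nil_sum_four ge gx sUV UX VX hX.
- by move=> [y gy] fV; case: (field_gen_nosum RT mV IV mU fV sM' gy).
- move=> [x gx] [e ge]; apply: four_sym.
  exact: idem_nil_sum_four ge gx sVU VX UX hX'.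
Qed.

Lemma types_four_sum T U V X k l : R <<= T -> mini T U -> rel_integral T U ->
  mini T V -> rel_integral T V -> k <> l -> residual_type k T U -> residual_type l T V ->
  U <<= X -> V <<= X -> four T U V X -> sumring U V.
Proof.
move=> RT mU IU mV IV nkl tU tV UX VX h4.
have [TU _ _] := mU; have [TV _ _] := mV.
have [sM|[m [n [Mm Nn e]]]] := cond_dichotomy fcpR RT mU IU mV IV; last first.
  exact: comax_sumring Mm Nn e.
have sM' := same_cond_sym sM; have h4' := four_sym h4.
case: k l nkl tU tV => -[] //= _.
- by move=> fU [y gy]; case: (field_gen_nofour RT mU IU mV fU sM gy UX VX).
- by move=> fU [y gy]; case: (field_gen_nofour RT mU IU mV fU sM gy UX VX).
- by move=> [y gy] fV; case: (field_gen_nofour RT mV IV mU fV sM' gy VX UX).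
- by move=> [e ge] [x gx]; exact: (idem_nil_four fcpR RT mU IU mV sM ge gx UX VX).
- by move=> [y gy] fV; case: (field_gen_nofour RT mV IV mU fV sM' gy VX UX).
- move=> [x gx] [e ge]; apply: sumring_sym.
  exact: (idem_nil_four fcpR RT mV IV mU sM' ge gx VX UX).
Qed.

Lemma types_neq T U V k l : R <<= T -> mini T U -> rel_integral T U ->
  k <> l -> residual_type k T U -> residual_type l T V -> U <> V.
Proof.
move=> RT mU IU nkl tU tV e; subst V; have [TU _ _] := mU.
case: k l nkl tU tV => -[] //= _.
- by move=> fU [y]; exact: field_no_gen.
- by move=> fU [y]; exact: field_no_gen.
- by move=> [y gy] fU; exact: (field_no_gen TU fU gy).
- by move=> [e ge] [x gx]; exact: (quad_gen_excl fcpR RT mU IU gx ge).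
- by move=> [y gy] fU; exact: (field_no_gen TU fU gy).
- by move=> [x gx] [e ge]; exact: (quad_gen_excl fcpR RT mU IU gx ge).
Qed.

Lemma adjoin_sumring T U V y z : T <<= U -> T <<= V ->
  U <<= adjoin T y -> V <<= adjoin T z ->
  (forall i j, exists u v, [/\ u \isin U, v \isin V & y ^+ i * z ^+ j = u + v]) ->
  sumring U V.
Proof.
move=> TU TV Uy Vz h u v Uu Vv.
pose P x := exists u v, [/\ u \isin U, v \isin V & x = u + v].
have PD a b : P a -> P b -> P (a + b).
  by move=> [u1 [v1 [? ? ->]]] [u2 [v2 [? ? ->]]]; exists (u1 + u2), (v1 + v2); split; [sr|sr|ring].
have PZ t a : t \isin T -> P a -> P (t * a).
  move=> Tt [u1 [v1 [? ? ->]]]; exists (t * u1), (t * v1).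
  by rewrite mulrDr; have := TU _ Tt; have := TV _ Tt; split=> //; sr.
have P0 : P 0 by exists 0, 0; rewrite addr0; split=> //; sr.
have powers W w x : W <<= adjoin T w -> x \isin W ->
    exists n (c : nat -> S), (forall i, c i \isin T) /\ x = \sum_(i < n) c i * w ^+ i.
  move=> Ww /Ww[p ->]; exists (size p), (fun i => val p`_i); split=> [i|]; first exact: valP_sr.
  rewrite (@horner_coef_wide _ (size p)) ?size_poly //; apply: eq_bigr => i _.
  by rewrite coef_poly ltn_ord.
have [n [c [Tc ->]]] := powers _ _ _ Uy Uu.
have [m [d [Td ->]]] := powers _ _ _ Vz Vv.
change (P ((\sum_(i < n) c i * y ^+ i) * (\sum_(j < m) d j * z ^+ j))).
rewrite mulr_suml; apply: (big_ind P) => // i _; rewrite mulr_sumr; apply: (big_ind P) => // j _.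
rewrite (_ : _ * _ = c i * (d j * (y ^+ i * z ^+ j))); last by ring.
by apply: (PZ) => //; apply: PZ => //; exact: h.
Qed.

(** Normalise [e] and [f] to kill [x] modulo the conductor. Multiplying [e f = a + b e + c f + d x]
    by [x], [e], [f] gives [a = 0], [(1 - c) e f = b e] and [(1 - b) e f = c f]. Thus [e f] lies in
    [U] or [V] unless [b = c = 1], which would give [e = 0]. *)
Lemma idem_nil_idem T U V N e f x : R <<= T -> mini T U -> rel_integral T U ->
  mini T V -> rel_integral T V -> mini T N -> rel_integral T N ->
  same_cond T U V -> same_cond T U N ->
  quad_gen T U e 1 -> quad_gen T V f 1 -> quad_gen T N x 0 ->
  sumring U N -> sumring V N ->
  (forall u v, u \isin U -> v \isin V -> exists n u' v',
     [/\ n \isin N, u' \isin U, v' \isin V & u * v = n + u' + v']) ->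
  sumring U V.
Proof.
move=> RT mU IU mV IV mN IN sUV sUN ge gf gx sumUN sumVN H.
have [TU _ _] := mU; have [TV _ _] := mV; have [TN _ _] := mN.
have sVN : same_cond T V N by move=> m; split=> [/sUV/sUN|/sUN/sUV].
have MV m v : conductor T U m -> v \isin V -> conductor T U (m * v).
  by move=> /sUV Mm Vv; apply/sUV/condMr.
have MN m v : conductor T U m -> v \isin N -> conductor T U (m * v).
  by move=> /sUN Mm Vv; apply/sUN/condMr.
wlog Mex : e ge / conductor T U (e * x).
  move=> wl; have [h|h] := idem_nil_mul RT mU IU mN IN sUN ge gx sumUN; first exact: (wl e).
  by apply: (wl (1 - e)) => //; exact: quad_gen_opp.
wlog Mfx : f gf / conductor T V (f * x).
  move=> wl; have [h|h] := idem_nil_mul RT mV IV mN IN sVN gf gx sumVN; first exact: (wl f).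
  by apply: (wl (1 - f)) => //; exact: quad_gen_opp.
apply: (gen_sumring mU mV ge gf).
have [Ue nTe _ he] := ge; have [Vf nTf _ hf] := gf; have [Nx nTx _ hx] := gx.
rewrite subr0 in hx; move/sUN: hx => hx; move/sUV: hf => hf; move/sUV: Mfx => Mfx.
have [_ [_ [_ [/(quad_gen_span mN gx)[a1 [d [Ta1 Td ->]]]
   /(quad_gen_span mU ge)[a2 [b [Ta2 Tb ->]]]
   /(quad_gen_span mV gf)[a3 [c [Ta3 Tc ->]]] eef]]]] := H _ _ Ue Vf.
have Ub := TU _ Tb; have Uc := TU _ Tc; have Ud := TU _ Td.
pose a := a1 + a2 + a3; have Ta : a \isin T by rewrite /a; sr.
have eef' : e * f = a + b * e + c * f + d * x by rewrite eef /a; ring.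
have Ma : conductor T U a.
  apply/sUN; apply: (@cond_cancel S R fcpR T N _ x) => //.
  rewrite (_ : a * x = e * x * f - b * (e * x) - c * (f * x) - d * (x * x)); last first.
    by rewrite (_ : e * x * f = x * (e * f)); [rewrite eef'; ring|ring].
  by have := cond_base (MV _ _ Mex Vf); have := cond_base Mex; have := cond_base Mfx;
     have := cond_base hx; sr.
have h1 : conductor T U ((1 - c) * (e * f) - b * e).
  rewrite (_ : _ - _ = a * e + (b - f) * (e * (e - 1)) + d * (e * x)); last first.
    transitivity (e * (a + b * e + c * f + d * x) - e * (e - 1) * f - c * (e * f) - b * e); last by ring.
    by rewrite -eef'; ring.
  apply: condD; last by exact: condMl.
  apply: condD; first exact: condMr.
  by rewrite mulrBl; apply: condB; [exact: condMl|rewrite mulrC; exact: MV].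
have h2 : conductor T U ((1 - b) * (e * f) - c * f).
  rewrite (_ : _ - _ = a * f + (c - e) * (f * (f - 1)) + d * (f * x)); last first.
    transitivity (f * (a + b * e + c * f + d * x) - f * (f - 1) * e - b * (e * f) - c * f); last by ring.
    by rewrite -eef'; ring.
  apply: condD; last by exact: condMl.
  apply: condD; first exact: MV.
  by rewrite mulrBl; apply: condB; exact: condMl.
have [Mc|[c' Tc' Mc']] := mini_cond fcpR RT mU IU (srB (sr1 T) Tc); last first.
  exists (c' * b * e + c' * ((1 - c) * (e * f) - b * e) + (1 - (1 - c) * c') * e * f), 0.
  split; [|sr|by ring].
  have := TU _ Tc'; have := TU _ (cond_base h1).
  by have := TU _ (cond_base (MV _ _ (condMr Mc' Ue) Vf)); sr.
have [Mb|[b' Tb' Mb']] := mini_cond fcpR RT mU IU (srB (sr1 T) Tb); last first.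
  exists 0, (b' * c * f + b' * ((1 - b) * (e * f) - c * f) + (1 - (1 - b) * b') * e * f).
  split; [sr| |by ring].
  have := TV _ Tb'; have := TV _ (cond_base h2); have := TV _ Tc.
  by have := TV _ (cond_base (MV _ _ (condMr Mb' Ue) Vf)); sr.
case: nTe; rewrite (_ : e = (1 - c) * e * f + (1 - b) * e - ((1 - c) * (e * f) - b * e)); last by ring.
have := cond_base (MV _ _ (condMr Mc Ue) Vf); have := cond_base (condMr Mb Ue).
by have := cond_base h1; sr.
Qed.

End Lattices.

(** * Delta-extensions *)

Section Delta.
Variables (S : comNzRingType) (R : subring S).
Hypothesis fcpR : fcp R [set: S].
Implicit Types (A B C P Q T U V W X N : subring S) (x y a b e u v t : S).

Lemma notin_subset T U : ~ U <<= T -> exists2 x, x \isin U & ~ x \isin T.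
Proof.
move=> nUT; apply: contrapT => /forall2NP h; apply: nUT => x Ux.
by case: (h x) => // /contrapT.
Qed.

Lemma rel_integralS C T U : R <<= T -> U <<= C -> rel_integral R C -> rel_integral T U.
Proof. by move=> RT UC IC x /UC /IC; exact: integral_sub_closure. Qed.

(* Both [U] and [V] are generated over [T] by elements of [B]. *)
Lemma descend_sumring (L : subring S) B T U V : delta L B -> L <<= T -> L <<= B -> mini T U -> mini T V ->
  (exists y, [/\ y \isin U, y \isin B & ~ y \isin T]) ->
  (exists z, [/\ z \isin V, z \isin B & ~ z \isin T]) -> sumring U V.
Proof.
move=> /deltaP dB LT LB mU mV [y [Uy By nTy]] [z [Vz Bz nTz]].
have [TU _ _] := mU; have [TV _ _] := mV.
have [Y hY] := inter_subring U B; have [Z hZ] := inter_subring V B.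
apply: (adjoin_sumring (T := T) (y := y) (z := z)) => //; try exact: mini_adjoin.
move=> i j.
have sYZ : sumring Y Z.
  apply: dB => [x Lx|x /hY[]//|x Lx|x /hZ[]//]; [apply/hY|apply/hZ]; split; try exact: LB.
    exact/TU/LT.
  exact/TV/LT.
have [|| p [q [/hY[Up _] /hZ[Vq _] e]]] := sYZ (y ^+ i) (z ^+ j).
- by apply/hY; split; sr.
- by apply/hZ; split; sr.
by exists p, q.
Qed.

(** Otherwise [P] and [U] meet inside [T]. Then the intersection of [T] and [P] is seminormal in
    [U], and [seminormal_up] transfers this to [T]. *)
Lemma seminormal_descent P C T U : R <<= P -> R <<= T -> mini T U -> U <<= C -> rel_integral R C ->
  seminormal P C -> ~ seminormal T U -> exists y, [/\ y \isin U, y \isin P & ~ y \isin T].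
Proof.
move=> RP RT mU UC IC sP nsT; apply: contrapT => /forallNP h; apply: nsT.
have [TU _ _] := mU.
have inT y : y \isin U -> y \isin P -> y \isin T.
  by move=> Uy Py; apply: contrapT => nTy; apply: (h y).
have [A hA] := inter_subring T P.
apply: (@seminormal_up S R fcpR A) => //.
- by move=> x Rx; apply/hA; split; [exact: RT|exact: RP].
- by move=> x /hA[].
- by apply: rel_integralS UC IC => x Rx; apply/hA; split; [exact: RT|exact: RP].
move=> b Ub /hA[_ P2] /hA[_ P3]; have Pb : b \isin P by apply: sP => //; exact: UC.
by apply/hA; split=> //; exact: inT.
Qed.

Lemma tclosed_descent P C T U : R <<= P -> R <<= T -> mini T U -> U <<= C -> rel_integral R C ->
  tclosed P C -> ~ tclosed T U -> exists y, [/\ y \isin U, y \isin P & ~ y \isin T].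
Proof.
move=> RP RT mU UC IC sP nsT; apply: contrapT => /forallNP h; apply: nsT.
have [TU _ _] := mU.
have inT y : y \isin U -> y \isin P -> y \isin T.
  by move=> Uy Py; apply: contrapT => nTy; apply: (h y).
have [A hA] := inter_subring T P.
apply: (@tclosed_up S R fcpR A) => //.
- by move=> x Rx; apply/hA; split; [exact: RT|exact: RP].
- by move=> x /hA[].
- by apply: rel_integralS UC IC => x Rx; apply/hA; split; [exact: RT|exact: RP].
move=> b r Ub /hA[_ Pr] /hA[_ P2] /hA[_ P3].
have Pb : b \isin P by apply: (sP b r) => //; exact: UC.
by apply/hA; split=> //; exact: inT.
Qed.

(** [T + T b] is a ring, so a minimal [N] inside it contains some [k b] outside [T]. The same type
    of equations then holds for [k b], with [k r] in place of [r]. *)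
Lemma nontclosed_step T X b r : R <<= T -> T <<= X -> b \isin X -> ~ b \isin T -> r \isin T ->
  b ^+ 2 - r * b \isin T -> b ^+ 3 - r * b ^+ 2 \isin T ->
  exists N k, [/\ mini T N, N <<= X, k \isin T, k * b \isin N & ~ k * b \isin T].
Proof.
move=> RT TX Xb nTb Tr T2 T3.
have [||t _ Tt [c Tc ->]|_ _ [c Tc ->] [d Td ->]|W hW] :=
   @add_subring _ T [set z | exists2 c, c \isin T & z = c * b].
- by exists 0; rewrite ?mul0r //; sr.
- by move=> _ _ [c Tc ->] [d Td ->]; exists (c - d); [sr|ring].
- by exists (t * c); [sr|ring].
- exists (c * d * (b ^+ 2 - r * b)), (c * d * r * b); split; [by sr| |by ring].
  by exists (c * d * r) => //; sr.
have TW : T <<= W.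
  by move=> t Tt; apply/hW; exists t, 0; split; [|exists 0; [sr|rewrite mul0r]|rewrite addr0].
have Wb : b \isin W.
  by apply/hW; exists 0, b; split; [sr|exists 1; [sr|rewrite mul1r]|rewrite add0r].
have [|N [mN NW]] := mini_exists fcpR RT TW; first by move/(_ _ Wb).
have [TN nNT _] := mN; have [y Ny nTy] := notin_subset nNT.
have /hW[a [_ [Ta [k Tk ->] ey]]] := NW _ Ny.
have ekb : k * b = y - a by rewrite ey; ring.
exists N, k; split=> //.
- by move=> w /NW/hW[t [_ [Tt [c Tc ->] ->]]]; have := TX _ Tt; have := TX _ Tc; sr.
- by rewrite ekb; have := TN _ Ta; sr.
by rewrite ekb => h; apply: nTy; rewrite -[y](subrK a); sr.
Qed.

Lemma nonseminormal_mini T C : R <<= T -> T <<= C -> ~ seminormal T C ->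
  exists N, [/\ mini T N, N <<= C & ~ seminormal T N].
Proof.
move=> RT TC; apply: contra_notP => /forallNP h b Cb T2 T3; apply: contrapT => nTb.
have [|||N [k [mN NC Tk Nkb nTkb]]] := @nontclosed_step T C b 0 RT TC Cb nTb.
- by sr.
- by rewrite mul0r subr0.
- by rewrite mul0r subr0.
apply: (h N); split=> // sN; apply/nTkb/sN => //.
  by rewrite exprMn; sr.
by rewrite exprMn; sr.
Qed.

Lemma nontclosed_mini T C : R <<= T -> T <<= C -> ~ tclosed T C ->
  exists N, [/\ mini T N, N <<= C & ~ tclosed T N].
Proof.
move=> RT TC; apply: contra_notP => /forallNP h b r Cb Tr T2 T3; apply: contrapT => nTb.
have [N [k [mN NC Tk Nkb nTkb]]] := nontclosed_step RT TC Cb nTb Tr T2 T3.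
apply: (h N); split=> // sN; apply/nTkb/(sN _ (k * r)) => //; first by sr.
  by rewrite (_ : _ - _ = k ^+ 2 * (b ^+ 2 - r * b)); [sr|ring].
by rewrite (_ : _ - _ = k ^+ 3 * (b ^+ 3 - r * b ^+ 2)); [sr|ring].
Qed.

(** [U + N] and [V + N] are minimal over [N], where the sum is already known to be a ring; this
    gives [u v] up to a term of [N]. *)
Lemma sumring_through C T N U V : mini T U -> mini T V -> T <<= N -> N <<= C ->
  U <<= C -> V <<= C -> ~ U <<= N -> ~ V <<= N -> sumring U N -> sumring V N ->
  (forall U' V', U' <<= C -> V' <<= C -> mini N U' -> mini N V' -> sumring U' V') ->
  forall u v, u \isin U -> v \isin V -> exists n u' v',
     [/\ n \isin N, u' \isin U, v' \isin V & u * v = n + u' + v'].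
Proof.
move=> mU mV TN NC UC VC nUN nVN sUN sVN IH u v Uu Vv.
have [U' [NU' UU' hU' [//|mU']]] := sumring_mini mU TN sUN.
have [V' [NV' VV' hV' [//|mV']]] := sumring_mini mV TN sVN.
have [||u1 [v1 [/hU'[u2 [n2 [? ? ->]]] /hV'[v3 [n3 [? ? ->]]] e]]] :=
  IH U' V' _ _ mU' mV' u v (UU' _ Uu) (VV' _ Vv).
- by move=> x /hU'[y [n [hy hn ->]]]; apply: srD; [exact: UC|exact: NC].
- by move=> x /hV'[y [n [hy hn ->]]]; apply: srD; [exact: VC|exact: NC].
by exists (n2 + n3), u2, v3; split=> //; [sr|rewrite e; ring].
Qed.

(** In [u v = m u v + n u v], [m u] falls in [T], and [n] brings the unwanted [N]-component into
    [T]. *)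
Lemma comax_through T N U V m n : T <<= U -> T <<= V -> T <<= N ->
  conductor T U m -> conductor T N n -> m + n = 1 ->
  (forall u v, u \isin U -> v \isin V -> exists n u' v',
     [/\ n \isin N, u' \isin U, v' \isin V & u * v = n + u' + v']) -> sumring U V.
Proof.
move=> TU TV TN Mm Nn e H u v Uu Vv.
have [k [u' [v' [Nk Uu' Vv' ek]]]] := H u v Uu Vv.
have Tn := cond_base Nn.
exists (n * k + n * u'), (m * u * v + n * v'); split.
- by have := TU _ (Nn _ Nk); have := TU _ Tn; sr.
- by have := TV _ (Mm _ Uu); have := TV _ Tn; sr.
transitivity (m * (u * v) + n * (u * v)); first by rewrite -mulrDl e mul1r.
by rewrite {2}ek; ring.
Qed.

Lemma delta_integral C P Q : R <<= P -> P <<= Q -> Q <<= C -> rel_integral R C ->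
  seminormal P C -> tclosed Q C ->
  (forall T, R <<= T -> T <<= C -> seminormal T C -> P <<= T) ->
  (forall T, R <<= T -> T <<= C -> tclosed T C -> Q <<= T) ->
  delta R P -> delta P Q -> delta Q C ->
  (forall T U V k l, R <<= T -> U <<= C -> V <<= C -> mini T U -> mini T V -> k <> l ->
     residual_type k T U -> residual_type l T V -> sumring U V) ->
  delta R C.
Proof.
move=> RP PQ QC IC sP tQ leastP leastQ dRP dPQ dQC H2.
have RQ : R <<= Q by move=> x /RP /PQ.
apply/deltaP; apply: (sumring_local fcpR (fun x h => h)).
move=> T U V RT; elim/(fcp_up_ind fcpR): T / RT U V => T RT IH U V UC VC mU mV.
have IU := rel_integralS RT UC IC; have IV := rel_integralS RT VC IC.
have [TU _ _] := mU; have [TV _ _] := mV.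
have TC : T <<= C by move=> x /TU /UC.
have [sM|[m [n [Mm Nn e]]]] := cond_dichotomy fcpR RT mU IU mV IV; last first.
  exact: comax_sumring Mm Nn e.
(* Passage through an auxiliary [N] of a type other than the common type of [U] and [V]: [H2]
   handles the sums with [N], induction handles the base [N], and only equal conductors are left to
   [goal]. *)
have thr N k l : mini T N -> N <<= C -> residual_type l T N -> residual_type k T U ->
    residual_type k T V -> k <> l -> (same_cond T U N -> 
    (forall u v, u \isin U -> v \isin V -> exists n u' v',
     [/\ n \isin N, u' \isin U, v' \isin V & u * v = n + u' + v']) -> 
    sumring U N -> sumring V N -> sumring U V) -> sumring U V.
  move=> mN NC tN tU tV nkl goal; have IN := rel_integralS RT NC IC; have [TN nNT minN] := mN.
  have sUN : sumring U N by exact: (H2 T U N k l).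
  have sVN : sumring V N by exact: (H2 T V N k l).
  have notle X : mini T X -> rel_integral T X -> residual_type k T X -> ~ X <<= N.
    move=> mX IX tX XN; have [TX nXT _] := mX.
    case: (minN X TX XN) => // NX; apply: (types_neq fcpR RT mX IX nkl tX tN).
    exact: subring_le_anti.
  have H : forall u v, u \isin U -> v \isin V -> exists n u' v',
     [/\ n \isin N, u' \isin U, v' \isin V & u * v = n + u' + v'].
    apply: (sumring_through mU mV TN NC UC VC) => //; try exact: notle.
    by apply: IH => // x /RT; exact: TN.
  have [sUNc|[m [n [Mm Nn e]]]] := cond_dichotomy fcpR RT mU IU mN IN; last first.
    exact: comax_through Mm Nn e H.
  exact: goal.
case: (mini_types fcpR RT mU IU) => [[nsU gU]|[sU ntU gU]|[tU gU]];
  case: (mini_types fcpR RT mV IV) => [[nsV gV]|[sV ntV gV]|[tV gV]];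
  try (by apply: (H2 T U V Ramified Decomposed)); try (by apply: (H2 T U V Ramified Inert));
  try (by apply: (H2 T U V Decomposed Ramified)); try (by apply: (H2 T U V Decomposed Inert));
  try (by apply: (H2 T U V Inert Decomposed)); try (by apply: (H2 T U V Inert Ramified)).
- apply: (descend_sumring dRP RT) => //.
    exact: (seminormal_descent RP RT mU UC IC sP nsU).
  exact: (seminormal_descent RP RT mV VC IC sP nsV).
(* Both decomposed: either [T] contains [P] and generators are found in [Q], or a ramified [N]
   exists over [T]. *)
- have [sT|nsT] := pselect (seminormal T C).
    by apply: (descend_sumring dPQ (leastP _ RT TC sT)) => //; [
       exact: (tclosed_descent RQ RT mU UC IC tQ ntU)|exact: (tclosed_descent RQ RT mV VC IC tQ ntV)].
  have [N [mN NC nsN]] := nonseminormal_mini RT TC nsT.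
  have IN := rel_integralS RT NC IC.
  have gN := nonseminormal_gen fcpR RT mN IN nsN.
  apply: (thr N Decomposed Ramified) => // sUN H sumUN sumVN.
  have [e ge] := gU; have [f gf] := gV; have [x gx] := gN.
  exact: (idem_nil_idem fcpR RT mU IU mV IV mN IN sM sUN ge gf gx).
(* Both inert: over a base that is not t-closed, a non-inert [N] with the same conductor would give
   a sum with [U] that is not a ring, against [H2]. *)
- have [tT|ntT] := pselect (tclosed T C).
    by apply: (deltaP Q C).1 => // x; [move=> /(leastQ _ RT TC tT) /TU|
       move=> /(leastQ _ RT TC tT) /TV].
  have [N [mN NC ntN]] := nontclosed_mini RT TC ntT.
  have IN := rel_integralS RT NC IC.
  case: (mini_types fcpR RT mN IN) => [[nsN gN]|[sN _ gN]|[//]].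
    apply: (thr N Inert Ramified) => // sUN H sumUN sumVN.
    by have [y gy] := gN; case: (field_gen_nosum RT mU IU mN gU sUN gy).
  apply: (thr N Inert Decomposed) => // sUN H sumUN sumVN.
  by have [y gy] := gN; case: (field_gen_nosum RT mU IU mN gU sUN gy).
Qed.

(** * Integrally closed extensions and the reduction to the integral closure *)

Lemma integral_pow A x m : x ^+ m.+1 \isin A -> x \isin integral_closure A.
Proof.
move=> Ax; apply: (@integral_intro _ A x m.+1 (fun i => if i == 0 then x ^+ m.+1 else 0)).
  by move=> i; case: eqP => _ //; exact: sr0.
rewrite big_ord_recl /= expr0 mulr1 big1 ?addr0 // => i _.
by rewrite mul0r.
Qed.

Lemma lead_coef_integral A y n (d : nat -> S) : (forall i, d i \isin A) ->
  \sum_(i < n.+2) d i * y ^+ i = 0 -> d n.+1 * y \isin integral_closure A.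
Proof.
move=> Ad; rewrite big_ord_recr /= => e.
apply: (@integral_intro _ A _ n.+1 (fun i => - (d i * d n.+1 ^+ (n - i)))).
  by move=> i; have := Ad i; have := Ad n.+1; sr.
transitivity (d n.+1 ^+ n * (d n.+1 * y ^+ n.+1)).
  by rewrite exprMn [d n.+1 ^+ n.+1]exprSr; ring.
move: e => /eqP; rewrite addrC addr_eq0 => /eqP->.
rewrite mulrN mulr_sumr -sumrN; apply: eq_bigr => i _.
have -> : d n.+1 ^+ n = d n.+1 ^+ (n - i) * d n.+1 ^+ i.
  by rewrite -exprD subnK // -ltnS.
by rewrite exprMn; ring.
Qed.

(* Seidenberg's lemma: descending through the polynomial, the leading
   coefficient times [y] can be absorbed into the next coefficient. *)
Lemma seidenberg A U y n (d : nat -> S) : A <<= U -> int_closed_in A U -> y \isin U ->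
  (forall i, d i \isin A) -> \sum_(i < n.+2) d i * y ^+ i = 0 ->
  exists j, [/\ j \isin A, j * y \isin A & (d 1 + j * y) * y \isin A].
Proof.
move=> AU icA Uy; elim: n d => [|n IH] d Ad e.
  exists 0; rewrite mul0r addr0; split; [sr|sr|].
  move: e; rewrite !big_ord_recr big_ord0 /= add0r expr0 expr1 mulr1 addrC => /eqP.
  by rewrite addr_eq0 => /eqP ->; have := Ad 0; sr.
have Ady : d n.+2 * y \isin A.
  apply: icA; first by have := AU _ (Ad n.+2); sr.
  exact: lead_coef_integral e.
pose d' i := if i == n.+1 then d n.+1 + d n.+2 * y else d i.
have [i|| j [Aj Ajy Adj]] := IH d'.
- by rewrite /d'; case: eqP => _; have := Ad n.+1; have := Ad i; sr.
- rewrite -[RHS]e big_ord_recr /= [in RHS]big_ord_recr [in RHS]big_ord_recr /=.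
  rewrite -addrA; congr (_ + _).
    by apply: eq_bigr => i _; rewrite /d' ltn_eqF.
  by rewrite /d' eqxx [y ^+ n.+2]exprS; ring.
have [k [Ak Aky ek]] : exists k, [/\ k \isin A, k * y \isin A & d' 1 = d 1 + k * y].
  rewrite /d'; case: n {IH e d' Adj} Ady => [|n] Ady; first by exists (d 2).
  by exists 0; rewrite mul0r addr0; split=> //; sr.
exists (k + j); split; [by sr|by rewrite mulrDl; sr|].
by rewrite (_ : d 1 + _ = d' 1 + j * y) //; rewrite ek; ring.
Qed.

(** The (u, 1/u) argument. FCP makes [A[t^(2^k)]] stationary, so [y = t^(2^k)] is a polynomial in
    [y^2]: a relation with linear coefficient -1, to which [seidenberg] applies. *)
Lemma int_closed_denom A U t : R <<= A -> A <<= U -> int_closed_in A U -> t \isin U ->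
  exists i j, [/\ i \isin A, i * t \isin A, j \isin A, j * t \isin A & 1 = i + j * t].
Proof.
move=> RA AU icA Ut.
have [k Rf|k|k hk] := fcp_down_stab (f := fun k => adjoin A (t ^+ (2 ^ k))) fcpR.
- by move=> /RA; exact: adjoin_base.
- apply: adjoin_min; first exact: adjoin_base.
  by rewrite expnSr exprM; have := adjoin_gen A (t ^+ (2 ^ k)); sr.
pose m := (2 ^ k).-1; have em : (2 ^ k)%N = m.+1 by rewrite prednK // expn_gt0.
have := hk _ (adjoin_gen A _); rewrite expnSr exprM em; set y := t ^+ m.+1.
have Uy : y \isin U by rewrite /y; sr.
move=> [p ey].
have [c [n [Ac ec]]] : exists (c : nat -> S) n, (forall i, c i \isin A) /\
    y = \sum_(i < n.+1) c i * y ^+ i.*2.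
  exists (fun i => val p`_i), (size p); split=> [i|]; first exact: valP_sr.
  rewrite {1}ey (@horner_coef_wide _ (size p).+1); last exact/leqW/size_poly.
  by apply: eq_bigr => i _; rewrite (@coef_map _ _ (val : {rmorphism subring_type A -> S})) -exprM mul2n.
pose g i := if odd i then 0 else c i./2.
have eg : \sum_(i < n.*2.+2) g i * y ^+ i = y.
  rewrite [RHS]ec -doubleS; elim: (n.+1) => [|q IHq]; first by rewrite !big_ord0.
  rewrite doubleS !big_ord_recr /= IHq /g /= odd_double doubleK /=.
  by rewrite mul0r addr0.
pose d i := g i - (i == 1)%:R.
have Ad i : d i \isin A.
  by rewrite /d /g; have := Ac i./2; case: odd; case: eqP => _ ?; rewrite ?subr0 /=; sr.
have ed : \sum_(i < n.*2.+2) d i * y ^+ i = 0.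
  have ey1 : \sum_(i < n.*2.+2) (i == 1 :> nat)%:R * y ^+ i = y.
    rewrite !big_ord_recl /= mul0r mul1r add0r expr1 big1 ?addr0 // => i _.
    by rewrite mul0r.
  transitivity (\sum_(i < n.*2.+2) g i * y ^+ i
     - \sum_(i < n.*2.+2) (i == 1 :> nat)%:R * y ^+ i); last by rewrite eg ey1 subrr.
  by rewrite -sumrB; apply: eq_bigr => i _; rewrite mulrBl.
have [j [Aj Ajy]] := seidenberg AU icA Uy Ad ed.
rewrite /d /g /= sub0r => Adj.
pose i := 1 - j * y; have Ai : i \isin A by rewrite /i; sr.
have Aiy : i * y \isin A.
  by rewrite (_ : i * y = - ((- 1 + j * y) * y)); [sr|rewrite /i; ring].
have Ui := AU _ Ai; have Uj := AU _ Aj.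
(* [(i t)^(m+1) = i^m (i y)] and [(j t^m)^(m+1) = j (j y)^m] are in [A], so integral closedness
   brings [i t] and [j t^m] into [A]. *)
exists i, (j * t ^+ m); split=> //.
- apply: icA; first by sr.
  apply: (@integral_pow A _ m).
  rewrite exprMn exprS (_ : _ * _ = i ^+ m * (i * y)); last by rewrite /y; ring.
  by sr.
- apply: icA; first by sr.
  apply: (@integral_pow A _ m).
  rewrite exprMn -exprM mulnC exprM -/y exprS (_ : _ * _ = j * (j * y) ^+ m); first by sr.
  by rewrite exprMn; ring.
- by rewrite -mulrA -exprSr.
by rewrite -mulrA -exprSr -/y /i; ring.
Qed.

Lemma int_closed_up A B U : R <<= A -> A <<= B -> B <<= U -> int_closed_in A U ->
  int_closed_in B U.
Proof.
move=> RA AB BU icA c Uc /integral_elim[n [b [Bb ec]]].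
have AU : A <<= U by move=> x /AB /BU.
(* Multiplier [a] is assumed to clear the coefficients from [m] on. For [m = 0] it clears all of
   them and [a c] is integral over [A]; each relation [1 = i + j b_m] removes one condition. *)
suff key m : (m <= n)%N -> forall a, a \isin A ->
    (forall k, (m <= k < n)%N -> a * b k \isin A) -> a * c \isin B.
  rewrite -[c]mul1r; apply: (key n) => //; first exact: sr1.
  by move=> k /andP[]; rewrite leqNgt => /negP.
elim: m => [|m IH] mn a Aa hab.
  apply/AB/icA; first by have := AU _ Aa; sr.
  pose d k := if (k < n)%N then a ^+ (n - k).-1 * (a * b k) else 0.
  apply: (@integral_intro _ A _ n d).
    by move=> k; rewrite /d; case: ltnP => kn; [have := hab k kn; sr|exact: sr0].
  rewrite exprMn ec mulr_sumr; apply: eq_bigr => k _; rewrite /d ltn_ord.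
  have -> : a ^+ n = a ^+ (n - k).-1 * a * a ^+ k.
    by rewrite -exprSr prednK ?subn_gt0 // -exprD subnK // ltnW.
  by rewrite exprMn; ring.
have [i [j [Ai Aib Aj Ajb e]]] := int_closed_denom RA AU icA (BU _ (Bb m)).
have hi h : h \isin A -> h * b m \isin A -> a * h * c \isin B.
  move=> Ah Ahb; apply: IH; [exact: ltnW|by sr|].
  move=> k /andP[]; rewrite leq_eqVlt => /orP[/eqP<- _|mk kn]; first by rewrite -mulrA; sr.
  rewrite (_ : _ * _ = a * b k * h); last by ring.
  by have := hab k (introT andP (conj mk kn)); sr.
rewrite -[a]mulr1 e (_ : _ * c = a * i * c + b m * (a * j * c)); last by ring.
by have := hi _ Ai Aib; have := hi _ Aj Ajb; have := Bb m; sr.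
Qed.

(* Locally, either [t] or [1 / t] lies in [A] ([i] or [j t] is a unit), and in the
   latter case so does [v / t] or [t / v]. *)
Lemma int_closed_sumring A T V : R <<= A -> A <<= T -> A <<= V ->
  int_closed_in A T -> int_closed_in A V -> sumring T V.
Proof.
move=> RA AT AV icT icV t v Tt Vv.
have [i [j [Ai Ait Aj Ajt e]]] := int_closed_denom RA AT icT Tt.
have [p [q [Ap Apv Aq Aqv e']]] := int_closed_denom RA AV icV (srM (AV _ Aj) Vv).
exists (p * (j * v) * t * t), ((i * t) * v + (j * t) * (q * (j * t) * v * v)); split.
- by have := AT _ Apv; sr.
- by have := AV _ Ait; have := AV _ Ajt; have := AV _ Aq; sr.
transitivity (i * t * v + (j * t) * (t * v) * (p + q * (j * v))); last by ring.
by rewrite -e' mulr1 -[LHS]mul1r {1}e; ring.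
Qed.

(** In [1 = i + j v] one of [i], [j] avoids the conductor of [U], since otherwise [U] would lie in
    [V]. So [v] is multiplied into [T] by a unit modulo that conductor. *)
Lemma int_nonint_sumring T U V : R <<= T -> mini T U -> rel_integral T U ->
  mini T V -> int_closed_in T V -> sumring U V.
Proof.
move=> RT mU IU [TV _ _] icV; have [TU _ _] := mU.
have den v : v \isin V -> exists i j,
    [/\ i \isin T, i * v \isin T, j \isin T, j * v \isin T & 1 = i + j * v].
  exact: int_closed_denom.
have [UV|nUV] := pselect (U <<= V).
  move=> u v Uu Vv; exists 0, (u * v); split; [sr| |by ring].
  by apply: srM => //; exact: UV.
have clear v : v \isin V -> exists a, [/\ a \isin T, a * v \isin T & ~ conductor T U a].
  move=> Vv; have [i [j [Ti Tiv Tj Tjv e]]] := den v Vv.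
  have [Mi|nMi] := pselect (conductor T U i); last by exists i.
  have [Mj|nMj] := pselect (conductor T U j); last by exists j.
  case: nUV => u Uu; rewrite -[u]mul1r e (_ : _ * u = i * u + j * u * v); last by ring.
  by have := TV _ (Mi _ Uu); have := TV _ (Mj _ Uu); sr.
move=> u v Uu Vv; have [a [Ta Tav nMa]] := clear v Vv.
have [//|[a' Ta' Ma]] := mini_cond fcpR RT mU IU Ta.
exists (a' * (a * v) * u), ((1 - a * a') * u * v); split; last by ring.
  by have := TU _ Tav; have := TU _ Ta'; sr.
by have := TV _ (Ma _ Uu); sr.
Qed.

Lemma delta_total : delta R (integral_closure R) -> delta R [set: S].
Proof.
move=> dR; apply/deltaTP; have [X eX] := top_subring S.
have inX T : T <<= X by rewrite eX.
suff key T U V : R <<= T -> mini T U -> mini T V -> sumring U V.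
  move=> T U RT RU; have loc A V W : R <<= A -> V <<= X -> W <<= X ->
      mini A V -> mini A W -> sumring V W by move=> ? _ _; exact: key.
  by apply: (sumring_local fcpR _ loc).
move=> RT mU mV; have [TU nUT _] := mU; have [TV nVT _] := mV.
(* Otherwise [T] contains the intersection of [W] with the integral closure, which is integrally
   closed in [W]; by [int_closed_up] so is [T], although [W] is integral over [T]. *)
have low W : mini T W -> rel_integral T W ->
    exists y, [/\ y \isin W, y \isin integral_closure R & ~ y \isin T].
  move=> [TW nWT _] IW; apply: contrapT => /forallNP h; apply: nWT.
  have [A hA] := inter_subring W (integral_closure R).
  have icT : int_closed_in T W.
    apply: (@int_closed_up A) => //.
    - by move=> x Rx; apply/hA; split; [exact/TW/RT|exact: integral_base].
    - by move=> x /hA[Wx Ix]; apply: contrapT => nTx; apply: (h x).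
    move=> x Wx Ix; apply/hA; split=> //; apply: integral_closure_idem.
    by apply: integral_sub_closure Ix => y /hA[].
  by move=> x Wx; apply: icT => //; exact: IW.
case: (mini_integral_or mU) => hU; case: (mini_integral_or mV) => hV.
- by apply: (descend_sumring dR RT) => //; [exact: integral_base|exact: low|exact: low].
- exact: int_nonint_sumring hV.
- by apply: sumring_sym; exact: int_nonint_sumring hU.
- exact: int_closed_sumring hU hV.
Qed.

End Delta.

(** * Cardinalities and ideals *)

Local Open Scope card_scope.
Local Open Scope quotient_scope.

Lemma ideal_intro (Q : comNzRingType) (K : set Q) : K 0 -> ~ K 1 ->
  (forall a u v, K u -> K v -> K (a * u + v)) ->
  exists J : idealr Q, forall x, x \in J <-> K x.
Proof.
move=> K0 K1 KD; pose p : {pred Q} := fun x => `[<K x>].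
have h : idealr_closed p.
  split; [exact/asboolP|exact/asboolP|].
  by move=> a u v /asboolP ? /asboolP ?; apply/asboolP/KD.
pose J : idealr Q := HB.pack_for (idealr Q) (p : Q -> bool) (isIdealr.Build Q p h).
by exists J => x; split=> [/asboolP|?]; [|apply/asboolP].
Qed.

Lemma maximal_idealP (Q : comNzRingType) (J : idealr Q) :
  maximal_ideal J <-> forall u, u \in J \/ exists b, 1 - b * u \in J.
Proof.
split=> [mJ u|h I JI x Ix]; last first.
  have [//|[b Jb]] := h x; have := rpredD (JI _ Jb) (idealMr b Ix).
  by rewrite subrK idealr1.
have [|nh] := pselect (exists b, 1 - b * u \in J); [by right|left].
have [||a x y [b [n [Jn ->]]] [c [m [Jm ->]]]|K hK] :=
    @ideal_intro _ [set x | exists b n, n \in J /\ x = b * u + n].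
- by exists 0, 0; rewrite mul0r addr0 idealr0.
- move=> [b [n [Jn e]]]; apply: nh; exists b.
  by rewrite (_ : 1 - _ = n) // e addrC addKr.
- exists (a * b + c), (a * n + m); split; last by ring.
  by apply: rpredD => //; exact: idealMr.
apply: (mJ K); first by move=> x Jx; apply/hK; exists 0, x; rewrite mul0r add0r.
by apply/hK; exists 1, 0; rewrite mul1r addr0 idealr0.
Qed.

Lemma quot_eqP (Q : comNzRingType) (J : idealr Q) (x y : Q) :
  \pi_{ideal_quot J} x = \pi y <-> x - y \in J.
Proof. by rewrite Quotient.idealrBE; split=> [->|/eqP]. Qed.

Lemma pi_surj (Q : comNzRingType) (J : idealr Q) (z : {ideal_quot J}) :
  exists x : Q, z = \pi x.
Proof. by exists (repr z); rewrite reprK. Qed.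

Section Cardinals.
Variable S : comNzRingType.
Implicit Types (A B T U V W X : subring S).

Lemma uniq_nth_inj (T : Type) (x0 : {classic T}) (s : seq {classic T}) :
  uniq s -> {in `I_(size s) &, injective (nth x0 s)}.
Proof.
move=> us i j; rewrite !inE => hi hj /eqP; rewrite nth_uniq //; exact/eqP.
Qed.

Lemma uniq_card_le (T : Type) (s : seq {classic T}) (E : set T) :
  uniq s -> (forall x, x \in s -> E x) -> `I_(size s) #<= E.
Proof.
case: s => [|x0 s] us hE; first by rewrite II0 card_ge0.
have e := inj_card_eq (uniq_nth_inj (x0 := x0) us).
rewrite -(card_le_eql e); apply: subset_card_le => _ [i hi <-].
by apply: hE; exact: mem_nth.
Qed.

Lemma list_card_eq (T : Type) (s : seq {classic T}) (E : set T) :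
  uniq s -> (forall x : {classic T}, x \in s <-> E x) -> E #= `I_(size s).
Proof.
case: s => [|x0 s] us hE.
  by rewrite II0 card_eq0; apply/eqP/seteqP; split=> // x /hE.
rewrite card_eq_sym -(card_eql (inj_card_eq (uniq_nth_inj (x0 := x0) us))).
suff -> : nth x0 (x0 :: s) @` `I_(size (x0 :: s)) = E by exact: card_eqxx.
apply/seteqP; split=> [_ [i hi <-]|x /hE xs]; first by apply/hE; exact: mem_nth.
exists (index (x : {classic T}) (x0 :: s)); last by rewrite nth_index.
by apply: (etrans _ xs); rewrite -index_mem.
Qed.

Lemma B2_four T U V X : mini T U -> mini T V -> U <> V -> U <<= X -> V <<= X ->
  B2 T X -> four T U V X.
Proof.
move=> [TU nUT minU] [TV nVT minV] nUV UX VX [_ c4] W TW WX.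
have TX : T <<= X by move=> x /TU /UX.
apply: contrapT => nW.
pose s : seq {classic subring S} := [:: T; U; V; X; W].
suff us : uniq s.
  have : `I_5 #<= subexts T X.
    apply: (@uniq_card_le _ s) => // Y; rewrite !in_cons orbF.
    by move=> /orP[/eqP->|/orP[/eqP->|/orP[/eqP->|/orP[/eqP->|/eqP->]]]]; split.
  by rewrite (card_le_eqr c4) card_le_II.
have neq (Y Z : subring S) : Y <> Z -> ((Y : {classic subring S}) == Z) = false by move=> h; apply/eqP.
have nUX : U <> X.
  move=> e; subst X; case: (minU V TV VX) => // UV.
  by apply: nUV; exact: subring_le_anti.
have nVX : V <> X.
  move=> e; subst X; case: (minV U TU UX) => // VU.
  by apply: nUV; exact: subring_le_anti.
have nTU : T <> U by move=> e; apply: nUT; rewrite -e.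
have nTV : T <> V by move=> e; apply: nVT; rewrite -e.
have nTX : T <> X by move=> e; apply: nUT; rewrite e.
have nTW : T <> W by move=> e; apply: nW; constructor 1.
have nUW : U <> W by move=> e; apply: nW; constructor 2.
have nVW : V <> W by move=> e; apply: nW; constructor 3.
have nXW : X <> W by move=> e; apply: nW; constructor 4.
by rewrite /s /= !in_cons !orbF !neq.
Qed.

Lemma four_B2 T U V X : mini T U -> mini T V -> U <> V -> U <<= X -> V <<= X ->
  four T U V X -> B2 T X.
Proof.
move=> [TU nUT minU] [TV nVT minV] nUV UX VX h4.
have TX : T <<= X by move=> x /TU /UX.
have neq (Y Z : subring S) : Y <> Z -> ((Y : {classic subring S}) == Z) = false by move=> h; apply/eqP.
have nUX : U <> X.
  move=> e; subst X; case: (minU V TV VX) => // UV.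
  by apply: nUV; exact: subring_le_anti.
have nVX : V <> X.
  move=> e; subst X; case: (minV U TU UX) => // VU.
  by apply: nUV; exact: subring_le_anti.
have nTU : T <> U by move=> e; apply: nUT; rewrite -e.
have nTV : T <> V by move=> e; apply: nVT; rewrite -e.
have nTX : T <> X by move=> e; apply: nUT; rewrite e.
have three Y : Y <> X -> T <> Y -> [set Z | Z = T \/ Z = Y \/ Z = X] #= `I_3.
  move=> nYX nTY; apply: (@list_card_eq _ ([:: T; Y; X] : seq {classic subring S})).
    by rewrite /= !in_cons !orbF !neq.
  move=> Z; rewrite !in_cons orbF; split; first by move=> /orP[/eqP->|/orP[/eqP->|/eqP->]] /=; tauto.
  by move=> [->|[->|->]]; rewrite eqxx ?orbT.
split; last first.
  apply: (@list_card_eq _ ([:: T; U; V; X] : seq {classic subring S})).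
    by rewrite /= !in_cons !orbF !neq.
  move=> Y; rewrite !in_cons orbF; split; first by move=> /orP[/eqP->|/orP[/eqP->|/orP[/eqP->|/eqP->]]]; split.
  by move=> [TY YX]; case: (h4 Y TY YX) => ->; rewrite eqxx ?orbT.
split.
  exists [set Y | Y = T \/ Y = U \/ Y = X]; last exact: three.
  split=> [Y [->|[->|->]]|Y Z]; try by split.
  by move=> [->|[->|->]] [->|[->|->]]; by [left|right].
move=> C m [CE tC] eC.
suff : `I_m.+1 #<= `I_3 by rewrite card_le_II.
rewrite -(card_le_eql eC).
have sub3 Y : Y <> X -> T <> Y -> C `<=` [set Z | Z = T \/ Z = Y \/ Z = X] -> C #<= `I_3.
  move=> nYX nTY /subset_card_le h; apply: (card_le_trans h).
  by have := three Y nYX nTY; rewrite card_eq_le => /andP[].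
(* [U] and [V] are incomparable, so a chain misses one of them and has at most three elements. *)
have [CU|nCU] := pselect (C U).
  apply: (sub3 U) => // Y CY; have [TY YX] := CE _ CY.
  case: (h4 Y TY YX) => e; rewrite ?e /=; try tauto.
  subst Y; case: (tC U V CU CY) => h; exfalso.
    by case: (minV U TU h) => // VU; apply: nUV; exact: subring_le_anti.
  by case: (minU V TV h) => // UV; apply: nUV; exact: subring_le_anti.
apply: (sub3 V) => // Y CY; have [TY YX] := CE _ CY.
case: (h4 Y TY YX) => e; rewrite ?e /=; try tauto.
by subst Y.
Qed.

End Cardinals.

(** * The three types of minimal extensions *)

Section FormalTypes.
Variables (S : comNzRingType) (R : subring S).
Hypothesis fcpR : fcp R [set: S].
Implicit Types (T U V W X : subring S).

Lemma inert_residual T U : inert T U -> residue_field T U.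
Proof.
move=> [M [N [f [[_ cN] _ /maximal_idealP mN _ _]]]] u Uu.
have [/cN|[b /cN]] := mN (SubringElt (mem_set Uu)); first by left.
by right; exists (val b); [exact: valP_sr|rewrite mulrC].
Qed.

Lemma canonical_iso_mem T U (M : idealr (subring_type T)) (N : idealr (subring_type U))
    (a : subring_type T) (b : subring_type U) :
  canonical_iso M N -> val a = val b -> b \in N -> a \in M.
Proof.
move=> [f cf bf] e Nb; have finj := bij_inj bf.
rewrite -[a]subr0; apply/quot_eqP/finj; rewrite rmorph0 rmorph0 (cf a b e).
by rewrite -(rmorph0 \pi_{ideal_quot N}); apply/quot_eqP; rewrite subr0.
Qed.

Lemma decomposed_residual T U : T <<= U -> decomposed T U -> exists e, quad_gen T U e 1.
Proof.
move=> TU [M [M1 [M2 [[cM _] [m1 m2] n12 c12 [i1 i2]]]]].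
(* Maximality of [N2] gives a multiple [e] of [x] in [N1] with [1 - e] in [N2]. If [e] were in [T],
   both [e] and [1 - e] would be in [M]. *)
have aux (N1 N2 : idealr (subring_type U)) (x : subring_type U) :
    maximal_ideal N2 -> canonical_iso M N1 -> canonical_iso M N2 ->
    (forall y, y \in N1 -> y \in N2 -> conductor T U (val y)) ->
    x \in N1 -> ~ x \in N2 -> exists e, quad_gen T U e 1.
  move=> /maximal_idealP m i1' i2' c N1x nN2x.
  have [//|[b N2b]] := m x.
  have N1e : b * x \in N1 by exact: idealMr.
  exists (val (b * x)); split; [exact: valP_sr| |exact: sr1|].
    move=> Te; pose a := SubringElt (mem_set Te).
    have Ma : a \in M by exact: (canonical_iso_mem i1' _ N1e).
    have Ma1 : 1 - a \in M.
      by apply: (canonical_iso_mem i2' _ N2b); rewrite /=.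
    by have := rpredD Ma Ma1; rewrite addrC subrK idealr1.
  rewrite (_ : _ * _ = val (b * x * (b * x - 1))); last by rewrite /=.
  apply: c; first by rewrite mulrC; exact: idealMr.
  by apply: idealMr; rewrite -opprB rpredN.
have : exists x, ~ (x \in M1 = (x \in M2)) by apply/existsNP.
move=> [x]; case h1 : (x \in M1); case h2 : (x \in M2) => // _.
  apply: (aux M1 M2 x) => //; last by rewrite h2.
  by move=> y ? ?; apply/c12.
apply: (aux M2 M1 x) => //; last by rewrite h1.
by move=> y ? ?; apply/c12.
Qed.

Lemma ramified_residual T U : ramified T U -> exists x, quad_gen T U x 0.
Proof.
move=> [M [N [M' [f [[cM cN _ _] sq [_ nsub] _ iM']]]]].
have [x M'x nNx] : exists2 x, x \in M' & ~ x \in N.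
  by apply: contrapT => /forall2NP h; apply: nsub => x M'x; case: (h x) => // /contrapT.
exists (val x); split; [exact: valP_sr| |exact: sr0|].
  move=> Tx; apply/nNx/cN.
  have /cM // : SubringElt (mem_set Tx) \in M by exact: (canonical_iso_mem iM' _ M'x).
by rewrite subr0; apply: (cN (x * x)).1; exact: sq.
Qed.

Lemma of_type_residual k T U : T <<= U -> of_type k T U -> residual_type k T U.
Proof.
case: k => TU /=; [exact: inert_residual|exact: decomposed_residual|exact: ramified_residual].
Qed.

Section Construction.
Variables (T U : subring S).
Hypotheses (RT : R <<= T) (mU : mini T U) (IU : rel_integral T U).

Let TU : T <<= U. Proof. by case: mU. Qed.

Definition incl (a : subring_type T) : subring_type U := SubringElt (mem_set (TU (valP_sr a))).

Lemma conductor_ideal : exists M : idealr (subring_type T),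
  carries M (conductor T U) /\ maximal_ideal M.
Proof.
have [|h|a u v hu hv|M hM] := @ideal_intro _ [set a : subring_type T | conductor T U (val a)].
- by rewrite /=; exact: cond0.
- by apply: (mini_cond1 mU); move: h; rewrite /=.
- rewrite /=; apply: condD => //; apply: condMl => //.
  exact/TU/valP_sr.
exists M; split=> //; apply/maximal_idealP => a.
have [Ma|[a' Ta' Ma]] := mini_cond fcpR RT mU IU (valP_sr a); first by left; apply/hM.
right; exists (SubringElt (mem_set Ta')); apply/hM.
by rewrite /= /= mulrC.
Qed.

Lemma conductor_ideal_up : exists N : idealr (subring_type U), carries N (conductor T U).
Proof.
have [|h|a u v hu hv|M hM] := @ideal_intro _ [set a : subring_type U | conductor T U (val a)].
- by rewrite /=; exact: cond0.
- by apply: (mini_cond1 mU); move: h; rewrite /=.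
- rewrite /=; apply: condD => //; apply: condMl => //.
  exact: valP_sr.
by exists M.
Qed.

Lemma canonical_map_exists (M : idealr (subring_type T)) (N : idealr (subring_type U)) :
  (forall a, a \in M -> incl a \in N) ->
  exists f : {rmorphism {ideal_quot M} -> {ideal_quot N}}, canonical_map f.
Proof.
move=> MN.
have inclB a b : incl (a - b) = incl a - incl b by apply/val_inj; rewrite /=.
have inclM a b : incl (a * b) = incl a * incl b by apply/val_inj; rewrite /=.
have incl1 : incl 1 = 1 by apply/val_inj; rewrite /=.
pose g (z : {ideal_quot M}) : {ideal_quot N} := \pi_{ideal_quot N} (incl (repr z)).
have gE a : g (\pi_{ideal_quot M} a) = \pi_{ideal_quot N} (incl a).
  apply/quot_eqP; rewrite -inclB; apply: MN; apply/quot_eqP; by rewrite reprK.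
have gB : zmod_morphism g.
  move=> z w; have [a ->] := pi_surj z; have [b ->] := pi_surj w.
  by rewrite -rmorphB !gE inclB rmorphB.
have gM : monoid_morphism g.
  split=> [|z w]; first by rewrite -(rmorph1 \pi_{ideal_quot M}) gE incl1 rmorph1.
  have [a ->] := pi_surj z; have [b ->] := pi_surj w.
  by rewrite -rmorphM !gE inclM rmorphM.
pose f : {rmorphism {ideal_quot M} -> {ideal_quot N}} :=
  HB.pack_for {rmorphism {ideal_quot M} -> {ideal_quot N}} g
    (GRing.isZmodMorphism.Build _ _ g gB) (GRing.isMonoidMorphism.Build _ _ g gM).
exists f => a b e; rewrite -[f _]/(g _) gE; congr (\pi _); exact: val_inj.
Qed.

Lemma canonical_iso_intro (M : idealr (subring_type T)) (N : idealr (subring_type U)) :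
  maximal_ideal M -> (forall a, incl a \in N <-> a \in M) ->
  (forall u, exists a, u - incl a \in N) -> canonical_iso M N /\ maximal_ideal N.
Proof.
move=> mM NM sur; have [|f cf] := @canonical_map_exists M N; first by move=> a /NM.
split; last first.
  apply/maximal_idealP => u; have [a Na] := sur u.
  have [Ma|[b Mb]] := (maximal_idealP M).1 mM a.
    by left; rewrite -[u](subrK (incl a)) rpredD //; apply/NM.
  right; exists (incl b).
  rewrite (_ : 1 - incl b * u = incl (1 - b * a) - incl b * (u - incl a)).
    by apply: rpredB; [apply/NM|exact: idealMr].
  by apply/val_inj; rewrite /= /=; ring.
exists f => //.
pose g (z : {ideal_quot N}) : {ideal_quot M} := \pi_{ideal_quot M} (sval (cid (sur (repr z)))).
have fK : cancel f g.
  move=> z; rewrite /g; have [a ->] := pi_surj z; case: cid => b /= Nb.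
  apply/esym/quot_eqP/NM; rewrite (cf a (incl a)) // in Nb.
  have : repr (\pi_{ideal_quot N} (incl a)) - incl a \in N by apply/quot_eqP; rewrite reprK.
  move=> h; have := rpredB Nb h; set y := _ - _ => Ny.
  by rewrite (_ : incl (a - b) = y) //; apply/val_inj; rewrite /y /=; ring.
have gK : cancel g f.
  move=> z; rewrite /g; case: cid => b /= Nb; rewrite (cf b (incl b)) //.
  by rewrite -[RHS]reprK; apply/esym/quot_eqP.
exact: Bijective fK gK.
Qed.

Lemma residual_inert : residue_field T U -> inert T U.
Proof.
move=> fU; have [M [cM mM]] := conductor_ideal; have [N cN] := conductor_ideal_up.
have [|f cf] := @canonical_map_exists M N; first by move=> a /cM h; apply/cN.
have [_ nUT minU] := mU.
have rangeP (u : subring_type U) : range f (\pi_{ideal_quot N} u) -> val u \isin T.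
  move=> [z _]; have [a ->] := pi_surj z; rewrite (cf a (incl a)) // => /quot_eqP/cN.
  rewrite /= => /cond_base h; rewrite (_ : val u = val a - (val a - val u)); last by ring.
  by have := valP_sr a; sr.
exists M, N, f; split=> //.
  apply/maximal_idealP => u; have [h|[b Ub h]] := fU _ (valP_sr u); first by left; apply/cN.
  right; exists (SubringElt (mem_set Ub)); apply/cN.
  by rewrite /= /= mulrC.
split.
  split=> // h; apply: nUT => u Uu.
  by apply: (rangeP (SubringElt (mem_set Uu))); apply: h.
move=> W [fW _].
have [|x y [b [<- Wb]] [c [<- Wc]]|x y [b [<- Wb]] [c [<- Wc]]|X eX] :=
    @subring_intro _ [set s | exists b : subring_type U, val b = s /\ \pi_{ideal_quot N} b \isin W].
- by exists 1; rewrite /= rmorph1; split=> //; exact: sr1.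
- by exists (b - c); rewrite /= rmorphB; split=> //; sr.
- by exists (b * c); rewrite /= rmorphM; split=> //; sr.
case: (minU X) => [t Tt|x|XT|UX].
- rewrite eX; exists (incl (SubringElt (mem_set Tt))); split=> //; apply: fW.
  by exists (\pi_{ideal_quot M} (SubringElt (mem_set Tt))) => //; exact: cf.
- by rewrite eX => -[b [<- _]]; exact: valP_sr.
- left; apply/seteqP; split=> // w Ww; have [b eb] := pi_surj w; subst w.
  have Tb : val b \isin T by apply: XT; rewrite eX; exists b.
  by exists (\pi_{ideal_quot M} (SubringElt (mem_set Tb))) => //; exact: cf.
- right; apply/seteqP; split=> // w _; have [b ->] := pi_surj w.
  have := UX _ (valP_sr b); rewrite eX => -[c [ecb Wc]].
  by rewrite (_ : b = c) //; exact: val_inj.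
Qed.

(** The two maximal ideals are the annihilators, modulo the conductor, of [1 - e] and of [e]. *)
Lemma residual_decomposed e : quad_gen T U e 1 -> decomposed T U.
Proof.
move=> ge; have [M [cM mM]] := conductor_ideal.
have [Ue nTe _ he] := ge.
(* the annihilator of an idempotent modulo the conductor *)
have ann g : quad_gen T U g 1 -> exists N : idealr (subring_type U),
    [/\ forall u, u \in N <-> conductor T U (val u * g), canonical_iso M N & maximal_ideal N].
  move=> gg; have [Ug nTg _ hg] := gg.
  have [|h|a u v hu hv|N hN] :=
      @ideal_intro _ [set u : subring_type U | conductor T U (val u * g)].
  - by rewrite /= mul0r; exact: cond0.
  - by apply: nTg; apply: (@cond_base _ T U); move: h; rewrite /= mul1r.
  - rewrite /= mulrDl; apply: condD => //.
    by rewrite -mulrA; apply: condMl => //; exact: valP_sr.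
  exists N; have [||iN mN] := canonical_iso_intro mM (N := N); last by split.
    move=> a; split=> [/hN /= h|/cM h]; last by apply/hN/condMr.
    by apply/cM; apply: (cond_cancel fcpR RT mU IU (valP_sr a) Ug) => //; exact: cond_base h.
  move=> u; have [a [b [Ta Tb eu]]] := quad_gen_span mU gg (valP_sr u).
  have Tab : a + b \isin T by sr.
  exists (SubringElt (mem_set Tab)); apply/hN; rewrite /= eu /=.
  rewrite (_ : _ * g = b * (g * (g - 1))); last by ring.
  by apply: condMl => //; exact: TU.
have [M1 [h1 i1 m1]] := ann _ (quad_gen_opp TU ge).
have [M2 [h2 i2 m2]] := ann _ ge.
exists M, M1, M2; split=> //.
  move=> h; pose e' : subring_type U := SubringElt (mem_set Ue).
  have : e' \in M1.
    apply/h1 => /=; rewrite (_ : _ * _ = - (e * (e - 1))); last by ring.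
    exact: condN.
  rewrite h => /h2 /= /cond_base Tee; apply: nTe.
  by rewrite (_ : e = e * e - e * (e - 1)); [have := cond_base he; sr|ring].
move=> x; split=> [h|[/h1 hx1 /h2 hx2]]; last first.
  by rewrite (_ : val x = val x * (1 - e) + val x * e); [exact: condD|ring].
by split; [apply/h1|apply/h2]; apply: condMr => //; sr.
Qed.

Lemma residual_ramified x : quad_gen T U x 0 -> ramified T U.
Proof.
move=> gx; have [M [cM mM]] := conductor_ideal; have [N cN] := conductor_ideal_up.
have [|f cf] := @canonical_map_exists M N; first by move=> a /cM h; apply/cN.
have [Ux nTx _ hx] := gx; rewrite subr0 in hx.
have cancel a : a \isin T -> conductor T U (a * x) -> conductor T U a.
  move=> Ta /cond_base h; exact: (cond_cancel fcpR RT mU IU Ta Ux).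
(* [M'] is the annihilator of [x] modulo the conductor. *)
have [|h|a u v hu hv|M' hM'] :=
    @ideal_intro _ [set u : subring_type U | conductor T U (val u * x)].
- by rewrite /= mul0r; exact: cond0.
- by apply: nTx; apply: (@cond_base _ T U); move: h; rewrite /= mul1r.
- rewrite /= mulrDl; apply: condD => //.
  by rewrite -mulrA; apply: condMl => //; exact: valP_sr.
have span := quad_gen_span mU gx.
have [||iM' mM'] := canonical_iso_intro mM (N := M').
- move=> a; split=> [/hM' /= h|/cM h]; last by apply/hM'/condMr.
  exact/cM/cancel/h/valP_sr.
- move=> u; have [a [b [Ta Tb eu]]] := span _ (valP_sr u).
  exists (SubringElt (mem_set Ta)); apply/hM'; rewrite /= eu /=.
  rewrite (_ : _ * x = b * (x * x)); last by ring.
  by apply: condMl => //; exact: TU.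
pose x' : subring_type U := SubringElt (mem_set Ux).
exists M, N, M', f; split=> //.
- move=> u v /hM' hu /hM' hv; apply/cN; rewrite /=.
  have [a [b [Ta Tb eu]]] := span _ (valP_sr u); have [c [d [Tc Td ev]]] := span _ (valP_sr v).
  have Ub := TU Tb; have Ud := TU Td; have Uc := TU Tc; have Ua := TU Ta.
  have Ma : conductor T U a.
    apply: cancel => //; rewrite (_ : a * x = val u * x - b * (x * x)); last by rewrite eu; ring.
    by apply: condB => //; exact: condMl.
  have Mc : conductor T U c.
    apply: cancel => //; rewrite (_ : c * x = val v * x - d * (x * x)); last by rewrite ev; ring.
    by apply: condB => //; exact: condMl.
  rewrite eu ev (_ : (a + b * x) * (c + d * x) = a * (c + d * x) + c * (b * x) + b * d * (x * x)); last by ring.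
  apply: condD; last by apply: condMl => //; sr.
  by apply: condD; apply: condMr => //; sr.
- split=> [u /cN h|sub]; first exact/hM'/condMr.
  have /sub/cN/= h : x' \in M' by apply/hM'.
  exact/nTx/(cond_base h).
split=> //; exists 1, (\pi_{ideal_quot N} x') => z; have [u eu] := pi_surj z; subst z.
have [a [b [Ta Tb eu]]] := span _ (valP_sr u).
exists (\pi_{ideal_quot M} (SubringElt (mem_set Ta)), \pi_{ideal_quot M} (SubringElt (mem_set Tb))); split.
  rewrite /= (cf _ (incl (SubringElt (mem_set Ta)))) // (cf _ (incl (SubringElt (mem_set Tb)))) //.
  by rewrite mulr1 -rmorphM -rmorphD; congr (\pi _); apply/val_inj; rewrite /=.
move=> [z w] /=; have [c ->] := pi_surj z; have [d ->] := pi_surj w.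
rewrite (cf c (incl c)) // (cf d (incl d)) // mulr1 -rmorphM -rmorphD => /quot_eqP/cN.
rewrite /= /= eu => h.
have Tc := valP_sr c; have Td := valP_sr d.
have Mbd : conductor T U (b - val d).
  apply: (cond_cancel fcpR RT mU IU _ Ux) => //; first by sr.
  rewrite (_ : _ * x = (a + b * x - (val c + val d * x)) - (a - val c)); last by ring.
  by have := cond_base h; sr.
congr (_, _); apply/quot_eqP/cM => /=; last exact: Mbd.
rewrite (_ : a - subring_val c = (a + b * x - (subring_val c + subring_val d * x))
  - (b - subring_val d) * x); last by ring.
by apply: condB => //; exact: condMr.
Qed.

Lemma residual_of_type k : residual_type k T U -> of_type k T U.
Proof.
by case: k => /= [|[e]|[x]]; [exact: residual_inert|exact: residual_decomposed
  |exact: residual_ramified].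
Qed.

End Construction.
End FormalTypes.

(** * Inert extensions with the same conductor *)

Section FieldPairs.
Variables (S : comNzRingType) (R : subring S).
Hypothesis fcpR : fcp R [set: S].
Implicit Types (A B T U V W X Y : subring S) (x y a b e u v : S).

(** Among [n + 1] vectors in the span of [n], read modulo [G] over the field [T / M], there is a
    nontrivial relation. The induction pivots on a vector whose last coordinate is invertible. *)
Lemma steinitz T (M G : set S) n (y z : nat -> S) (d : nat -> nat -> S) :
  ~ M 1 -> (forall a, a \isin T -> M a \/ exists2 a', a' \isin T & M (1 - a * a')) ->
  (forall a b, G a -> G b -> G (a + b)) -> (forall t a, t \isin T -> G a -> G (t * a)) ->
  (forall m j, M m -> G (m * y j)) -> (forall i j, d i j \isin T) ->
  (forall i, (i <= n)%N -> G (z i - \sum_(j < n) d i j * y j)) ->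
  exists c : nat -> S, [/\ forall i, c i \isin T, exists2 i, (i <= n)%N & ~ M (c i)
    & G (\sum_(i < n.+1) c i * z i)].
Proof.
move=> nM1 hM GD GZ GM; elim: n z d => [|n IH] z d Td hz.
  exists (fun=> 1); split; [by move=> _; exact: sr1|by exists 0|].
  by rewrite big_ord1 mul1r; have := hz 0 (leqnn 0); rewrite big_ord0 subr0.
have [allM|] := pselect (forall i, (i <= n.+1)%N -> M (d i n)).
  have [|c [Tc [i0 i0n nMc] Gc]] := IH z d Td.
    move=> i ni; rewrite (_ : _ - _ = (z i - \sum_(j < n.+1) d i j * y j) + d i n * y n).
      by apply: GD; [apply: hz; exact: leqW|apply/GM/allM/leqW].
    by rewrite big_ord_recr /=; ring.
  exists (fun i => if (i <= n)%N then c i else 0); split.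
  - by move=> i; case: ifP => _ //; exact: sr0.
  - by exists i0; [exact: leqW|rewrite i0n].
  rewrite big_ord_recr /= ltnn mul0r addr0 (eq_bigr (fun i : 'I_n.+1 => c i * z i)) // => i _.
  by rewrite -ltnS ltn_ord.
move=> /existsNP[k /not_implyP[kn nMk]].
have [//|[r Tr Mr]] := hM _ (Td k n).
(* [bump k] skips the pivot [k]; subtracting the multiple of [z k] cancels the last coordinate
   modulo [M]. *)
pose z' i := z (bump k i) - d (bump k i) n * r * z k.
pose d' i j := d (bump k i) j - d (bump k i) n * r * d k j.
have Td' i j : d' i j \isin T.
  by rewrite /d'; have := Td (bump k i) j; have := Td (bump k i) n; have := Td k j; sr.
case: (IH z' d' Td') => [i ni|c [Tc [i0 i0n nMc] Gc]].
  have bn : (bump k i <= n.+1)%N by rewrite /bump; case: (k <= i)%N; [rewrite add1n|rewrite add0n leqW].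
  rewrite (_ : _ - _ = (z (bump k i) - \sum_(j < n.+1) d (bump k i) j * y j)
     + (- (d (bump k i) n * r)) * (z k - \sum_(j < n.+1) d k j * y j)
     + d (bump k i) n * ((1 - d k n * r) * y n)).
    have Tb := Td (bump k i) n.
    apply: (GD); last by apply: (GZ) => //; exact: GM.
    by apply: (GD); [exact: hz|apply: (GZ); [sr|exact: hz]].
  rewrite !big_ord_recr /= (_ : \sum_(j < n) d' i j * y j = \sum_(j < n) d (bump k i) j * y j
     - d (bump k i) n * r * \sum_(j < n) d k j * y j); first by rewrite /z'; ring.
  by rewrite mulr_sumr -sumrB; apply: eq_bigr => j _; rewrite /d'; ring.
pose C i := if i == k then - \sum_(i < n.+1) c i * (d (bump k i) n * r) else c (unbump k i).
have Cb i : C (bump k i) = c i.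
  by rewrite /C; case: eqP => [e|_]; [have := neq_bump k i; rewrite e eqxx|rewrite bumpK].
exists C; split.
- move=> i; rewrite /C; case: eqP => _ //; apply: srN; apply: sr_sum => j _.
  by have := Tc j; have := Td (bump k j) n; sr.
- exists (bump k i0); first by rewrite /bump; case: (k <= i0)%N; [rewrite add1n|rewrite add0n leqW].
  by rewrite Cb.
have kn2 : (k < n.+2)%N by [].
rewrite (bigD1_ord (Ordinal kn2)) //= {1}/C eqxx.
rewrite [X in G (_ + X)](eq_bigr (fun i : 'I_n.+1 => c i * z (bump k i))); last first.
  by move=> i _; rewrite Cb.
rewrite (_ : _ + _ = \sum_(i < n.+1) c i * z' i) //.
rewrite mulNr mulr_suml addrC -sumrB; apply: eq_bigr => i _.
by rewrite /z'; ring.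
Qed.

(** The dimension of [U / T] over the residue field is at most [p]; the vector 1 is not counted. *)
Definition spanned T U p := exists x : nat -> S, (forall i, x i \isin U) /\
  forall u, u \isin U -> exists2 c : nat -> S, (forall i, c i \isin T)
    & u - \sum_(i < p) c i * x i \isin T.

Lemma mini_spanned T U : mini T U -> rel_integral T U -> exists p, spanned T U p.
Proof.
move=> mU IU; have [TU nUT _] := mU; have [x Ux nTx] := notin_subset nUT.
have [n hn] := adjoin_span (IU _ Ux); exists n, (fun i => x ^+ i); split=> [i|u Uu].
  by sr.
have [c [Tc ->]] := hn _ (mini_adjoin mU Ux nTx Uu).
by exists c => //; rewrite subrr; exact: sr0.
Qed.

Lemma spanned_drop T U (M : set S) p (x e : nat -> S) i : (forall j, x j \isin U) ->
  (forall u, u \isin U -> exists2 c : nat -> S, (forall i, c i \isin T)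
    & u - \sum_(i < p.+1) c i * x i \isin T) ->
  (forall m, M m -> forall u, u \isin U -> m * u \isin T) ->
  (forall a, a \isin T -> M a \/ exists2 a', a' \isin T & M (1 - a * a')) ->
  (forall j, e j \isin T) -> \sum_(j < p.+1) e j * x j \isin T -> (i <= p)%N -> ~ M (e i) ->
  spanned T U p.
Proof.
move=> Ux span MU hM Te Tsum ilt nMe; have ip : (i < p.+1)%N by [].
move: Tsum; rewrite (bigD1_ord (Ordinal ip)) //= => Tsum.
have [//|[r Tr Mr]] := hM _ (Te i).
exists (fun j => x (bump i j)); split=> // u /span[c Tc].
rewrite (bigD1_ord (Ordinal ip)) //= => Tu.
exists (fun j => c (bump i j) - c i * r * e (bump i j)).
  by move=> j; have := Tc (bump i j); have := Tc i; have := Te (bump i j); sr.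
rewrite (_ : _ - _ = (u - (c i * x i + \sum_(j < p) c (bump i j) * x (bump i j)))
  + c i * r * (e i * x i + \sum_(j < p) e (bump i j) * x (bump i j))
  + c i * ((1 - e i * r) * x i)).
  by have := MU _ Mr _ (Ux i); have := Tc i; sr.
rewrite (_ : \sum_(j < p) (c (bump i j) - c i * r * e (bump i j)) * x (bump i j)
  = \sum_(j < p) c (bump i j) * x (bump i j) - c i * r * \sum_(j < p) e (bump i j) * x (bump i j)).
  by ring.
by rewrite mulr_sumr -sumrB; apply: eq_bigr => j _; ring.
Qed.

(* If [V] is not inside [U], pick [y] in [V] outside [U]; multiplication by [y]
   embeds the [U]-line [U y] in [(U + V) / U = V / T], whose dimension over the
   residue field is smaller than that of [U] if [dim V <= dim U]. *)
Lemma field_pair_eq T U V : R <<= T -> mini T U -> rel_integral T U ->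
  mini T V -> rel_integral T V -> residue_field T U -> residue_field T V ->
  same_cond T U V -> sumring U V -> U = V.
Proof.
move=> RT.
have min_dim : (forall T U, mini T U -> rel_integral T U ->
    exists p, spanned T U p /\ forall q, spanned T U q -> (p <= q)%N).
  move=> T' U' mU IU; have [p hp] := mini_spanned mU IU.
  have ex : exists p, `[< spanned T' U' p >] by exists p; apply/asboolP.
  by exists (ex_minn ex); case: ex_minnP => q /asboolP hq h; split=> // k hk; apply: h; apply/asboolP.
move=> mU IU mV IV fU fV sM sUV.
have [p [hp minp]] := min_dim _ _ mU IU; have [q [hq minq]] := min_dim _ _ mV IV.
wlog qp : U V mU IU mV IV fU fV sM sUV p hp minp q hq minq / (q <= p)%N.
  move=> wl; case/orP: (leq_total q p) => h; first exact: (wl U V _ _ _ _ _ _ _ _ p _ _ q).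
  apply/esym; apply: (wl V U _ _ _ _ _ _ _ _ q _ _ p) => //; first exact: same_cond_sym.
  exact: sumring_sym.
have [TU nUT minU] := mU; have [TV nVT minV] := mV.
have [VU|nVU] := pselect (V <<= U).
  by case: (minU V TV VU) => // UV; exact: subring_le_anti.
exfalso; have [y Vy nUy] := notin_subset nVU.
have [x [Ux spanU]] := hp; have [v [Vv spanV]] := hq.
(* With 1 in front, [w] supplies [q + 1] elements of [U]. Their products with [y] lie in
   [(U + V) / U], which [q] vectors span. *)
pose w i := if i is i'.+1 then x i' else 1.
have Uw i : w i \isin U by case: i => [|i] /=; [exact: sr1|].
have /choice[d hd] : forall i, exists d : nat -> S, (forall j, d j \isin T) /\
    w i * y - \sum_(j < q) d j * v j \isin U.
  move=> i; have [u' [v' [Uu' Vv' ->]]] := sUV _ _ (Uw i) Vy.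
  have [d Td hd] := spanV _ Vv'; exists d; split=> //.
  by rewrite -addrA; have := TU _ hd; sr.
have [||||||c [Tc [k kq nMk] Uc]] := @steinitz T (conductor T U) (subring_set U) q v
  (fun i => w i * y) d (mini_cond1 mU).
- by move=> a Ta; exact: (mini_cond fcpR RT mU IU Ta).
- by move=> a b ? ?; sr.
- by move=> t a /TU ? ?; sr.
- by move=> m j /sM Mm; apply/TU/Mm.
- by move=> i j; have [] := hd i.
- by move=> i _; have [] := hd i.
pose u0 := \sum_(i < q.+1) c i * w i.
have Uu0 : u0 \isin U by apply: sr_sum => i _; have := TU _ (Tc i); have := Uw i; sr.
have Uu0y : u0 * y \isin U.
  by rewrite /u0 mulr_suml (eq_bigr (fun i : 'I_q.+1 => c i * (w i * y))) // => i _; rewrite mulrA.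
(* An invertible [u0] would bring [y] into [U]; so [u0] is in the conductor and gives a relation
   between 1 and the spanning vectors of [U / T]. *)
case: (fU _ Uu0) => [Mu0|[u1 Uu1 M1]]; last first.
  apply: nUy; rewrite (_ : y = (1 - u0 * u1) * y + u1 * (u0 * y)); last by ring.
  by have := TU _ ((sM _).1 M1 _ Vy); sr.
have eu0 : u0 = c 0 + \sum_(i < q) c i.+1 * x i by rewrite /u0 big_ord_recl /= mulr1.
have [[k' k'q nMk']|all] := pselect (exists2 k', (k' < q)%N & ~ conductor T U (c k'.+1)).
  have p0 : (0 < p)%N by apply: leq_trans qp; apply: leq_ltn_trans k'q.
  (* Zero padding from length [q] to [p]; a coefficient outside the conductor would make one of the
     [p] vectors redundant, against minimality of [p]. *)
  pose e i := if (i < q)%N then c i.+1 else 0.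
  have : spanned T U p.-1.
    apply: (@spanned_drop T U (conductor T U) p.-1 x e k') => //.
    - by rewrite prednK.
    - by move=> a Ta; exact: (mini_cond fcpR RT mU IU Ta).
    - by move=> j; rewrite /e; case: ifP => _ //; exact: sr0.
    - rewrite prednK //; rewrite (big_ord_widen_cond p xpredT (fun i => c i.+1 * x i)) // in eu0.
      rewrite (_ : \sum_(j < p) e j * x j = u0 - c 0).
        by have := cond_base Mu0; have := Tc 0; sr.
      rewrite eu0 addrC addKr [RHS]big_mkcond /=; apply: eq_bigr => i _; rewrite /e.
      by case: ifP => _ //; rewrite mul0r.
    - by rewrite -ltnS prednK //; exact: leq_trans k'q qp.
    - by rewrite /e k'q.
  by move=> /minp; rewrite leqNgt prednK ?leqnn.
have all' k' : (k' < q)%N -> conductor T U (c k'.+1).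
  by move=> h; apply: contrapT => nM; apply: all; exists k'.
case: k kq nMk => [|k] kq nMk; last exact/nMk/all'.
apply: nMk; rewrite (_ : c 0 = u0 - \sum_(i < q) c i.+1 * x i); last by rewrite eu0 addrK.
apply: condB => //; apply: (big_ind (conductor T U)) => [|? ?|i _]; first exact: cond0.
  exact: condD.
by apply: condMr => //; exact: all'.
Qed.

End FieldPairs.

(** * Localization and the main theorem *)

Lemma prime_ideal_intro (Q : comNzRingType) (K : set Q) : K 0 -> ~ K 1 ->
  (forall a u v, K u -> K v -> K (a * u + v)) ->
  (forall u v, K (u * v) -> K u \/ K v) ->
  exists J : prime_idealr Q, forall x, x \in J <-> K x.
Proof.
move=> K0 K1 KD KM; pose p : {pred Q} := fun x => `[<K x>].
have h : idealr_closed p.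
  split; [exact/asboolP|exact/asboolP|].
  by move=> a u v /asboolP ? /asboolP ?; apply/asboolP/KD.
have hp : prime_idealr_closed p.
  by move=> u v /asboolP/KM[]?; apply/orP; [left|right]; apply/asboolP.
pose J : prime_idealr Q := HB.pack_for (prime_idealr Q) (p : Q -> bool)
  (isIdealr.Build Q p h) (isPrimeIdealrClosed.Build Q p hp).
by exists J => x; split=> [/asboolP|?]; [|apply/asboolP].
Qed.

Local Notation frac := Defs.frac.

(** * Intermediate rings of a localization *)

Section Localize.
Variables (S : comNzRingType) (A B : subring S) (P : prime_idealr (subring_type A)).
Hypothesis AB : A <<= B.
Implicit Types (X Y : subring S).

Let D := prime_compl B P.

Lemma denom_base (s : denom D) : exists2 a : subring_type A, a \notin P & val a = val (dval s).
Proof. exact: denomP s. Qed.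

Lemma denom_intro (a : subring_type A) : a \notin P -> exists s : denom D, val (dval s) = val a.
Proof.
move=> aP; pose b : subring_type B := SubringElt (mem_set (AB (valP_sr a))).
have hb : mulset_set D b by exists a.
by exists (Denom (mem_set hb)).
Qed.

Lemma denom_valA (s : denom D) : val (dval s) \isin A.
Proof. by have [a _ <-] := denom_base s; exact: valP_sr. Qed.

Lemma frac_add x s y t : frac x s + frac y t = frac (dval t * x + dval s * y) (denomM s t) :> loc D.
Proof. exact: loc_addE. Qed.
Lemma frac_mul x s y t : frac x s * frac y t = frac (x * y) (denomM s t) :> loc D.
Proof. exact: loc_mulE. Qed.
Lemma frac_opp x s : - frac x s = frac (- x) s :> loc D.
Proof. exact: loc_oppE. Qed.
Lemma frac_eq x s y t : dval t * x = dval s * y -> frac x s = frac y t :> loc D.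
Proof. by move=> h; apply/eq_frac; exists (denom1 D); rewrite h subrr mulr0. Qed.

Lemma local_extension X : A <<= X -> X <<= B -> exists Y : subring (loc D), forall z,
  z \isin Y <-> exists (x : subring_type B) (s : denom D), val x \isin X /\ z = frac x s.
Proof.
move=> AX XB.
have [|z w [x [s [Xx ->]]] [y [t [Xy ->]]]|z w [x [s [Xx ->]]] [y [t [Xy ->]]]|Y eY] :=
  @subring_intro _ [set z | exists (x : subring_type B) (s : denom D), val x \isin X /\ z = frac x s].
- by exists 1, (denom1 D); split; [exact: sr1|].
- exists (dval t * x + dval s * - y), (denomM s t); rewrite frac_opp frac_add; split=> //=.
  by have := AX _ (denom_valA s); have := AX _ (denom_valA t); rewrite /=; sr.
- by exists (x * y), (denomM s t); rewrite frac_mul; split=> //=; sr.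
by exists Y => z; rewrite eY.
Qed.

Lemma chained_local X Y : chained (@local_base S A B P) [set: loc D] ->
  A <<= X -> X <<= B -> A <<= Y -> Y <<= B ->
  (forall x, x \isin X -> exists2 a : subring_type A, a \notin P & val a * x \isin Y) \/
  (forall y, y \isin Y -> exists2 a : subring_type A, a \notin P & val a * y \isin X).
Proof.
move=> [_ ch] AX XB AY YB.
have [X' hX] := local_extension AX XB; have [Y' hY] := local_extension AY YB.
have le V W V' W' : V <<= B ->
    (forall z, z \isin V' <-> exists (x : subring_type B) (s : denom D), val x \isin V /\ z = frac x s) ->
    (forall z, z \isin W' <-> exists (x : subring_type B) (s : denom D), val x \isin W /\ z = frac x s) ->
    A <<= W -> V' <<= W' ->
    forall x, x \isin V -> exists2 a : subring_type A, a \notin P & val a * x \isin W.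
  move=> VB hV hW AW VW x Vx; pose b : subring_type B := SubringElt (mem_set (VB _ Vx)).
  have : frac b (denom1 D) \isin V' by apply/hV; exists b, (denom1 D).
  move=> /VW/hW[y [s [Wy /eq_frac[u]]]] /= /(congr1 val) /=.
  rewrite mul1r => e.
  have [a aP ea] := denom_base u; have [c cP ec] := denom_base s.
  exists (a * c); first by rewrite prime_idealrM negb_or aP.
  rewrite /= in ea ec *; rewrite ea ec.
  rewrite (_ : _ * _ * x = subring_val (dval u) * subring_val y).
    by apply: srM => //; rewrite -ea; apply: AW; exact: valP_sr.
  by move/eqP: e; rewrite mulrBr subr_eq0 mulrA => /eqP.
have sub V V' : A <<= V ->
    (forall z, z \isin V' <-> exists (x : subring_type B) (s : denom D), val x \isin V /\ z = frac x s) ->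
    subexts (@local_base S A B P) [set: loc D] V'.
  by move=> AV hV; split=> // z [x [s [Ax ->]]]; apply/hV; exists x, s; split=> //; exact: AV.
case: (ch _ _ (sub _ _ AX hX) (sub _ _ AY hY)) => h; [left|right].
  exact: (le X Y X' Y').
exact: (le Y X Y' X').
Qed.

(** The property characteristic of contractions to [B] of subrings of [B_P]. *)
Definition saturated X := forall (a : subring_type A) x, a \notin P -> x \isin B ->
  val a * x \isin X -> x \isin X.

Lemma local_contraction (Z : subring (loc D)) : subexts (@local_base S A B P) [set: loc D] Z ->
  exists X, [/\ A <<= X, X <<= B, saturated X &
    forall (b : subring_type B) s, frac b s \isin Z <-> val b \isin X].
Proof.
move=> [lZ _].
have base (b : subring_type B) s : val b \isin A -> frac b s \isin Z.
  by move=> Ab; apply: lZ; exists b, s.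
(* Denominators come from [A] and have inverses in the image of [A_P], so they do not affect
   membership in [Z]. *)
have den (b : subring_type B) s : frac b s \isin Z <-> frac b (denom1 D) \isin Z.
  split=> h.
    have -> : frac b (denom1 D) = frac b s * frac (dval s) (denom1 D) :> loc D.
      by rewrite frac_mul; apply: frac_eq; rewrite /=; ring.
    by apply: srM => //; apply: base; exact: denom_valA.
  have -> : frac b s = frac b (denom1 D) * frac 1 s :> loc D.
    by rewrite frac_mul; apply: frac_eq; rewrite /=; ring.
  by apply: srM => //; apply: base; exact: sr1.
have [|x y [b [<- Wb]] [c [<- Wc]]|x y [b [<- Wb]] [c [<- Wc]]|X eX] :=
    @subring_intro _ [set s | exists b : subring_type B, val b = s /\ frac b (denom1 D) \isin Z].
- by exists 1; split=> //; exact: sr1.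
- exists (b - c); split=> //.
  have -> : frac (b - c) (denom1 D) = frac b (denom1 D) - frac c (denom1 D) :> loc D.
    by rewrite frac_opp frac_add; apply: frac_eq; rewrite /=; ring.
  by sr.
- exists (b * c); split=> //.
  have -> : frac (b * c) (denom1 D) = frac b (denom1 D) * frac c (denom1 D) :> loc D.
    by rewrite frac_mul; apply: frac_eq; rewrite /=; ring.
  by sr.
have XP (b : subring_type B) : val b \isin X <-> frac b (denom1 D) \isin Z.
  by rewrite eX; split=> [[c [/val_inj-> ]]|h] //; exists b.
exists X; split=> [x Ax|x|a x aP Bx|b s].
- by rewrite eX; exists (SubringElt (mem_set (AB Ax))); split=> //; exact: base.
- by rewrite eX => -[b [<- _]]; exact: valP_sr.
- pose b : subring_type B := SubringElt (mem_set Bx).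
  have [s es] := denom_intro aP.
  rewrite (_ : val a * x = val (dval s * b)); last by rewrite -es.
  move=> /XP h; apply/(XP b)/(den b s).
  have -> : frac b s = frac (dval s * b) (denom1 D) * frac 1 (denomM s s) :> loc D.
    by rewrite frac_mul; apply: frac_eq; rewrite /=; ring.
  by apply: srM => //; apply: base; exact: sr1.
by rewrite den XP.
Qed.

End Localize.

Section Arithmetic.
Variables (S : comNzRingType) (R : subring S).
Hypothesis fcpR : fcp R [set: S].
Implicit Types (A B T U V W X Y : subring S) (x y b e u v : S).

Lemma subset_sumring U V : U <<= V -> sumring U V.
Proof.
move=> UV u v Uu Vv; exists 0, (u * v); split; [exact: sr0| |by rewrite add0r].
by apply: srM => //; exact: UV.
Qed.

(** Localize at the prime of [A] under the common conductor: elements of [A] outside it are units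
    modulo the conductor, so comparability of the localizations of [U] and [V] descends to [U] and
    [V]. *)
Lemma arithmetic_delta A B : R <<= A -> A <<= B -> rel_integral A B ->
  arithmetic A B -> delta A B.
Proof.
move=> RA AB IB ar; apply/deltaP; apply: (sumring_local fcpR RA).
move=> T U V AT UB VB mU mV; have RT : R <<= T by move=> x /RA /AT.
have I W : W <<= B -> rel_integral T W.
  by move=> WB x /WB /IB; exact: integral_sub_closure.
have IU := I _ UB; have IV := I _ VB.
have [TU _ _] := mU; have [TV _ _] := mV.
have [sM|[m [n [Mm Nn e]]]] := cond_dichotomy fcpR RT mU IU mV IV; last first.
  exact: (comax_sumring TU TV Mm Nn e).
have [|h|a u v hu hv|a b hab|P hP] :=
  @prime_ideal_intro _ [set a : subring_type A | conductor T U (val a)].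
- exact: cond0.
- exact: (mini_cond1 mU h).
- rewrite /=; apply: condD => //; apply: condMl => //.
  exact/TU/AT/valP_sr.
- rewrite /= in hab *; have [Ma|[a' Ta' Ma]] := mini_cond fcpR RT mU IU (AT _ (valP_sr a)); first by left.
  right; rewrite (_ : subring_val b = (1 - val a * a') * val b + a' * (subring_val a * subring_val b)).
    apply: condD; last by apply: condMl => //; exact: TU.
    by apply: condMr => //; apply/TU/AT/valP_sr.
  by rewrite /=; ring.
have unit X Y : mini T X -> same_cond T U X -> X <<= B -> T <<= Y ->
    (forall x, x \isin X -> exists2 a : subring_type A, a \notin P & val a * x \isin Y) -> X <<= Y.
  move=> mX sX XB TY h x Xx; have [a aP Yax] := h x Xx; have Ta := AT _ (valP_sr a).
  have [Ma|[a' Ta' Ma]] := mini_cond fcpR RT mX (I _ XB) Ta.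
    by move/negP: aP; case; apply/hP/sX.
  rewrite (_ : x = (1 - val a * a') * x + a' * (val a * x)); last by ring.
  by have := TY _ (Ma _ Xx); have := TY _ Ta'; sr.
have AU : A <<= U by move=> x /AT /TU.
have AV : A <<= V by move=> x /AT /TV.
case: (chained_local (ar P) AU UB AV VB) => h.
  by apply: subset_sumring; exact: unit h.
by apply/sumring_sym/subset_sumring; exact: unit h.
Qed.

(** Over the intersection [T] of incomparable [X] and [Y], take minimal [U] in [X] and [V] in [Y].
    With equal conductors [field_pair_eq] gives [U = V], hence [U] inside [T]. Comaximal conductors
    would split 1 by elements of [A] in a way that primality of [P] forbids. *)
Lemma delta_saturated A B (P : prime_idealr (subring_type A)) X Y :
  R <<= A -> A <<= B -> rel_integral A B -> tclosed A B -> delta A B ->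
  A <<= X -> X <<= B -> saturated B P X -> A <<= Y -> Y <<= B -> saturated B P Y ->
  X <<= Y \/ Y <<= X.
Proof.
move=> RA AB IB tA dAB AX XB satX AY YB satY; apply: contrapT => /not_orP[nXY nYX].
have [T hT] := inter_subring X Y.
have AT : A <<= T by move=> a Aa; apply/hT; split; [exact: AX|exact: AY].
have TX : T <<= X by move=> x /hT[].
have TY : T <<= Y by move=> x /hT[].
have RT : R <<= T by move=> x /RA /AT.
have [|U [mU UX]] := mini_exists fcpR RT TX; first by move=> XT; apply: nXY => x /XT /TY.
have [|V [mV VY]] := mini_exists fcpR RT TY; first by move=> YT; apply: nYX => x /YT /TX.
have UB : U <<= B by move=> x /UX /XB.
have VB : V <<= B by move=> x /VY /YB.
have AU : A <<= U by case: mU => TU _ _ x /AT /TU.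
have AV : A <<= V by case: mV => TV _ _ x /AT /TV.
have TB : T <<= B by move=> x /TX /XB.
have I W : W <<= B -> rel_integral T W.
  by move=> WB x /WB /IB; exact: integral_sub_closure.
have tT : tclosed T B by exact: (tclosed_up fcpR RA AT TB IB tA).
have fld W : mini T W -> W <<= B -> residue_field T W.
  move=> mW WB; apply: (tclosed_field fcpR RT mW (I _ WB)).
  by move=> b r /WB Bb; exact: tT.
have sUV : sumring U V by apply: ((deltaP A B).1 dAB).
have [TU nUT _] := mU; have [TV nVT _] := mV.
have UV : U <> V.
  by move=> e; apply: nUT => x Ux; apply/hT; split; [exact: UX|apply: VY; rewrite -e].
apply: UV; apply: (field_pair_eq fcpR RT mU (I _ UB) mV (I _ VB) (fld _ mU UB) (fld _ mV VB)) => //.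
have [//|[m [n [Mm Nn emn]]]] := cond_dichotomy fcpR RT mU (I _ UB) mV (I _ VB); exfalso.
have inP (a : subring_type A) W : T <<= W -> ~ W <<= T -> W <<= X \/ W <<= Y ->
    W <<= B -> conductor T W (val a) -> a \in P.
  move=> TW nWT hW WB Ma; apply: contrapT => /negP aP; apply: nWT => w Ww.
  have /hT[Xaw Yaw] := Ma _ Ww; apply/hT.
  by split; [apply: (satX a)|apply: (satY a)] => //; exact: WB.
have rad := seminormal_radical AB (tclosed_seminormal tA).
(* [k e] is idempotent modulo the conductor of [A] in [B], so t-closedness moves it from [T] down to
   [A], where [P] lives. *)
have idem k : k \isin T -> exists e (f : subring_type A), [/\ e \isin T, val f = k * e &
    conductor A B (k * (1 - val f))].
  move=> Tk; have [e Te h] := cond_vnr fcpR RA AT TB IB rad Tk.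
  have Bk := TB _ Tk; have Be := TB _ Te.
  have Af : k * e \isin A.
    apply: (tclosed_idem tA); first by sr.
    rewrite (_ : _ - _ = - (k * (1 - k * e)) * e); last by ring.
    by apply: condMr => //; exact: condN.
  by exists e, (SubringElt (mem_set Af)).
have Tm := cond_base Mm; have Tn := cond_base Nn.
have [e [f [Te ef hf]]] := idem _ Tm; have [e' [g [Te' eg hg]]] := idem _ Tn.
have Pf : f \in P.
  by apply: (inP f U) => //; [left|rewrite ef; apply: condMr => //; exact: TU].
have Pg : g \in P.
  by apply: (inP g V) => //; [right|rewrite eg; apply: condMr => //; exact: TV].
have nP h : h \in P -> (1 - h) \notin P.
  by move=> Ph; apply/negP => Ph'; have := rpredD Ph Ph'; rewrite addrC subrK idealr1.
(* [m (1 - f)] and [n (1 - g)] are in the conductor of [A] in [B], and [m + n = 1]. *)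
have : (1 - f) * (1 - g) \in P.
  apply: (inP _ U) => //; first by left.
  have hc : conductor A B (val ((1 - f) * (1 - g))).
    rewrite /= (_ : _ * _ = (m * (1 - val f)) * (1 - val g) + (n * (1 - val g)) * (1 - val f)).
      by have := AB _ (valP_sr f); have := AB _ (valP_sr g) => ? ?; apply: condD; apply: condMr => //; sr.
    by rewrite -[LHS]mul1r -emn /=; ring.
  by move=> u Uu; apply/AT/hc/UB.
by rewrite prime_idealrM (negbTE (nP _ Pf)) (negbTE (nP _ Pg)).
Qed.

Lemma delta_arithmetic A B : R <<= A -> A <<= B -> rel_integral A B -> tclosed A B ->
  delta A B -> arithmetic A B.
Proof.
move=> RA AB IB tA dAB P; split=> // Z W hZ hW.
have [X [AX XB satX hX]] := local_contraction AB hZ.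
have [Y [AY YB satY hY]] := local_contraction AB hW.
case: (delta_saturated RA AB IB tA dAB AX XB satX AY YB satY) => h; [left|right] => z.
  by have [x [s ->]] := fracP z; move=> /hX/h/hY.
by have [x [s ->]] := fracP z; move=> /hY/h/hX.
Qed.

End Arithmetic.

Lemma compositum_sum (S : comNzRingType) (U V : subring S) : sumring U V ->
  forall x, x \isin compositum U V -> exists u v, [/\ u \isin U, v \isin V & x = u + v].
Proof.
move=> /sumringP[W hW] x hx; apply/hW; have [_ _ least] := compositum_sup U V.
apply: (least W _ _ _ hx) => y hy; apply/hW.
  by exists y, 0; split=> //; [exact: sr0|rewrite addr0].
by exists 0, y; split=> //; [exact: sr0|rewrite add0r].
Qed.

Theorem theorem4p28 (S : comNzRingType) (R : subring S)
    (properRS : (R : set S) `<` [set: S])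
    (fcpRS : fcp R [set: S]) :
  let Rbar := integral_closure R in
  let Rplus := seminormalization R Rbar in
  let Rt := tclosure R Rbar in
  (delta R [set: S] <->
     [/\ delta R Rplus, delta Rplus Rt & delta Rt Rbar] /\
     (forall T U V : subring S,
        subexts R Rbar T -> subexts R Rbar U -> subexts R Rbar V ->
        minimal T U -> minimal T V ->
        (exists k l : ext_type, [/\ k <> l, of_type k T U & of_type l T V]) ->
        B2 T (compositum U V)))
  /\ (delta Rt Rbar <-> arithmetic Rt Rbar).
Proof.
move=> Rbar Rplus Rt.
have RRbar : R <<= Rbar by exact: integral_base.
have IR : rel_integral R Rbar by [].
have [[RRp RpRbar] snRp leastP] := seminormalization_least RRbar.
have [[RRt RtRbar] tRt leastT] := tclosure_least RRbar.
have RpRt : Rplus <<= Rt by apply: leastP => //; exact: tclosed_seminormal.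
have IRt : rel_integral Rt Rbar by move=> x /IR; exact: integral_sub_closure.
split; last first.
  split; first exact: (delta_arithmetic fcpRS RRt).
  exact: (arithmetic_delta fcpRS RRt).
split=> [/deltaTP dR|[[dRp dpt dtb] H]].
  split.
    split; apply/deltaP => T U lT _ lU _; apply: dR => //.
    - by move=> x /RRp /lT.
    - by move=> x /RRp /lU.
    - by move=> x /RRt /lT.
    - by move=> x /RRt /lU.
  move=> T U V [RT TR] [RU UR] [RV VR] /miniP mU /miniP mV [k [l [nkl tU tV]]].
  have [TU _ _] := mU; have [TV _ _] := mV.
  have sUV := dR _ _ RU RV; have [UX VX _] := compositum_sup U V.
  have IU := rel_integralS RT UR IR; have IV := rel_integralS RT VR IR.
  have rU := of_type_residual TU tU; have rV := of_type_residual TV tV.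
  apply: (four_B2 mU mV) => //; first exact: (types_neq fcpRS RT mU IU nkl rU rV).
  by apply: (types_sum_four fcpRS RT mU IU mV IV nkl rU rV) => //; exact: compositum_sum.
apply: (delta_total fcpRS); apply: (delta_integral fcpRS RRp RpRt RtRbar) => //.
- by move=> T RT TR sT; exact: leastP.
- by move=> T RT TR sT; exact: leastT.
move=> T U V k l RT UR VR mU mV nkl rU rV.
have [TU _ _] := mU; have [TV _ _] := mV.
have IU := rel_integralS RT UR IR; have IV := rel_integralS RT VR IR.
have [UX VX _] := compositum_sup U V.
apply: (types_four_sum fcpRS RT mU IU mV IV nkl rU rV UX VX).
apply: (B2_four mU mV) => //; first exact: (types_neq fcpRS RT mU IU nkl rU rV).
apply: H; try exact/miniP.
- by split=> // x /TU /UR.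
- by split=> // x /RT /TU.
- by split=> // x /RT /TV.
by exists k, l; split=> //; exact: (residual_of_type fcpRS).
Qed.
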